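(* Let $\mathcal{P}=He_1\oplus He_2$ be the free left $H$-module of rank two with basis $e_1,e_2$, equipped with an $H$-pseudoalgebra structure such that $$e_{1}\ast e_{1}=t_{1}\otimes1 \otimes_{H}e_{1}, \quad e_{2}\ast e_{2}=(1\otimes s+t_{2})\otimes_{H}e_{2},$$ where $t_{1}, t_{2}\in\mathbf{k}$ and $s\in\delta$ are nonzero (and $e_1\ast e_2$, $e_2\ast e_1$ are arbitrary elements of $(H\otimes H)\otimes_H\mathcal{P}$). Then $\mathcal{P}$ is a left pre-Lie $H$-pseudoalgebra if and only if it is of one of the following types: (1) $e_{1}\ast e_{2}=0$, $e_{2}\ast e_{1}=0$; (2) $e_{1}\ast e_{2}=0$, $e_{2}\ast e_{1}=1\otimes s\otimes_{H}e_{1}$; (3) $e_{1}\ast e_{2}=t_{1}\otimes1\otimes_{H}e_{2}$, $e_{2}\ast e_{1}=1\otimes s\otimes_{H}e_{1}+t_{1}\otimes1\otimes_{H}e_{2}$; (4) $e_{1}\ast e_{2}=t_{2}\otimes1\otimes_{H}e_{1}$, $e_{2}\ast e_{1}=(1\otimes s+t_{2})\otimes_{H}e_{1}$; (5) $e_{1}\ast e_{2}=(1\otimes s+t_{2})\otimes_{H}e_{1}$, $e_{2}\ast e_{1}=(1\otimes s+s\otimes1+t_{2})\otimes_{H}e_{1}$.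
   Context: $\mathbf{k}$ is an algebraically closed field of characteristic $0$, $\delta$ is a finite-dimensional Lie algebra over $\mathbf{k}$, and $H=U(\delta)$ is its universal enveloping algebra with the standard cocommutative Hopf structure ($\Delta(x)=x\otimes1+1\otimes x$ for $x\in\delta$). We regard $\mathbf{k},\delta\subset H$. $H^{\otimes n}$ is a right $H$-module via the iterated coproduct, e.g. $(f\otimes g)\cdot h=(f\otimes g)\Delta(h)$. An $H$-pseudoalgebra is a left $H$-module $A$ with a map $\ast:A\otimes A\to(H\otimes H)\otimes_H A$ that is $H$-bilinear: $hx\ast gy=(h\otimes g\otimes_H1)(x\ast y)$ for $x,y\in A$, $h,g\in H$. For $\beta\in H\otimes H$ and $x\ast y=\sum_i\alpha_i\otimes_Hc_i$ one sets, in $H^{\otimes3}\otimes_HA$, $(\beta\otimes_Hx)\ast y=\sum_i(\beta\otimes1)(\Delta\otimes\mathrm{id})(\alpha_i)\otimes_Hc_i$ and $x\ast(\beta\otimes_Hy)=\sum_i(1\otimes\beta)(\mathrm{id}\otimes\Delta)(\alpha_i)\otimes_Hc_i$. $A$ is left pre-Lie if for all $x,y,z\in A$ $$(x\ast y)\ast z-x\ast(y\ast z)=((12)\otimes_H\mathrm{id})[(y\ast x)\ast z-y\ast(x\ast z)],$$ where $(12)(f\otimes h\otimes g)=h\otimes f\otimes g$. Conventions: a scalar $c\in\mathbf{k}$ appearing as an element of $H\otimes H$ means $c(1\otimes1)$; $f\otimes g\otimes_He$ means $(f\otimes g)\otimes_He$. By $H$-bilinearity a pseudoproduct on a free module is determined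 by its values on basis elements. *)

(* Defs.v *)
From HB Require Import structures.
From mathcomp Require Import all_boot all_order all_algebra.
From mathcomp Require Import boolp classical_sets.

Set Implicit Arguments.
Unset Strict Implicit.
Unset Printing Implicit Defensive.

Import GRing.Theory.
Local Open Scope quotient_scope.
Local Open Scope ring_scope.

Reserved Notation "x \ot y" (at level 40, left associativity).
Reserved Notation "b \otH x" (at level 40, left associativity).
Reserved Notation "b \otH3 x" (at level 40, left associativity).
Reserved Notation "x ** y" (at level 40, left associativity).

(* Balanced tensor product of a right R-module M (action ra) and a left       *)
(* R-module N (action la): formal sums of pairs, as lists, modulo the least   *)
(* congruence making the pairing biadditive and R-balanced. R is only a set   *)
(* of scalars here, so that one construction serves over k and over U(delta). *)
Section Tensor.
Variables (R : Type) (M N : zmodType) (ra : M -> R -> M) (la : R -> N -> N).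

Inductive teq : seq (M * N) -> seq (M * N) -> Prop :=
| teq_refl s : teq s s
| teq_sym s t : teq s t -> teq t s
| teq_trans t s u : teq s t -> teq t u -> teq s u
| teq_perm s t : perm_eq s t -> teq s t
| teq_cons p s t : teq s t -> teq (p :: s) (p :: t)
| teq_addl m m' n : teq [:: (m + m', n)] [:: (m, n); (m', n)]
| teq_addr m n n' : teq [:: (m, n + n')] [:: (m, n); (m, n')]
| teq_zero n : teq [:: (0, n)] [::]
| teq_bal m r n : teq [:: (ra m r, n)] [:: (m, la r n)].

Definition teqb s t : bool := `[< teq s t >].

Lemma teqb_refl : reflexive teqb.
Proof. by move=> s; apply/asboolP; apply: teq_refl. Qed.
Lemma teqb_sym : symmetric teqb.
Proof. by move=> s t; apply/asboolP/asboolP; apply: teq_sym. Qed.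
Lemma teqb_trans : transitive teqb.
Proof.
by move=> t s u /asboolP st /asboolP tu; apply/asboolP; apply: teq_trans tu.
Qed.

Canonical teqb_equiv := EquivRel teqb teqb_refl teqb_sym teqb_trans.

Definition tensor : Type := {eq_quot teqb}.
HB.instance Definition _ := Choice.on tensor.
HB.instance Definition _ := Quotient.on tensor.

Lemma tensor_eqP s t : teq s t <-> \pi_tensor s = \pi_tensor t.
Proof.
by split=> [st|/eqmodP /asboolP //]; apply/eqmodP; apply/asboolP.
Qed.

Lemma teq_repr s : teq (repr (\pi_tensor s)) s.
Proof. by apply/tensor_eqP; rewrite reprK. Qed.

Lemma teq_catl s t u : teq s t -> teq (u ++ s) (u ++ t).
Proof. by move=> st; elim: u => //= p u; apply: teq_cons. Qed.

Lemma teq_cat s s' t t' : teq s s' -> teq t t' -> teq (s ++ t) (s' ++ t').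
Proof.
move=> ss' /(teq_catl s) h; apply: teq_trans h _.
have sw a b : teq (a ++ b) (b ++ a) by apply: teq_perm; rewrite perm_catC.
apply: teq_trans (sw _ _) _; apply: teq_trans (sw _ _).
exact: teq_catl.
Qed.

Definition tnil : tensor := \pi_tensor [::].
Definition tadd (x y : tensor) : tensor := \pi_tensor (repr x ++ repr y).
Definition topp (x : tensor) : tensor :=
  \pi_tensor [seq (- p.1, p.2) | p <- repr x].

Definition tpure (m : M) (n : N) : tensor := \pi_tensor [:: (m, n)].

Lemma tadd_pi s t : tadd (\pi_tensor s) (\pi_tensor t) = \pi_tensor (s ++ t).
Proof. by apply/tensor_eqP/teq_cat; apply: teq_repr. Qed.

Lemma taddA : associative tadd.
Proof.
elim/quotW=> x; elim/quotW=> y; elim/quotW=> z.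
by rewrite (tadd_pi x y) (tadd_pi y z) (tadd_pi x) (tadd_pi _ z) catA.
Qed.

Lemma taddC : commutative tadd.
Proof.
move=> x y; apply/tensor_eqP; apply: teq_perm; by rewrite perm_catC.
Qed.

Lemma tadd0 : left_id tnil tadd.
Proof. by elim/quotW=> x; rewrite tadd_pi. Qed.

Lemma taddN : left_inverse tnil topp tadd.
Proof.
move=> x; rewrite /topp -{2}[x](@reprK _ tensor) tadd_pi; apply/tensor_eqP.
elim: (repr x) => [|[m n] s IH] /=; first exact: teq_refl.
apply: (@teq_trans ([:: (- m, n); (m, n)] ++
                    ([seq (- p.1, p.2) | p <- s] ++ s))).
  apply: teq_perm; rewrite /= perm_cons.
  by rewrite -cat1s -[X in perm_eq _ X]cat1s perm_catCA.
apply: (teq_trans (teq_cat (teq_refl _) IH)); rewrite cats0.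
apply: (teq_trans (teq_sym (teq_addl _ _ _))).
by rewrite addNr; apply: teq_zero.
Qed.

HB.instance Definition _ :=
  GRing.isZmodule.Build tensor taddA taddC tadd0 taddN.

Lemma tpureDl m m' n : tpure (m + m') n = tpure m n + tpure m' n.
Proof. by rewrite /GRing.add /= tadd_pi; apply/tensor_eqP/teq_addl. Qed.

Lemma tpureDr m n n' : tpure m (n + n') = tpure m n + tpure m n'.
Proof. by rewrite /GRing.add /= tadd_pi; apply/tensor_eqP/teq_addr. Qed.

Lemma tpure_bal m r n : tpure (ra m r) n = tpure m (la r n).
Proof. exact/tensor_eqP/teq_bal. Qed.

Lemma tensor_ind (P : tensor -> Prop) :
  P 0 -> (forall m n t, P t -> P (tpure m n + t)) -> forall t, P t.
Proof.
move=> P0 PS t; rewrite -[t]reprK; elim: (repr t) => [//|[m n] s IH].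
by have := PS m n _ IH; rewrite {1}/GRing.add /= tadd_pi.
Qed.

Section Lift.
Variables (Z : zmodType) (f : M -> N -> Z).

Definition balanced : Prop :=
  [/\ forall m m' n, f (m + m') n = f m n + f m' n,
      forall m n n', f m (n + n') = f m n + f m n' &
      forall m r n, f (ra m r) n = f m (la r n)].

(* The additive map sending tpure m n to f m n; meaningful only when f is     *)
(* balanced, see tlift_pure.                                                  *)
Definition tlift (t : tensor) : Z := \sum_(p <- repr t) f p.1 p.2.

Hypothesis fb : balanced.

Lemma tlift_pi s : tlift (\pi_tensor s) = \sum_(p <- s) f p.1 p.2.
Proof.
case: fb => fDl fDr fbal.
have f0 n : f 0 n = 0 by apply: (addrI (f 0 n)); rewrite -fDl !addr0.
suff H a b : teq a b -> \sum_(p <- a) f p.1 p.2 = \sum_(p <- b) f p.1 p.2.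
  exact/H/teq_repr.
elim=> //.
- by move=> {}a {}b c _ -> _ ->.
- by move=> {}a {}b ab; apply: perm_big.
- by move=> p {}a {}b _ IH; rewrite !big_cons IH.
- by move=> m m' n; rewrite !big_cons !big_nil /= fDl !addr0.
- by move=> m n n'; rewrite !big_cons !big_nil /= fDr !addr0.
- by move=> n; rewrite big_cons !big_nil /= f0 addr0.
- by move=> m r n; rewrite !big_cons !big_nil /= fbal.
Qed.

Lemma tlift_pure m n : tlift (tpure m n) = f m n.
Proof. by rewrite tlift_pi big_cons big_nil addr0. Qed.

Lemma tliftD s t : tlift (s + t) = tlift s + tlift t.
Proof.
rewrite -[s]reprK -[t]reprK {1}/GRing.add /= tadd_pi !tlift_pi.
by rewrite big_cat.
Qed.

Lemma tlift0 : tlift 0 = 0.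
Proof. by apply: (addrI (tlift 0)); rewrite -tliftD !addr0. Qed.

End Lift.

Lemma tensor_ext (Z : zmodType) (f g : tensor -> Z) :
  (forall s t, f (s + t) = f s + f t) -> (forall s t, g (s + t) = g s + g t) ->
  (forall m n, f (tpure m n) = g (tpure m n)) -> forall t, f t = g t.
Proof.
move=> fD gD fg; elim/tensor_ind => [|m n t IH]; last by rewrite fD gD fg IH.
have f0 : f 0 = 0 by apply: (addrI (f 0)); rewrite -fD !addr0.
have g0 : g 0 = 0 by apply: (addrI (g 0)); rewrite -gD !addr0.
by rewrite f0 g0.
Qed.

End Tensor.

Arguments tensor_ext {R M N ra la Z f g}.
Arguments tlift {R M N ra la Z} f t.


Lemma functional_exists (k : fieldType) (V : lmodType k) (v : V) : v != 0 ->
  exists phi : V -> k,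
    (forall c x y, phi (c *: x + y) = c * phi x + phi y) /\ phi v = 1.
Proof.
move=> v0.
pose P (S : set V) :=
  (forall a x y, S x -> S y -> S (a *: x + y)) /\ ~ S v.
have [F FP Ftot|A [[Acl Av] Amax]] := @Zorn_bigcup V P.
  split=> [a x y [X FX Xx] [Y FY Yy]|[X FX Xv]]; last by case: (FP _ FX).
  case: (Ftot _ _ FX FY) => [XY|YX].
    by exists Y => //; case: (FP _ FY) => + _; apply=> //; apply: XY.
  by exists X => //; case: (FP _ FX) => + _; apply=> //; apply: YX.
pose A' z := A z \/ z = 0.
have A'cl a x y : A' x -> A' y -> A' (a *: x + y).
  move=> [Ax|->] [Ay|->]; rewrite ?scaler0 ?add0r ?addr0.
  - by left; apply: Acl.
  - by have /(Acl a _ _ Ax) := Acl (-1) _ _ Ax Ax;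
      rewrite scaleN1r addNr addr0; left.
  - by left.
  - by right.
have A'v : ~ A' v by case=> // v00; rewrite v00 eqxx in v0.
have ex x : exists c, A' (x - c *: v).
  apply: contrapT => nx.
  pose B : set V := fun z => exists a, A' (z - a *: x).
  have Bcl a y z : B y -> B z -> B (a *: y + z).
    move=> [b yb] [c zc]; exists (a * b + c).
    have := A'cl a _ _ yb zc.
    by rewrite scalerBr scalerA scalerDl opprD addrACA.
  have AB : (A `<` B)%classic.
    split=> [z Az|/(_ x)]; first by exists 0; rewrite scale0r subr0; left.
    have Bx : B x by exists 1; rewrite scale1r subrr; right.
    by move=> /(_ Bx) Ax; apply: nx; exists 0; rewrite scale0r subr0; left.
  apply: (Amax _ AB); split=> // -[a va]; apply: nx; exists a^-1.
  have a0 : a != 0.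
    by apply/eqP => a0; apply: A'v; rewrite a0 scale0r subr0 in va.
  have := A'cl (- a^-1) _ _ va (or_intror erefl).
  by rewrite addr0 scalerBr !scaleNr scalerA mulVf // scale1r opprK addrC.
have uniq x c d : A' (x - c *: v) -> A' (x - d *: v) -> c = d.
  move=> xc xd; apply: contrapT => /eqP cd; apply: A'v.
  have dc0 : d - c != 0 by rewrite subr_eq0 eq_sym.
  have := A'cl (-1) _ _ xd xc.
  rewrite scaleN1r opprB addrA subrK -scalerBl => h.
  have := A'cl (d - c)^-1 _ _ h (or_intror erefl).
  by rewrite addr0 scalerA mulVf // scale1r.
have [phi phiP] := choice ex.
exists phi; split=> [c x y|].
  apply: uniq (phiP _) _; have := A'cl c _ _ (phiP x) (phiP y).
  by rewrite scalerBr scalerA scalerDl opprD addrACA.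
by apply: uniq (phiP v) _; rewrite scale1r subrr; right.
Qed.

Section TensorAlgebra.
Variables (k : fieldType) (A B : algType k).

Definition kra (a : A) (c : k) : A := c *: a.
Definition kla (c : k) (b : B) : B := c *: b.

Definition tens : Type := tensor kra kla.
HB.instance Definition _ := GRing.Zmodule.on tens.

Definition tenp (a : A) (b : B) : tens := @tpure k A B kra kla a b.
Local Notation "a \ot b" := (tenp a b) : ring_scope.

Lemma tenpDl a a' b : (a + a') \ot b = a \ot b + a' \ot b.
Proof. exact: tpureDl. Qed.
Lemma tenpDr a b b' : a \ot (b + b') = a \ot b + a \ot b'.
Proof. exact: tpureDr. Qed.
Lemma tenpZ c a b : (c *: a) \ot b = a \ot (c *: b).
Proof. exact: tpure_bal. Qed.

Definition tens_balanced (Z : zmodType) (f : A -> B -> Z) : Prop :=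
  balanced kra kla f.
Definition tens_lift (Z : zmodType) (f : A -> B -> Z) : tens -> Z :=
  @tlift k A B kra kla Z f.

Lemma tens_liftE Z f a b : tens_balanced f ->
  @tens_lift Z f (a \ot b) = f a b.
Proof. by move=> fb; apply: tlift_pure fb a b. Qed.
Lemma tens_liftD Z f s t : tens_balanced f ->
  @tens_lift Z f (s + t) = tens_lift f s + tens_lift f t.
Proof. by move=> fb; apply: tliftD fb s t. Qed.
Lemma tens_lift0 Z f : tens_balanced f -> @tens_lift Z f 0 = 0.
Proof. by move=> fb; apply: tlift0 fb. Qed.

Definition tens_scale (c : k) : tens -> tens :=
  tens_lift (fun a b => (c *: a) \ot b).

Lemma tens_scale_bal c :
  tens_balanced
    (fun a b => (c *: a) \ot b).
Proof.
split=> [a a' b|a b b'|a d b]; first by rewrite scalerDr tenpDl.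
  by rewrite tenpDr.
by rewrite -tenpZ !scalerA mulrC.
Qed.

Lemma tens_scaleE c a b : tens_scale c (a \ot b) = (c *: a) \ot b.
Proof. exact: tens_liftE _ _ (tens_scale_bal c). Qed.

Lemma tens_scaleD c s t : tens_scale c (s + t) = tens_scale c s + tens_scale c t.
Proof. exact: tens_liftD _ _ (tens_scale_bal c). Qed.

Lemma tens_scaleA c d t : tens_scale c (tens_scale d t) = tens_scale (c * d) t.
Proof.
move: t; apply: tensor_ext => [s t|s t|a b]; rewrite ?tens_scaleD //.
by rewrite -/(a \ot b) !tens_scaleE scalerA.
Qed.

Lemma tens_scale1 : left_id 1 tens_scale.
Proof.
apply: tensor_ext => [s t|s t|a b]; rewrite ?tens_scaleD //.
by rewrite -/(a \ot b) !tens_scaleE scale1r.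
Qed.

Lemma tens_scaleDr : right_distributive tens_scale +%R.
Proof. exact: tens_scaleD. Qed.

Lemma tens_scaleDl t : {morph tens_scale^~ t : c d / c + d}.
Proof.
move=> c d; move: t; apply: tensor_ext => [s t|s t|a b].
- by rewrite tens_scaleD.
- by rewrite !tens_scaleD addrACA.
by rewrite -/(a \ot b) !tens_scaleE scalerDl tenpDl.
Qed.

HB.instance Definition _ := GRing.Zmodule_isLmodule.Build k tens
  tens_scaleA tens_scale1 tens_scaleDr tens_scaleDl.

Lemma tenpZl c a b : c *: (a \ot b) = (c *: a) \ot b.
Proof. exact: tens_scaleE. Qed.
Lemma tenpZr c a b : c *: (a \ot b) = a \ot (c *: b).
Proof. by rewrite tenpZl tenpZ. Qed.

Lemma tens_ext (Z : zmodType) (f g : tens -> Z) :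
  (forall s t, f (s + t) = f s + f t) -> (forall s t, g (s + t) = g s + g t) ->
  (forall a b, f (a \ot b) = g (a \ot b)) -> forall t, f t = g t.
Proof. exact: tensor_ext. Qed.

Definition tens_mul (s t : tens) : tens :=
  tens_lift (fun a b => tens_lift (fun c d => (a * c) \ot (b * d)) t) s.

Lemma tens_mul_bal a b :
  tens_balanced
    (fun c d => (a * c) \ot (b * d)).
Proof.
split=> [c c' d|c d d'|c e d]; rewrite ?mulrDr ?tenpDl ?tenpDr //.
by rewrite -!scalerAr -tenpZl tenpZr.
Qed.

Lemma tens_mul_bal2 t :
  tens_balanced
    (fun a b => tens_lift (fun c d => (a * c) \ot (b * d)) t : tens).
Proof.
split=> [a a' b|a b b'|a e b]; move: t; apply: tens_ext => [s t|s t|c d];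
  rewrite ?(tens_liftD _ _ (tens_mul_bal _ _)) ?(tens_liftE _ _ (tens_mul_bal _ _)) //.
- by rewrite addrACA.
- by rewrite mulrDl tenpDl.
- by rewrite addrACA.
- by rewrite mulrDl tenpDr.
by rewrite -!scalerAl -tenpZl tenpZr.
Qed.

Lemma tens_mulE a b c d : tens_mul (a \ot b) (c \ot d) = (a * c) \ot (b * d).
Proof.
rewrite /tens_mul (tens_liftE _ _ (tens_mul_bal2 _)).
exact: tens_liftE _ _ (tens_mul_bal a b).
Qed.

Lemma tens_mulDl : left_distributive tens_mul +%R.
Proof. by move=> s s' t; apply: tens_liftD _ _ (tens_mul_bal2 t). Qed.

Lemma tens_mulDr : right_distributive tens_mul +%R.
Proof.
move=> s t t'; move: s; apply: tens_ext => [s s'|s s'|a b].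
- by rewrite tens_mulDl.
- by rewrite !tens_mulDl addrACA.
rewrite /tens_mul !(tens_liftE _ _ (tens_mul_bal2 _)).
exact: tens_liftD _ _ (tens_mul_bal a b).
Qed.

Lemma tens_mulA : associative tens_mul.
Proof.
move=> s t u; move: s; apply: tens_ext => [s s'|s s'|a b];
  rewrite ?tens_mulDl //.
move: t; apply: tens_ext => [t t'|t t'|a' b'];
  rewrite ?(tens_mulDl, tens_mulDr) //.
move: u; apply: tens_ext => [u u'|u u'|c d]; rewrite ?(tens_mulDr) //.
by rewrite !tens_mulE !mulrA.
Qed.

Lemma tens_mul1l : left_id (1 \ot 1) tens_mul.
Proof.
apply: tens_ext => [s t|s t|a b]; rewrite ?tens_mulDr //.
by rewrite tens_mulE !mul1r.
Qed.

Lemma tens_mul1r : right_id (1 \ot 1) tens_mul.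
Proof.
apply: tens_ext => [s t|s t|a b]; rewrite ?tens_mulDl //.
by rewrite tens_mulE !mulr1.
Qed.

Lemma tens_1neq0 : 1 \ot 1 != 0 :> tens.
Proof.
have [phi [phiP phi1]] := functional_exists (oner_neq0 A).
have phiD x y : phi (x + y) = phi x + phi y.
  by have := phiP 1 x y; rewrite scale1r mul1r.
have phi0 : phi 0 = 0 by apply: (addrI (phi 0)); rewrite -phiD !addr0.
have phiZ c x : phi (c *: x) = c * phi x.
  by have := phiP c x 0; rewrite phi0 !addr0.
have fb : tens_balanced (fun a b => phi a *: b).
  split=> [a a' b|a b b'|a c b]; first by rewrite phiD scalerDl.
    by rewrite scalerDr.
  by rewrite phiZ scalerA mulrC.
apply/eqP => /(congr1 (tens_lift (fun a b => phi a *: b))).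
rewrite (tens_liftE _ _ fb) (tens_lift0 fb) phi1 scale1r.
by apply/eqP/oner_neq0.
Qed.

HB.instance Definition _ := GRing.Zmodule_isNzRing.Build tens
  tens_mulA tens_mul1l tens_mul1r tens_mulDl tens_mulDr tens_1neq0.

Lemma tenpM a b c d : (a \ot b) * (c \ot d) = (a * c) \ot (b * d).
Proof. exact: tens_mulE. Qed.

Lemma tenp1 : 1 \ot 1 = 1 :> tens. Proof. by []. Qed.

Lemma tens_scalerAl c (s t : tens) : c *: (s * t) = (c *: s) * t.
Proof.
move: s; apply: tens_ext => [s s'|s s'|a b]; rewrite ?(mulrDl, scalerDr) //.
move: t; apply: tens_ext => [t t'|t t'|a' b']; rewrite ?(mulrDr, scalerDr) //.
by rewrite tenpM !tenpZl tenpM scalerAl.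
Qed.
HB.instance Definition _ := GRing.Lmodule_isLalgebra.Build k tens tens_scalerAl.

Lemma tens_scalerAr c (s t : tens) : c *: (s * t) = s * (c *: t).
Proof.
move: s; apply: tens_ext => [s s'|s s'|a b]; rewrite ?(mulrDl, scalerDr) //.
move: t; apply: tens_ext => [t t'|t t'|a' b']; rewrite ?(mulrDr, scalerDr) //.
by rewrite tenpM !tenpZl tenpM scalerAr.
Qed.
HB.instance Definition _ := GRing.Lalgebra_isAlgebra.Build k tens tens_scalerAr.

End TensorAlgebra.

Arguments tens_ext {k A B Z f g}.

Notation "a \ot b" := (tenp a b) : ring_scope.

HB.mixin Record isLie (k : fieldType) L of GRing.Lmodule k L := {
  lie : L -> L -> L;
  lie_linear_l : forall c x y z, lie (c *: x + y) z = c *: lie x z + lie y z;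
  lie_linear_r : forall c x y z, lie z (c *: x + y) = c *: lie z x + lie z y;
  lie_alt : forall x, lie x x = 0;
  lie_jacobi : forall x y z,
    lie x (lie y z) + lie y (lie z x) + lie z (lie x y) = 0
}.

#[short(type="lieAlgType")]
HB.structure Definition LieAlgebra (k : fieldType) :=
  { L of GRing.Lmodule k L & isLie k L }.

#[short(type="finLieAlgType")]
HB.structure Definition FinLieAlgebra (k : fieldType) :=
  { L of LieAlgebra k L & Vector k L }.

(* The universal enveloping algebra, presented as the k-algebra generated by  *)
(* L subject to linearity of L -> U(L) and [x, y] = x y - y x: expressions    *)
(* modulo the least congruence containing these relations and the axioms of   *)
(* k-algebras. Its universal property is U_lift_morph and U_lift_uniq.        *)
Section Envelope.
Variables (k : fieldType) (L : lieAlgType k).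

Inductive uexpr : Type :=
| UScal (c : k)
| UGen (x : L)
| UAdd (a b : uexpr)
| UMul (a b : uexpr).

HB.instance Definition _ := gen_eqMixin uexpr.
HB.instance Definition _ := gen_choiceMixin uexpr.

Inductive ueq : uexpr -> uexpr -> Prop :=
| ueq_refl a : ueq a a
| ueq_sym a b : ueq a b -> ueq b a
| ueq_trans b a c : ueq a b -> ueq b c -> ueq a c
| ueq_add a a' b b' : ueq a a' -> ueq b b' -> ueq (UAdd a b) (UAdd a' b')
| ueq_mul a a' b b' : ueq a a' -> ueq b b' -> ueq (UMul a b) (UMul a' b')
| ueq_addA a b c : ueq (UAdd a (UAdd b c)) (UAdd (UAdd a b) c)
| ueq_addC a b : ueq (UAdd a b) (UAdd b a)
| ueq_add0 a : ueq (UAdd (UScal 0) a) a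
| ueq_addN a : ueq (UAdd (UMul (UScal (-1)) a) a) (UScal 0)
| ueq_mulA a b c : ueq (UMul a (UMul b c)) (UMul (UMul a b) c)
| ueq_mul1 a : ueq (UMul (UScal 1) a) a
| ueq_mulDl a b c : ueq (UMul (UAdd a b) c) (UAdd (UMul a c) (UMul b c))
| ueq_mulDr a b c : ueq (UMul a (UAdd b c)) (UAdd (UMul a b) (UMul a c))
| ueq_scalD c d : ueq (UScal (c + d)) (UAdd (UScal c) (UScal d))
| ueq_scalM c d : ueq (UScal (c * d)) (UMul (UScal c) (UScal d))
| ueq_scalC c a : ueq (UMul (UScal c) a) (UMul a (UScal c))
| ueq_genD x y : ueq (UGen (x + y)) (UAdd (UGen x) (UGen y))
| ueq_genZ c x : ueq (UGen (c *: x)) (UMul (UScal c) (UGen x))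
| ueq_lie x y : ueq (UAdd (UGen (lie x y)) (UMul (UGen y) (UGen x)))
                    (UMul (UGen x) (UGen y)).

Definition ueqb a b : bool := `[< ueq a b >].

Lemma ueqb_refl : reflexive ueqb.
Proof. by move=> s; apply/asboolP; apply: ueq_refl. Qed.
Lemma ueqb_sym : symmetric ueqb.
Proof. by move=> s t; apply/asboolP/asboolP; apply: ueq_sym. Qed.
Lemma ueqb_trans : transitive ueqb.
Proof.
by move=> t s u /asboolP st /asboolP tu; apply/asboolP; apply: ueq_trans tu.
Qed.

Canonical ueqb_equiv := EquivRel ueqb ueqb_refl ueqb_sym ueqb_trans.

Definition Uenv : Type := {eq_quot ueqb}.
HB.instance Definition _ := Choice.on Uenv.
HB.instance Definition _ := Quotient.on Uenv.

Lemma Uenv_eqP a b : ueq a b <-> \pi_Uenv a = \pi_Uenv b.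
Proof. by split=> [st|/eqmodP /asboolP //]; apply/eqmodP; apply/asboolP. Qed.

Lemma ueq_repr a : ueq (repr (\pi_Uenv a)) a.
Proof. by apply/Uenv_eqP; rewrite reprK. Qed.

Definition Uscal (c : k) : Uenv := \pi_Uenv (UScal c).
Definition Ugen (x : L) : Uenv := \pi_Uenv (UGen x).
Definition Uadd (u v : Uenv) : Uenv := \pi_Uenv (UAdd (repr u) (repr v)).
Definition Umul (u v : Uenv) : Uenv := \pi_Uenv (UMul (repr u) (repr v)).
Definition Uopp (u : Uenv) : Uenv := Umul (Uscal (-1)) u.

Lemma Uadd_pi a b : Uadd (\pi_Uenv a) (\pi_Uenv b) = \pi_Uenv (UAdd a b).
Proof. by apply/Uenv_eqP/ueq_add; apply: ueq_repr. Qed.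
Lemma Umul_pi a b : Umul (\pi_Uenv a) (\pi_Uenv b) = \pi_Uenv (UMul a b).
Proof. by apply/Uenv_eqP/ueq_mul; apply: ueq_repr. Qed.

Lemma UaddA : associative Uadd.
Proof.
elim/quotW=> a; elim/quotW=> b; elim/quotW=> c.
rewrite (Uadd_pi b c) (Uadd_pi a b) (Uadd_pi a) (Uadd_pi _ c).
exact/Uenv_eqP/ueq_addA.
Qed.
Lemma UaddC : commutative Uadd.
Proof. by move=> u v; apply/Uenv_eqP/ueq_addC. Qed.
Lemma Uadd0 : left_id (Uscal 0) Uadd.
Proof. elim/quotW=> a; rewrite Uadd_pi; exact/Uenv_eqP/ueq_add0. Qed.
Lemma UaddN : left_inverse (Uscal 0) Uopp Uadd.
Proof.
elim/quotW=> a; rewrite /Uopp Umul_pi (Uadd_pi _ a).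
exact/Uenv_eqP/ueq_addN.
Qed.

HB.instance Definition _ :=
  GRing.isZmodule.Build Uenv UaddA UaddC Uadd0 UaddN.

Lemma UmulA : associative Umul.
Proof.
elim/quotW=> a; elim/quotW=> b; elim/quotW=> c.
rewrite (Umul_pi b c) (Umul_pi a b) (Umul_pi a) (Umul_pi _ c).
exact/Uenv_eqP/ueq_mulA.
Qed.
Lemma Umul1l : left_id (Uscal 1) Umul.
Proof. elim/quotW=> a; rewrite Umul_pi; exact/Uenv_eqP/ueq_mul1. Qed.
Lemma UscalC c u : Umul (Uscal c) u = Umul u (Uscal c).
Proof. elim/quotW: u => a; rewrite !Umul_pi; exact/Uenv_eqP/ueq_scalC. Qed.
Lemma Umul1r : right_id (Uscal 1) Umul.
Proof. by move=> u; rewrite -UscalC Umul1l. Qed.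
Lemma UmulDl : left_distributive Umul +%R.
Proof.
elim/quotW=> a; elim/quotW=> b; elim/quotW=> c; rewrite /GRing.add /=.
rewrite (Uadd_pi a b) (Umul_pi _ c) (Umul_pi a) (Umul_pi b).
rewrite (Uadd_pi (UMul a c)); exact/Uenv_eqP/ueq_mulDl.
Qed.
Lemma UmulDr : right_distributive Umul +%R.
Proof.
elim/quotW=> a; elim/quotW=> b; elim/quotW=> c; rewrite /GRing.add /=.
rewrite (Uadd_pi b c) (Umul_pi a) (Umul_pi a b) (Umul_pi a c).
rewrite (Uadd_pi (UMul a b)); exact/Uenv_eqP/ueq_mulDr.
Qed.

Section Eval.
Variables (B : algType k) (f : L -> B).

Fixpoint ueval (a : uexpr) : B :=
  match a with
  | UScal c => c%:A
  | UGen x => f x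
  | UAdd a b => ueval a + ueval b
  | UMul a b => ueval a * ueval b
  end.

Definition U_lift (u : Uenv) : B := ueval (repr u).

Definition lie_morph : Prop :=
  (forall c x y, f (c *: x + y) = c *: f x + f y) /\
  (forall x y, f (lie x y) = f x * f y - f y * f x).

Hypothesis fL : lie_morph.

Lemma ueval_ueq a b : ueq a b -> ueval a = ueval b.
Proof.
case: fL => flin flie.
have fD x y : f (x + y) = f x + f y.
  by have := flin 1 x y; rewrite !scale1r.
have f0 : f 0 = 0 by apply: (addrI (f 0)); rewrite -fD !addr0.
have fZ c x : f (c *: x) = c *: f x.
  by have := flin c x 0; rewrite f0 !addr0.
elim=> //=.
- by move=> {}b {}a c _ -> _ ->.
- by move=> {}a a' {}b b' _ -> _ ->.
- by move=> {}a a' {}b b' _ -> _ ->.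
- by move=> {}a {}b c; rewrite addrA.
- by move=> {}a {}b; rewrite addrC.
- by move=> {}a; rewrite scale0r add0r.
- by move=> {}a; rewrite scale0r mulr_algl scaleN1r addNr.
- by move=> {}a {}b c; rewrite mulrA.
- by move=> {}a; rewrite mulr_algl scale1r.
- by move=> {}a {}b c; rewrite mulrDl.
- by move=> {}a {}b c; rewrite mulrDr.
- by move=> c d; rewrite scalerDl.
- by move=> c d; rewrite mulr_algl scalerA.
- by move=> c {}a; rewrite mulr_algl mulr_algr.
- by move=> c x; rewrite fZ mulr_algl.
- by move=> x y; rewrite flie subrK.
Qed.

Lemma U_lift_pi a : U_lift (\pi_Uenv a) = ueval a.
Proof. exact/ueval_ueq/ueq_repr. Qed.

End Eval.

Lemma Uone_neq0 : Uscal 1 != 0.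
Proof.
apply/eqP => /Uenv_eqP /(@ueval_ueq (k^o)%type (fun=> 0)) /= h.
have /h/eqP : lie_morph (B := (k^o)%type) (fun=> 0).
  by split=> [c x y|x y]; rewrite ?scaler0 ?addr0 ?mulr0 ?subr0.
by rewrite scale0r scale1r oner_eq0.
Qed.

HB.instance Definition _ := GRing.Zmodule_isNzRing.Build Uenv
  UmulA Umul1l Umul1r UmulDl UmulDr Uone_neq0.

Definition Uscale (c : k) (u : Uenv) : Uenv := Uscal c * u.

Lemma UscalD c d : Uscal (c + d) = Uscal c + Uscal d.
Proof.
by rewrite [RHS]/GRing.add /= (Uadd_pi (UScal c)); apply/Uenv_eqP/ueq_scalD.
Qed.
Lemma UscalM c d : Uscal (c * d) = Uscal c * Uscal d.
Proof.
by rewrite [RHS]/GRing.mul /= (Umul_pi (UScal c)); apply/Uenv_eqP/ueq_scalM.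
Qed.

Lemma UscaleA c d u : Uscale c (Uscale d u) = Uscale (c * d) u.
Proof. by rewrite /Uscale UscalM mulrA. Qed.
Lemma Uscale1 : left_id 1 Uscale.
Proof. by move=> u; rewrite /Uscale mul1r. Qed.
Lemma UscaleDr : right_distributive Uscale +%R.
Proof. by move=> c u v; rewrite /Uscale mulrDr. Qed.
Lemma UscaleDl u : {morph Uscale^~ u : c d / c + d}.
Proof. by move=> c d; rewrite /Uscale UscalD mulrDl. Qed.
HB.instance Definition _ := GRing.Zmodule_isLmodule.Build k Uenv
  UscaleA Uscale1 UscaleDr UscaleDl.

Lemma Uscale_Al (c : k) (u v : Uenv) : c *: (u * v) = c *: u * v.
Proof. exact: mulrA. Qed.
HB.instance Definition _ := GRing.Lmodule_isLalgebra.Build k Uenv Uscale_Al.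

Lemma Uscale_Ar (c : k) (u v : Uenv) : c *: (u * v) = u * (c *: v).
Proof.
by rewrite /GRing.scale /= /Uscale !mulrA; congr (_ * _); apply: UscalC.
Qed.
HB.instance Definition _ := GRing.Lalgebra_isAlgebra.Build k Uenv Uscale_Ar.

Lemma UscalE c : Uscal c = c%:A.
Proof. by rewrite /GRing.scale /= /Uscale mulr1. Qed.

Lemma Ugen_morph : lie_morph Ugen.
Proof.
have genM x y : Ugen x * Ugen y = \pi_Uenv (UMul (UGen x) (UGen y)).
  exact: Umul_pi.
split=> [c x y|x y].
  have -> : c *: Ugen x = \pi_Uenv (UMul (UScal c) (UGen x)) by exact: Umul_pi.
  apply/esym; apply: etrans (Uadd_pi _ (UGen y)) _; apply/esym/Uenv_eqP.
  apply: ueq_trans (ueq_genD _ _) _; apply: ueq_add (ueq_refl _).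
  exact: ueq_genZ.
apply/eqP; rewrite eq_sym subr_eq eq_sym !genM; apply/eqP.
by apply: etrans (Uadd_pi (UGen _) _) _; apply/Uenv_eqP/ueq_lie.
Qed.

Lemma Uenv_ind (P : Uenv -> Prop) :
  (forall c, P c%:A) -> (forall x, P (Ugen x)) ->
  (forall u v, P u -> P v -> P (u + v)) ->
  (forall u v, P u -> P v -> P (u * v)) -> forall u, P u.
Proof.
move=> Pc Px PD PM; elim/quotW; elim=> [c|x|a Pa b Pb|a Pa b Pb].
- by have := Pc c; rewrite -UscalE.
- exact: Px.
- by have := PD _ _ Pa Pb; rewrite {1}/GRing.add /= Uadd_pi.
- by have := PM _ _ Pa Pb; rewrite {1}/GRing.mul /= Umul_pi.
Qed.

Definition alg_morph (A B : algType k) (g : A -> B) : Prop :=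
  [/\ forall c u v, g (c *: u + v) = c *: g u + g v,
      forall u v, g (u * v) = g u * g v & g 1 = 1].

Lemma U_lift_gen (B : algType k) (f : L -> B) x :
  lie_morph f -> U_lift f (Ugen x) = f x.
Proof. by move=> fL; rewrite U_lift_pi. Qed.

Lemma U_lift_morph (B : algType k) (f : L -> B) :
  lie_morph f -> alg_morph (U_lift f).
Proof.
move=> fL.
have liftD u v : U_lift f (u + v) = U_lift f u + U_lift f v.
  elim/quotW: u => a; elim/quotW: v => b.
  by rewrite [X in U_lift f X]/GRing.add /= Uadd_pi !U_lift_pi.
have liftM u v : U_lift f (u * v) = U_lift f u * U_lift f v.
  elim/quotW: u => a; elim/quotW: v => b.
  by rewrite [X in U_lift f X]/GRing.mul /= Umul_pi !U_lift_pi.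
split=> // [c u v|]; last by rewrite U_lift_pi //= scale1r.
by rewrite liftD -[c *: u]mulr_algl -UscalE liftM U_lift_pi //= mulr_algl.
Qed.

Lemma alg_morph_ext (B : algType k) (g h : Uenv -> B) :
  alg_morph g -> alg_morph h -> (forall x, g (Ugen x) = h (Ugen x)) ->
  forall u, g u = h u.
Proof.
move=> [gl gM g1] [hl hM h1] gh.
have gD u v : g (u + v) = g u + g v by have := gl 1 u v; rewrite !scale1r.
have hD u v : h (u + v) = h u + h v by have := hl 1 u v; rewrite !scale1r.
have g0 : g 0 = 0 by apply: (addrI (g 0)); rewrite -gD !addr0.
have h0 : h 0 = 0 by apply: (addrI (h 0)); rewrite -hD !addr0.
elim/Uenv_ind => [c|//|u v IHu IHv|u v IHu IHv].
- by rewrite -[c%:A]addr0 gl hl g1 h1 g0 h0.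
- by rewrite gD hD IHu IHv.
- by rewrite gM hM IHu IHv.
Qed.

Lemma U_lift_uniq (B : algType k) (f : L -> B) (g : Uenv -> B) :
  lie_morph f -> alg_morph g -> (forall x, g (Ugen x) = f x) ->
  forall u, g u = U_lift f u.
Proof.
move=> fL gM gf; apply: alg_morph_ext (U_lift_morph fL) _ => // x.
by rewrite gf U_lift_gen.
Qed.

End Envelope.

Section AlgMorph.
Variable k : fieldType.

Lemma alg_morphD (A B : algType k) (f : A -> B) : alg_morph f ->
  forall u v, f (u + v) = f u + f v.
Proof. by case=> fl _ _ u v; have := fl 1 u v; rewrite !scale1r. Qed.

Lemma alg_morph0 (A B : algType k) (f : A -> B) : alg_morph f -> f 0 = 0.
Proof.
by move=> fM; apply: (addrI (f 0)); rewrite -(alg_morphD fM) !addr0.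
Qed.

Lemma alg_morphZ (A B : algType k) (f : A -> B) : alg_morph f ->
  forall c u, f (c *: u) = c *: f u.
Proof.
move=> fM c u; have f0 := alg_morph0 fM; case: fM => fl _ _.
by have := fl c u 0; rewrite f0 !addr0.
Qed.

Lemma alg_morph_comp (A B C : algType k) (g : B -> C) (f : A -> B) :
  alg_morph g -> alg_morph f -> alg_morph (g \o f).
Proof.
move=> [gl gM g1] [fl fM f1].
by split=> [c u v|u v|] /=; rewrite ?fl ?gl ?fM ?gM ?f1 ?g1.
Qed.

Lemma alg_morph_id (A : algType k) : alg_morph (@id A).
Proof. by []. Qed.

Definition tens_map (A B C D : algType k) (f : A -> C) (g : B -> D) :
  tens A B -> tens C D := tens_lift (fun a b => f a \ot g b).

Definition tens_swap (A B : algType k) : tens A B -> tens B A :=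
  tens_lift (fun a b => b \ot a).

(* The identification of A \otimes (B \otimes C) with                         *)
(* (A \otimes B) \otimes C, the bracketing used below for triple products.    *)
Definition tens_assoc (A B C : algType k) :
  tens A (tens B C) -> tens (tens A B) C :=
  tens_lift (fun a => tens_lift (fun b c => (a \ot b) \ot c)).

Lemma tens_alg_morph (A B C : algType k) (f : tens A B -> C) :
  (forall s t, f (s + t) = f s + f t) ->
  (forall c a b, f (c *: (a \ot b)) = c *: f (a \ot b)) ->
  (forall a b a' b', f ((a \ot b) * (a' \ot b')) = f (a \ot b) * f (a' \ot b'))
  -> f 1 = 1 -> alg_morph f.
Proof.
move=> fD fZ fM f1; split=> // [c s t|].
  rewrite fD; congr (_ + _); move: s; apply: tens_ext => [s s'|s s'|a b].
  - by rewrite scalerDr fD.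
  - by rewrite fD scalerDr.
  exact: fZ.
move=> s t; move: s; apply: tens_ext => [s s'|s s'|a b];
  rewrite ?(fD, mulrDl) //.
by move: t; apply: tens_ext => [t t'|t t'|a' b']; rewrite ?(fD, mulrDr).
Qed.

Lemma tens_map_bal (A B C D : algType k) (f : A -> C) (g : B -> D) :
  alg_morph f -> alg_morph g -> tens_balanced (fun a b => f a \ot g b).
Proof.
move=> fM gM; split=> [a a' b|a b b'|a c b].
- by rewrite (alg_morphD fM) tenpDl.
- by rewrite (alg_morphD gM) tenpDr.
by rewrite /kra /kla (alg_morphZ fM) (alg_morphZ gM) tenpZ.
Qed.

Lemma tens_mapE (A B C D : algType k) (f : A -> C) (g : B -> D) a b :
  alg_morph f -> alg_morph g -> tens_map f g (a \ot b) = f a \ot g b.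
Proof. by move=> fM gM; apply: tens_liftE (tens_map_bal fM gM). Qed.

Lemma tens_map_morph (A B C D : algType k) (f : A -> C) (g : B -> D) :
  alg_morph f -> alg_morph g -> alg_morph (tens_map f g).
Proof.
move=> fM gM; have E a b := tens_mapE a b fM gM.
apply: tens_alg_morph => [s t|c a b|a b a' b'|].
- exact: tens_liftD (tens_map_bal fM gM).
- by rewrite tenpZl !E (alg_morphZ fM) tenpZl.
- by rewrite tenpM !E tenpM; case: fM => _ -> _; case: gM => _ -> _.
by rewrite -tenp1 E; case: fM => _ _ ->; case: gM => _ _ ->.
Qed.

Lemma tens_swap_bal (A B : algType k) :
  tens_balanced (fun (a : A) (b : B) => b \ot a).
Proof.
by split=> [a a' b|a b b'|a c b]; rewrite ?tenpDl ?tenpDr // -tenpZ.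
Qed.

Lemma tens_swapE (A B : algType k) (a : A) (b : B) :
  tens_swap (a \ot b) = b \ot a.
Proof. exact: tens_liftE (tens_swap_bal A B). Qed.

Lemma tens_swap_morph (A B : algType k) : alg_morph (@tens_swap A B).
Proof.
apply: tens_alg_morph => [s t|c a b|a b a' b'|].
- exact: tens_liftD (tens_swap_bal A B).
- by rewrite tenpZl !tens_swapE tenpZr.
- by rewrite tenpM !tens_swapE tenpM.
by rewrite -tenp1 tens_swapE.
Qed.

Lemma tens_assoc_bal1 (A B C : algType k) (a : A) :
  tens_balanced (fun (b : B) (c : C) => (a \ot b) \ot c).
Proof.
split=> [b b' c|b c c'|b e c]; rewrite ?tenpDr ?tenpDl //.
by rewrite -tenpZr tenpZ.
Qed.

Lemma tens_assoc_bal2 (A B C : algType k) :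
  tens_balanced (fun (a : A) (t : tens B C) =>
    tens_lift (fun b c => (a \ot b) \ot c) t).
Proof.
have liftE a b c := tens_liftE b c (@tens_assoc_bal1 A B C a).
have liftD a s t := tens_liftD s t (@tens_assoc_bal1 A B C a).
split=> [a a' t|a t t'|a e t]; last 2 [by rewrite liftD].
  move: t; apply: tens_ext => [s t|s t|b c].
  - exact: liftD.
  - by rewrite !liftD addrACA.
  by rewrite !liftE !tenpDl.
move: t; apply: tens_ext => [s t|s t|b c].
- exact: liftD.
- by rewrite /kla scalerDr liftD.
by rewrite /kla /kra tenpZl !liftE tenpZ.
Qed.

Lemma tens_assocE (A B C : algType k) (a : A) (b : B) (c : C) :
  tens_assoc (a \ot (b \ot c)) = (a \ot b) \ot c.
Proof.
rewrite /tens_assoc (tens_liftE _ _ (@tens_assoc_bal2 A B C)).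
exact: tens_liftE (@tens_assoc_bal1 A B C a).
Qed.

Lemma tens_assoc_morph (A B C : algType k) : alg_morph (@tens_assoc A B C).
Proof.
have D s t : @tens_assoc A B C (s + t) = tens_assoc s + tens_assoc t.
  exact: tens_liftD (@tens_assoc_bal2 A B C).
apply: tens_alg_morph => // [e a t|a t a' t'|].
- move: t; apply: tens_ext => [s t|s t|b c].
  + by rewrite tenpDr scalerDr D.
  + by rewrite tenpDr D scalerDr.
  by rewrite tenpZl !tens_assocE !tenpZl.
- move: t; apply: tens_ext => [s t|s t|b c]; rewrite ?(tenpDr, mulrDl, D) //.
  move: t'; apply: tens_ext => [s t|s t|b' c'];
    rewrite ?(tenpDr, mulrDr, D) //.
  by rewrite !tenpM !tens_assocE !tenpM.
by rewrite -!tenp1 tens_assocE.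
Qed.

End AlgMorph.

Section Coproduct.
Variables (k : fieldType) (L : lieAlgType k).
Local Notation H := (Uenv L).
Local Notation H2 := (tens H H).
Local Notation H3 := (tens H2 H).

Definition cop : H -> H2 := U_lift (fun x => Ugen x \ot 1 + 1 \ot Ugen x).

Lemma cop_lie : lie_morph (fun x : L => Ugen x \ot 1 + 1 \ot Ugen x : H2).
Proof.
have [genl genlie] := Ugen_morph L.
split=> [c x y|x y].
  by rewrite !genl tenpDl tenpDr scalerDr tenpZl tenpZr addrACA.
rewrite !genlie !(mulrDl, mulrDr) !tenpM !(mul1r, mulr1).
rewrite tenpDl tenpDr !opprD !addrA.
have oppl (a b : H) : (- a) \ot b = - (a \ot b).
  by rewrite -scaleN1r -tenpZl scaleN1r.
have oppr (a b : H) : a \ot (- b) = - (a \ot b).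
  by rewrite -scaleN1r -tenpZr scaleN1r.
rewrite oppl oppr.
set a := _ \ot 1; set b := _ \ot 1; set c := 1 \ot _; set d := 1 \ot _.
set e := _ \ot _; set f := _ \ot _.
by rewrite [RHS](ACl (1*5*4*8*2*7*3*6)) /= !addrK.
Qed.

Lemma cop_morph : alg_morph cop.
Proof. exact: U_lift_morph cop_lie. Qed.

Lemma cop_gen x : cop (Ugen x) = Ugen x \ot 1 + 1 \ot Ugen x.
Proof. exact: U_lift_gen cop_lie. Qed.

(* With H^{\otimes 3} = (H \otimes H) \otimes H: \Delta \otimes id,             *)
(* id \otimes \Delta, the iterated coproduct, beta |-> 1 \otimes beta and (12).*)
Definition cop_id : H2 -> H3 := tens_map cop id.
Definition id_cop : H2 -> H3 := @tens_assoc k H H H \o tens_map id cop.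
Definition cop3 : H -> H3 := cop_id \o cop.
Definition one_ot (b : H2) : H3 := tens_assoc (1 \ot b).
Definition swap12 : H3 -> H3 := tens_map (@tens_swap k H H) id.

Lemma cop_id_morph : alg_morph cop_id.
Proof. exact/tens_map_morph/alg_morph_id/cop_morph. Qed.
Lemma cop_idE (f g : H) : cop_id (f \ot g) = cop f \ot g.
Proof. exact: tens_mapE cop_morph (alg_morph_id _). Qed.

Lemma id_cop_morph : alg_morph id_cop.
Proof.
apply: alg_morph_comp (@tens_assoc_morph _ _ _ _) _.
exact: tens_map_morph (alg_morph_id _) cop_morph.
Qed.
Lemma id_copE (f g : H) : id_cop (f \ot g) = tens_assoc (f \ot cop g).
Proof. by rewrite /id_cop /= (tens_mapE _ _ (alg_morph_id _) cop_morph). Qed.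

Lemma cop3_morph : alg_morph cop3.
Proof. exact: alg_morph_comp cop_id_morph cop_morph. Qed.

Lemma swap12_morph : alg_morph swap12.
Proof. exact/tens_map_morph/alg_morph_id/tens_swap_morph. Qed.
Lemma swap12E (f h g : H) : swap12 ((f \ot h) \ot g) = (h \ot f) \ot g.
Proof.
rewrite /swap12 (tens_mapE _ _ (tens_swap_morph H H) (alg_morph_id _)).
by rewrite tens_swapE.
Qed.

Lemma one_otE (f g : H) : one_ot (f \ot g) = (1 \ot f) \ot g.
Proof. exact: tens_assocE. Qed.
Lemma one_otD (b c : H2) : one_ot (b + c) = one_ot b + one_ot c.
Proof. by rewrite /one_ot tenpDr (alg_morphD (@tens_assoc_morph _ _ _ _)). Qed.
Lemma one_otM (b c : H2) : one_ot (b * c) = one_ot b * one_ot c.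
Proof.
rewrite /one_ot; case: (@tens_assoc_morph k H H H) => _ <- _.
by rewrite tenpM mulr1.
Qed.

Lemma cop1 : cop 1 = 1.
Proof. by case: cop_morph. Qed.

Lemma cop3_gen x : cop3 (Ugen x) =
  (Ugen x \ot 1) \ot 1 + (1 \ot Ugen x) \ot 1 + (1 \ot 1) \ot Ugen x.
Proof.
rewrite /cop3 /= cop_gen (alg_morphD cop_id_morph) !cop_idE cop_gen cop1.
by rewrite tenpDl.
Qed.

Lemma cop_coassoc h : id_cop (cop h) = cop3 h.
Proof.
apply: (alg_morph_ext (alg_morph_comp id_cop_morph cop_morph) cop3_morph).
move=> x; rewrite cop3_gen /= cop_gen (alg_morphD id_cop_morph) !id_copE.
rewrite cop_gen cop1 -tenp1 tenpDr (alg_morphD (@tens_assoc_morph _ _ _ _)).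
by rewrite !tens_assocE addrA.
Qed.

Lemma cop_cocomm h : tens_swap (cop h) = cop h.
Proof.
have sM := tens_swap_morph H H.
apply: (alg_morph_ext (alg_morph_comp sM cop_morph) cop_morph) => x /=.
by rewrite cop_gen (alg_morphD sM) !tens_swapE addrC.
Qed.

Lemma swap12_cop3 h : swap12 (cop3 h) = cop3 h.
Proof.
apply: (alg_morph_ext (alg_morph_comp swap12_morph cop3_morph) cop3_morph).
move=> x /=; rewrite cop3_gen !(alg_morphD swap12_morph) !swap12E.
by rewrite [X in X + _]addrC.
Qed.

End Coproduct.

(* S \otimes_R V, where S is a right R-module through phi : R -> S, as a left *)
(* S-module.                                                                  *)
Section ScalarExtension.
Variables (R S : pzRingType) (phi : R -> S) (V : lmodType R).

Definition era (s : S) (r : R) : S := s * phi r.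
Definition ela (r : R) (v : V) : V := r *: v.

Definition ext : Type := tensor era ela.
HB.instance Definition _ := GRing.Zmodule.on ext.

Definition extp (s : S) (v : V) : ext := @tpure R S V era ela s v.

Definition ext_balanced (Z : zmodType) (f : S -> V -> Z) : Prop :=
  balanced era ela f.
Definition ext_lift (Z : zmodType) (f : S -> V -> Z) : ext -> Z :=
  @tlift R S V era ela Z f.

Lemma ext_liftE Z f s v : ext_balanced f -> @ext_lift Z f (extp s v) = f s v.
Proof. by move=> fb; apply: tlift_pure fb s v. Qed.
Lemma ext_liftD Z f s t : ext_balanced f ->
  @ext_lift Z f (s + t) = ext_lift f s + ext_lift f t.
Proof. by move=> fb; apply: tliftD fb s t. Qed.

Lemma extpDl s s' v : extp (s + s') v = extp s v + extp s' v.
Proof. exact: tpureDl. Qed.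
Lemma extpDr s v v' : extp s (v + v') = extp s v + extp s v'.
Proof. exact: tpureDr. Qed.
Lemma extp_bal s r v : extp (s * phi r) v = extp s (r *: v).
Proof. exact: tpure_bal. Qed.

Lemma ext_ext (Z : zmodType) (f g : ext -> Z) :
  (forall s t, f (s + t) = f s + f t) -> (forall s t, g (s + t) = g s + g t) ->
  (forall s v, f (extp s v) = g (extp s v)) -> forall t, f t = g t.
Proof. exact: tensor_ext. Qed.

Definition ext_scale (a : S) : ext -> ext := ext_lift (fun s v => extp (a * s) v).

Lemma ext_scale_bal a : ext_balanced (fun s v => extp (a * s) v).
Proof.
split=> [s s' v|s v v'|s r v]; first by rewrite mulrDr extpDl.
  by rewrite extpDr.
by rewrite /era mulrA extp_bal.
Qed.

Lemma ext_scaleE a s v : ext_scale a (extp s v) = extp (a * s) v.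
Proof. exact: ext_liftE (ext_scale_bal a). Qed.
Lemma ext_scaleDr : right_distributive ext_scale +%R.
Proof. by move=> a s t; apply: ext_liftD (ext_scale_bal a). Qed.
Lemma ext_scaleA a b t : ext_scale a (ext_scale b t) = ext_scale (a * b) t.
Proof.
move: t; apply: ext_ext => [s t|s t|s v]; rewrite ?ext_scaleDr //.
by rewrite !ext_scaleE mulrA.
Qed.
Lemma ext_scale1 : left_id 1 ext_scale.
Proof.
apply: ext_ext => [s t|s t|s v]; rewrite ?ext_scaleDr //.
by rewrite !ext_scaleE mul1r.
Qed.
Lemma ext_scaleDl t : {morph ext_scale^~ t : a b / a + b}.
Proof.
move=> a b; move: t; apply: ext_ext => [s t|s t|s v].
- by rewrite ext_scaleDr.
- by rewrite !ext_scaleDr addrACA.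
by rewrite !ext_scaleE mulrDl extpDl.
Qed.

HB.instance Definition _ := GRing.Zmodule_isLmodule.Build S ext
  ext_scaleA ext_scale1 ext_scaleDr ext_scaleDl.

Lemma extpZ a s v : a *: extp s v = extp (a * s) v.
Proof. exact: ext_scaleE. Qed.

End ScalarExtension.

Arguments extp {R S} phi {V} s v.
Arguments ext_ext {R S phi V Z f g}.

Section ExtMap.
Variables (R S S' : pzRingType) (phi : R -> S) (phi' : R -> S').
Variable V : lmodType R.

(* f \otimes_R id; meaningful when f is additive and right R-linear.          *)
Definition ext_map (f : S -> S') : ext phi V -> ext phi' V :=
  ext_lift (fun s v => extp phi' (f s) v).

Variable f : S -> S'.
Hypothesis fD : forall s t, f (s + t) = f s + f t.
Hypothesis fphi : forall s r, f (s * phi r) = f s * phi' r.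

Lemma ext_map_bal : ext_balanced phi (fun s (v : V) => extp phi' (f s) v).
Proof.
split=> [s s' v|s v v'|s r v]; first by rewrite fD extpDl.
  by rewrite extpDr.
by rewrite /era fphi extp_bal.
Qed.

Lemma ext_mapE s (v : V) : ext_map f (extp phi s v) = extp phi' (f s) v.
Proof. exact: ext_liftE ext_map_bal. Qed.
Lemma ext_mapD s t : ext_map f (s + t) = ext_map f s + ext_map f t.
Proof. exact: ext_liftD ext_map_bal. Qed.
Lemma ext_mapZ : (forall s t, f (s * t) = f s * f t) ->
  forall s t, ext_map f (s *: t) = f s *: ext_map f t.
Proof.
move=> fM s; apply: ext_ext => [t t'|t t'|t v]; rewrite ?(scalerDr, ext_mapD) //.
by rewrite extpZ !ext_mapE fM extpZ.
Qed.

End ExtMap.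

Notation "b \otH x" := (extp (@cop _ _) b x) : ring_scope.
Notation "b \otH3 x" := (extp (@cop3 _ _) b x) : ring_scope.

(* The H-bilinear map A \otimes A -> (H \otimes H) \otimes_H A is given as a  *)
(* biadditive map on A x A; its k-bilinearity follows from psmul_bilin.       *)
HB.mixin Record isPseudoAlgebra (k : fieldType) (L : lieAlgType k) A
    of GRing.Lmodule (Uenv L) A := {
  psmul : A -> A -> ext (@cop k L) A;
  psmulDl : forall x x' y, psmul (x + x') y = psmul x y + psmul x' y;
  psmulDr : forall x y y', psmul x (y + y') = psmul x y + psmul x y';
  psmul_bilin : forall (h g : Uenv L) x y,
    psmul (h *: x) (g *: y) = (h \ot g) *: psmul x y
}.

#[short(type="pseudoAlgType")]
HB.structure Definition PseudoAlgebra (k : fieldType) (L : lieAlgType k) :=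
  { A of GRing.Lmodule (Uenv L) A & isPseudoAlgebra k L A }.

Notation "x ** y" := (psmul x y) : ring_scope.

Section PreLie.
Variables (k : fieldType) (L : lieAlgType k) (A : pseudoAlgType L).
Local Notation H := (Uenv L).
Local Notation H2 := (tens H H).
Local Notation A2 := (ext (@cop k L) A).
Local Notation A3 := (ext (@cop3 k L) A).

(* (beta \otimes_H x) * y and x * (beta \otimes_H y), extended additively.    *)
Definition psmul3l (t : A2) (y : A) : A3 :=
  ext_lift (fun (b : H2) (x : A) =>
    (b \ot 1) *: ext_map (@cop3 k L) (@cop_id k L) (x ** y)) t.

Definition psmul3r (x : A) (t : A2) : A3 :=
  ext_lift (fun (b : H2) (y : A) =>
    one_ot b *: ext_map (@cop3 k L) (@id_cop k L) (x ** y)) t.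

Definition swap12H : A3 -> A3 := ext_map (@cop3 k L) (@swap12 k L).

Definition left_prelie : Prop := forall x y z : A,
  psmul3l (x ** y) z - psmul3r x (y ** z) =
  swap12H (psmul3l (y ** x) z - psmul3r y (x ** z)).

Let cidD := alg_morphD (cop_id_morph L).
Let idcD := alg_morphD (id_cop_morph L).
Let cidM : forall s t, @cop_id k L (s * t) = cop_id s * cop_id t.
Proof. by case: (cop_id_morph L). Qed.
Let idcM : forall s t, @id_cop k L (s * t) = id_cop s * id_cop t.
Proof. by case: (id_cop_morph L). Qed.
Let cid_cop s r : @cop_id k L (s * cop r) = cop_id s * cop3 r.
Proof. exact: cidM. Qed.
Let idc_cop s r : @id_cop k L (s * cop r) = id_cop s * cop3 r.
Proof. by rewrite idcM cop_coassoc. Qed.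

Lemma cop_idHE (a : H2) (c : A) :
  ext_map (@cop3 k L) (@cop_id k L) (a \otH c) = cop_id a \otH3 c.
Proof. exact: ext_mapE cidD cid_cop _ _. Qed.

Lemma id_copHE (a : H2) (c : A) :
  ext_map (@cop3 k L) (@id_cop k L) (a \otH c) = id_cop a \otH3 c.
Proof. exact: ext_mapE idcD idc_cop _ _. Qed.

Lemma swap12HE (a : tens H2 H) (c : A) :
  swap12H (a \otH3 c) = swap12 a \otH3 c.
Proof.
apply: ext_mapE (alg_morphD (swap12_morph L)) _ _ _ => s r.
by case: (swap12_morph L) => _ -> _; rewrite swap12_cop3.
Qed.

Lemma psmul3l_bal (y : A) :
  ext_balanced (@cop k L) (fun (b : H2) (x : A) =>
    (b \ot 1) *: ext_map (@cop3 k L) (@cop_id k L) (x ** y)).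
Proof.
split=> [b b' x|b x x'|b h x].
- by rewrite tenpDl scalerDl.
- by rewrite psmulDl (ext_mapD cidD cid_cop) scalerDr.
have := psmul_bilin h 1 x y; rewrite scale1r /ela => ->.
rewrite (ext_mapZ cidD cid_cop cidM) cop_idE scalerA tenpM mulr1.
by [].
Qed.

Lemma psmul3lE (b : H2) (x y : A) : psmul3l (b \otH x) y =
  (b \ot 1) *: ext_map (@cop3 k L) (@cop_id k L) (x ** y).
Proof. exact: ext_liftE (psmul3l_bal y). Qed.

Lemma psmul3r_bal (x : A) :
  ext_balanced (@cop k L) (fun (b : H2) (y : A) =>
    one_ot b *: ext_map (@cop3 k L) (@id_cop k L) (x ** y)).
Proof.
split=> [b b' y|b y y'|b h y].
- by rewrite one_otD scalerDl.
- by rewrite psmulDr (ext_mapD idcD idc_cop) scalerDr.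
have := psmul_bilin 1 h x y; rewrite scale1r /ela => ->.
by rewrite (ext_mapZ idcD idc_cop idcM) id_copE scalerA /era one_otM.
Qed.

Lemma psmul3rE (b : H2) (x y : A) : psmul3r x (b \otH y) =
  one_ot b *: ext_map (@cop3 k L) (@id_cop k L) (x ** y).
Proof. exact: ext_liftE (psmul3r_bal x). Qed.

Lemma psmul3lD (s t : A2) (y : A) :
  psmul3l (s + t) y = psmul3l s y + psmul3l t y.
Proof. exact: ext_liftD (psmul3l_bal y). Qed.
Lemma psmul3rD (x : A) (s t : A2) :
  psmul3r x (s + t) = psmul3r x s + psmul3r x t.
Proof. exact: ext_liftD (psmul3r_bal x). Qed.

Definition is_basis2 (e1 e2 : A) : Prop :=
  forall x : A, exists! h : H * H, x = h.1 *: e1 + h.2 *: e2.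

End PreLie.

(* Main.v *)
Require Import Defs.
From HB Require Import structures.
From mathcomp Require Import all_boot all_order all_algebra.
From mathcomp Require Import zify.

Set Implicit Arguments.
Unset Strict Implicit.
Unset Printing Implicit Defensive.

Import GRing.Theory.
Local Open Scope ring_scope.

(** Write A and B for the coefficients of e1 * e2 on e1 and e2, and C and D for
    those of e2 * e1. An element of H (x) H can be read as a function u(x, y) of
    two variables, with the coproduct in the role of addition: the pre-Lie
    identity on basis elements becomes a system of equations in the third tensor
    power of H ([left_prelie_coef]), among which
<<
      B(y, z) B(x, y + z) = B(x, z) B(y, x + z),
      (s(y) - s(x)) C(x + y, z) = C(y, z) C(x, y + z) - C(x, z) C(y, x + z).
>>
    These equations are solved by comparing degrees in one variable. This works
    as over a polynomial ring, because degrees in one tensor factor add up under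
    multiplication ([deg_lt_mul]).

    The first equation forces B = b(x) ([left_only_of_symmetric]). The second
    forces C = 0 or C = s(y) + c(x); in the latter case c satisfies a cocycle
    equation, whose solutions in characteristic zero are c = l s + c0
    ([solve_C], [linear_of_cocycle]). Then:
    - if C = 0, degrees in z give A = 0, and then B = D = 0 (type 1);
    - if C is nonzero and A = 0, then l = c0 = 0, and B and D are the same
      constant, which is 0 or t1 (types 2 and 3);
    - A and D cannot both be nonzero: the coefficients of z in
      D(y, z) A(x, y + z) and A(x, z) D(y, x + z) are opposite while the leading
      terms are equal, and 2 is invertible ([AD_contra]);
    - if A is nonzero and D = 0, then B = 0, A = l s(y) + c0, and the last
      equation gives c0 = t2 with l = 0 or l = 1 (types 4 and 5).

    The additivity of degrees rests on the theorem of Poincare, Birkhoff and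
    Witt. It is proved here in dual form: every function on sorted words in a
    basis of L extends to a function on all words that respects the commutation
    relations ([straighten_rel]), hence to a linear functional on U(L). Suitable
    functionals give the symbol of an element, and the coefficients of the
    powers of s when s is the first basis vector.

    Conversely, in each of the five types the structure constants are affine in
    s, and the identities hold in the commutative algebra generated by s(x),
    s(y) and s(z) ([left_prelie_affine]). *)

(** * Identities in abelian groups *)

(** The computations below take place in non-commutative rings; once products
    are expanded, what remains is an identity between signed sums of atoms,
    which [abel] decides by comparing the coefficients of each atom. *)
Inductive zexp := ZVar of nat | ZZero | ZAdd of zexp & zexp | ZOpp of zexp.

Section Abel.
Variable V : zmodType.

Fixpoint zeval (env : seq V) (e : zexp) : V :=
  match e with
  | ZVar i => env`_i
  | ZZero => 0
  | ZAdd a b => zeval env a + zeval env b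
  | ZOpp a => - zeval env a
  end.

Fixpoint zcoef (e : zexp) (i : nat) : int :=
  match e with
  | ZVar j => if j == i then 1 else 0
  | ZZero => 0
  | ZAdd a b => zcoef a i + zcoef b i
  | ZOpp a => - zcoef a i
  end.

Lemma zevalE env e :
  zeval env e = \sum_(i < size env) env`_i *~ zcoef e i.
Proof.
elim: e => [j||a IHa b IHb|a IHa] /=.
- case: (ltnP j (size env)) => j_lt; last first.
    rewrite nth_default // big1 // => i _; case: eqP => [ji|_];
      last exact: mulr0z.
    by move: (ltn_ord i); rewrite -ji ltnNge j_lt.
  rewrite (bigD1 (Ordinal j_lt)) //= eqxx mulr1z big1 ?addr0 // => i ij.
  by rewrite ifF ?mulr0z // eq_sym; apply: contraNF ij => /eqP e;
    apply/eqP/val_inj.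
- by rewrite big1 // => i _; rewrite mulr0z.
- by rewrite IHa IHb -big_split; apply: eq_bigr => i _; rewrite mulrzDr.
- by rewrite IHa -sumrN; apply: eq_bigr => i _; rewrite mulrNz.
Qed.

Lemma zeval_eq env a b :
  all (fun i => zcoef a i == zcoef b i) (iota 0 (size env)) ->
  zeval env a = zeval env b.
Proof.
move=> /allP ab; rewrite !zevalE; apply: eq_bigr => i _.
by rewrite (eqP (ab _ _)) // mem_iota ltn_ord.
Qed.

End Abel.

(* Atoms are compared up to the algebraic structures that their ring operations
   are inferred from, since these depend on how a term was elaborated. *)
Ltac zsame x y :=
  first
  [ constr_eq x y
  | lazymatch constr:((x, y)) with
    | (@GRing.mul _ ?a ?b, @GRing.mul _ ?c ?d) => zsame a c; zsame b d
    | (@GRing.add _ ?a ?b, @GRing.add _ ?c ?d) => zsame a c; zsame b d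
    | (@GRing.scale _ _ ?a ?b, @GRing.scale _ _ ?c ?d) => zsame a c; zsame b d
    | (@GRing.opp _ ?a, @GRing.opp _ ?c) => zsame a c
    | (@GRing.one _, @GRing.one _) => idtac
    | (?f ?a, ?g ?b) => zsame f g; zsame a b
    end ].
Ltac zindex x env :=
  lazymatch env with
  | ?y :: ?r =>
    let i := match goal with
    | _ => let found := match goal with _ => zsame x y end in constr:(0%N)
    | _ => let i := zindex x r in constr:(S i)
    end in i
  end.
Ltac zinsert x env :=
  match goal with
  | _ => let i := zindex x env in env
  | _ => constr:(x :: env)
  end.
Ltac zatoms e env :=
  match e with
  | 0 => env
  | ?a + ?b => let env := zatoms a env in zatoms b env
  | - ?a => zatoms a env
  | ?x => zinsert x env
  end.
Ltac zreify e env :=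
  match e with
  | 0 => constr:(ZZero)
  | ?a + ?b =>
    let a := zreify a env in let b := zreify b env in constr:(ZAdd a b)
  | - ?a => let a := zreify a env in constr:(ZOpp a)
  | ?x => let i := zindex x env in constr:(ZVar i)
  end.
Ltac abel :=
  match goal with |- @eq ?V ?a ?b =>
    let env := zatoms a (@nil V) in
    let env := zatoms b env in
    let ea := zreify a env in
    let eb := zreify b env in
    change (zeval env ea = zeval env eb);
    apply: zeval_eq; vm_compute; reflexivity
  end.

(** * Straightening words *)

(** A linear functional on U(L) is a function on words in a basis of L that
    is compatible with the commutation relations. Such a function is pinned
    down by its values on sorted words, and [straighten_rel] says that these
    values can be prescribed freely: this is the Poincare-Birkhoff-Witt
    theorem in dual form, and avoids constructing U(L)-modules. *)
Section Straightening.
Variables (k : fieldType) (E : lmodType k) (n : nat).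
Variable c : 'I_n -> 'I_n -> 'I_n -> k.
Variable g : seq 'I_n -> E.
Local Notation word := (seq 'I_n).
Implicit Types u v w : word.

Hypothesis c_alt : forall i l, c i i l = 0.
Hypothesis c_anti : forall i j l, c i j l = - c j i l.
Hypothesis c_jacobi : forall i j h l,
  \sum_m (c i j m * c m h l + c j h m * c m i l + c h i m * c m j l) = 0.

Fixpoint find_descent w : option (word * 'I_n * 'I_n * word) :=
  if w isn't b :: w' then None else
  if w' isn't a :: v then None else
  if (a < b)%N then Some ([::], b, a, v) else
  if find_descent w' is Some (u, b', a', v') then Some (b :: u, b', a', v')
  else None.

Lemma find_descentP w :
  match find_descent w with
  | Some (u, b, a, v) => w = u ++ b :: a :: v /\ (a < b)%N
  | None => sorted leq (map val w)
  end.
Proof.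
elim: w => [//|b [//|a v] IH] /=.
case: (ltnP a b) => // ba; rewrite -/(find_descent (a :: v)).
case: (find_descent _) IH => [[[[u b'] a'] v']|//] /=.
by move=> [-> ?].
Qed.

Fixpoint inversions w : nat :=
  if w is b :: w' then (count (fun a : 'I_n => a < b) w' + inversions w')%N
  else 0%N.

Lemma inversions_descent u (b a : 'I_n) v : (a < b)%N ->
  inversions (u ++ b :: a :: v) = (inversions (u ++ a :: b :: v)).+1.
Proof.
move=> ab; elim: u => [|x u IH] /=.
  by rewrite ab ltnNge (ltnW ab) /=; lia.
rewrite IH addnS !count_cat /=; congr (_ .+1); congr (_ + _)%N; lia.
Qed.

(** Each swap removes an inversion, so the number of inversions is enough fuel;
    the bracket terms are shorter words, left to a recursion on the length. *)
Fixpoint straighten_swaps (shorter : word -> E) (fuel : nat) w : E :=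
  if find_descent w is Some (u, b, a, v) then
    if fuel is m.+1 then
      straighten_swaps shorter m (u ++ a :: b :: v)
      + \sum_l c b a l *: shorter (u ++ l :: v)
    else 0
  else g w.

Fixpoint straighten_size (size_w : nat) w : E :=
  straighten_swaps (if size_w is m.+1 then straighten_size m else g)
    (inversions w) w.

Definition straighten w := straighten_size (size w) w.

Lemma straighten_sorted w : sorted leq (map val w) -> straighten w = g w.
Proof.
move=> sw; rewrite /straighten.
have fw : find_descent w = None.
  case fw: (find_descent w) (find_descentP w) => [[[[u b] a] v]|//] [wE ab].
  move: sw; rewrite wE map_cat /= => /cat_sorted2[_] /=.
  by rewrite leqNgt ab.
have swE h m : straighten_swaps h m w = g w by case: m => /=; rewrite fw.
by case: (size w) => [|m]; apply: swE.
Qed.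

Definition rewritten u b a v : E :=
  straighten (u ++ a :: b :: v) + \sum_l c b a l *: straighten (u ++ l :: v).

Lemma straighten_step w u b a v : find_descent w = Some (u, b, a, v) ->
  straighten w = rewritten u b a v.
Proof.
move=> fw; have := find_descentP w; rewrite fw => -[wE ab].
have sz x y : size (u ++ x :: y :: v) = (size u + size v).+2.
  by rewrite size_cat /= !addnS.
have sz1 l : size (u ++ l :: v) = (size u + size v).+1.
  by rewrite size_cat /= addnS.
rewrite /rewritten /straighten.
under eq_bigr => l _ do rewrite sz1.
rewrite sz [in LHS]wE sz -wE /=.
rewrite [in inversions w]wE (inversions_descent u v ab) /= fw.
by congr (_ + _).
Qed.

Definition relation_at u b a v : Prop :=
  straighten (u ++ b :: a :: v) = rewritten u b a v.

Lemma relation_at_anti u b a v : relation_at u b a v -> relation_at u a b v.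
Proof.
rewrite /relation_at /rewritten => ->; rewrite -addrA -big_split /=.
rewrite big1 ?addr0 // => l _.
by rewrite -scalerDl (c_anti a b) subrr scale0r.
Qed.

Lemma relation_of_descents N :
  (forall u b a v, size (u ++ b :: a :: v) = N -> (a < b)%N ->
     relation_at u b a v) ->
  forall u b a v, size (u ++ b :: a :: v) = N -> relation_at u b a v.
Proof.
move=> H u b a v sz; case: (ltngtP a b) => [ab|ba|/val_inj ->].
- exact: H.
- by apply: relation_at_anti; apply: H => //; rewrite -sz !size_cat.
- by rewrite /relation_at /rewritten big1 ?addr0 // => l _;
    rewrite c_alt scale0r.
Qed.

(** Confluence: the two ways of rewriting a word at two descents agree. If the
    descents are disjoint the rewritings commute; if they overlap, the
    discrepancy is the Jacobi identity. *)
Section Confluence.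
Variable w : word.
Hypothesis shorter : forall u b a v,
  (size (u ++ b :: a :: v) < size w)%N -> relation_at u b a v.
Hypothesis fewer : forall u b a v, size (u ++ b :: a :: v) = size w ->
  (inversions (u ++ b :: a :: v) < inversions w)%N -> (a < b)%N ->
  relation_at u b a v.

Lemma confluence_disjoint u b a m b' a' v :
  w = u ++ b :: a :: m ++ b' :: a' :: v -> (a < b)%N -> (a' < b')%N ->
  rewritten u b a (m ++ b' :: a' :: v) =
  rewritten (u ++ b :: a :: m) b' a' v.
Proof.
move=> wE ab ab'.
have szw : size w = (size u + size m + size v).+4.
  by rewrite wE !size_cat /= size_cat /=; lia.
have wE' : w = (u ++ b :: a :: m) ++ b' :: a' :: v by rewrite wE -catA.
have r1 : relation_at (u ++ a :: b :: m) b' a' v.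
  apply: fewer => //; first by rewrite szw !size_cat /= ?size_cat /=; lia.
  by rewrite wE -catA /= (inversions_descent u _ ab).
have r2 : relation_at u b a (m ++ a' :: b' :: v).
  apply: fewer => //; first by rewrite szw !size_cat /= ?size_cat /=; lia.
  rewrite wE' (inversions_descent (u ++ b :: a :: m) _ ab').
  by rewrite -!catA.
have r3 l : relation_at (u ++ l :: m) b' a' v.
  by apply: shorter; rewrite szw !size_cat /= ?size_cat /=; lia.
have r4 l : relation_at u b a (m ++ l :: v).
  by apply: shorter; rewrite szw !size_cat /= ?size_cat /=; lia.
have {}r1 : straighten (u ++ a :: b :: m ++ b' :: a' :: v) =
    straighten (u ++ a :: b :: m ++ a' :: b' :: v) +
    \sum_l c b' a' l *: straighten (u ++ a :: b :: m ++ l :: v).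
  move: r1; rewrite /relation_at /rewritten -!catA /= => ->; congr (_ + _).
  by apply: eq_bigr => l _; rewrite -catA.
have {}r3 l : straighten (u ++ l :: m ++ b' :: a' :: v) =
    straighten (u ++ l :: m ++ a' :: b' :: v) +
    \sum_l' c b' a' l' *: straighten (u ++ l :: m ++ l' :: v).
  move: (r3 l); rewrite /relation_at /rewritten -!catA /= => ->.
  by congr (_ + _); apply: eq_bigr => l' _; rewrite -catA.
rewrite /rewritten r1 -!catA /= r2 /rewritten -!addrA; congr (_ + _).
under [X in _ + X = _]eq_bigr => l _ do rewrite r3 scalerDr.
under [X in _ = _ + X]eq_bigr => l _ do rewrite -catA /= r4 /rewritten scalerDr.
rewrite !big_split /= addrCA; congr (_ + (_ + _)).
under eq_bigr => l _ do rewrite scaler_sumr.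
under [RHS]eq_bigr => l _ do rewrite scaler_sumr.
rewrite exchange_big /=; apply: eq_bigr => l _; apply: eq_bigr => l' _.
by rewrite !scalerA mulrC.
Qed.

Lemma confluence_overlap u d b a v :
  w = u ++ d :: b :: a :: v -> (b < d)%N -> (a < b)%N ->
  rewritten u d b (a :: v) = rewritten (rcons u d) b a v.
Proof.
move=> wE bd ab; have ad := ltn_trans ab bd.
have cat_rc x t : rcons u x ++ t = u ++ x :: t by rewrite -cats1 -catA.
have szw : size w = (size u + size v).+3.
  by rewrite wE size_cat /=; lia.
have inv1 := inversions_descent u (a :: v) bd.
have inv2 := inversions_descent (rcons u d) v ab.
rewrite !cat_rc in inv2.
have r1 : relation_at (rcons u b) d a v.
  apply: fewer => //; rewrite cat_rc; first by rewrite szw size_cat /=; lia.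
  by rewrite wE; lia.
have r2 : relation_at u b a (d :: v).
  apply: fewer => //; first by rewrite szw size_cat /=; lia.
  have := inversions_descent (rcons u b) v ad; rewrite !cat_rc => inv3.
  by rewrite wE; lia.
have r3 : relation_at u d a (b :: v).
  apply: fewer => //; first by rewrite szw size_cat /=; lia.
  by rewrite wE; lia.
have r4 : relation_at (rcons u a) d b v.
  apply: fewer => //; rewrite cat_rc; first by rewrite szw size_cat /=; lia.
  have := inversions_descent u (b :: v) ad.
  by rewrite wE; lia.
have r5 x y : relation_at u x y v.
  by apply: shorter; rewrite szw size_cat /=; lia.
pose S2 x y := straighten (u ++ x :: y :: v).
pose S1 x := straighten (u ++ x :: v).
pose bracket x y := \sum_m c x y m *: S1 m.
have {}r1 : straighten (u ++ b :: d :: a :: v) =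
    straighten (u ++ b :: a :: d :: v) + \sum_l c d a l *: S2 b l.
  move: r1; rewrite /relation_at /rewritten !cat_rc => ->; congr (_ + _).
  by apply: eq_bigr => l _; rewrite cat_rc.
have {}r4 : straighten (u ++ a :: d :: b :: v) =
    straighten (u ++ a :: b :: d :: v) + \sum_l c d b l *: S2 a l.
  move: r4; rewrite /relation_at /rewritten !cat_rc => ->; congr (_ + _).
  by apply: eq_bigr => l _; rewrite cat_rc.
have {}r5 x y : S2 x y = S2 y x + bracket x y by exact: r5.
rewrite /rewritten r1 r2 /rewritten cat_rc r3 /rewritten r4.
have -> : \sum_l c b a l *: straighten (rcons u d ++ l :: v) =
    \sum_l c b a l *: S2 d l by apply: eq_bigr => l _; rewrite cat_rc.
rewrite -!addrA; congr (_ + _); rewrite -!big_split /=.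
apply/eqP; rewrite -subr_eq0 -sumrB; apply/eqP.
transitivity (\sum_l \sum_m (c d b l * c l a m + c b a l * c l d m
                             + c a d l * c l b m) *: S1 m).
  apply: eq_bigr => l _; rewrite -!/(S2 _ _) (r5 l d) (r5 l a) (r5 l b).
  have -> : \sum_m (c d b l * c l a m + c b a l * c l d m
                    + c a d l * c l b m) *: S1 m =
      c d b l *: bracket l a + c b a l *: bracket l d - c d a l *: bracket l b.
    rewrite !scaler_sumr -!(big_split, sumrB) /=; apply: eq_bigr => m _.
    by rewrite (c_anti a d) mulNr !scalerDl scaleNr -!scalerA.
  by rewrite !scalerDr; abel.
rewrite exchange_big big1 //= => m _.
by rewrite -scaler_suml c_jacobi scale0r.
Qed.

Lemma rewritten_unique u b a v u' b' a' v' :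
  w = u ++ b :: a :: v -> w = u' ++ b' :: a' :: v' ->
  (a < b)%N -> (a' < b')%N -> rewritten u b a v = rewritten u' b' a' v'.
Proof.
wlog le_uu' : u b a v u' b' a' v' / (size u <= size u')%N
  => [H|] wE wE' ab ab'.
  case/orP: (leq_total (size u) (size u')) => le_uu'.
    exact: H.
  by apply: esym; apply: H.
have [t u'E] : exists t, u' = u ++ t.
  exists (drop (size u) u'); rewrite -{1}(cat_take_drop (size u) u').
  have := congr1 (take (size u)) (etrans (esym wE) wE').
  by rewrite take_size_cat // takel_cat // => <-.
move: wE'; rewrite wE u'E -catA => /eqP; rewrite eqseq_cat // eqxx /= => /eqP.
case: t {u'E} => [|x [|y t]] /=.
- by move=> [-> -> ->]; rewrite cats0.
- move=> [bx ab'E vE]; rewrite cats1 -bx vE -ab'E.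
  apply: confluence_overlap => //; last by rewrite ab'E.
  by rewrite wE vE.
move=> [bx ay vE]; rewrite -bx -ay vE.
by apply: confluence_disjoint => //; rewrite wE vE.
Qed.
End Confluence.

(** By induction on the length and on the number of inversions: a word is
    straightened at some descent, and by confluence any other would do. *)
Theorem straighten_rel u b a v : relation_at u b a v.
Proof.
move: {-1}(size _) (erefl (size (u ++ b :: a :: v))) => N.
elim/ltn_ind: N u b a v => N IH.
have {}IH u b a v : (size (u ++ b :: a :: v) < N)%N -> relation_at u b a v.
  by move=> lt; apply: IH lt _ _ _ _ erefl.
apply: relation_of_descents => u b a v.
move: {-1}(inversions _) (erefl (inversions (u ++ b :: a :: v))) => m.
elim/ltn_ind: m u b a v => m IHm u b a v invE sz ab.
set w := u ++ b :: a :: v in invE sz *.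
case fw: (find_descent w) (find_descentP w) => [[[[u' b'] a'] v']|] /=.
  move=> [wE ab']; rewrite /relation_at -/w (straighten_step fw).
  apply: (@rewritten_unique w) => // [x y z t|x y z t sz' inv' yz].
    by rewrite sz; apply: IH.
  by apply: IHm (erefl _) _ _ => //; rewrite ?sz' -?invE.
rewrite map_cat => /cat_sorted2[_] /= /andP[].
by rewrite leqNgt ab.
Qed.

End Straightening.

(** * Linear functionals on enveloping algebras *)

Section LieBasics.
Variables (k : fieldType) (L : lieAlgType k).
Implicit Types x y z : L.

Lemma lieDl x y z : lie (x + y) z = lie x z + lie y z.
Proof. by have := lie_linear_l 1 x y z; rewrite !scale1r. Qed.
Lemma lieDr x y z : lie z (x + y) = lie z x + lie z y.
Proof. by have := lie_linear_r 1 x y z; rewrite !scale1r. Qed.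

Lemma lie0l z : lie 0 z = 0 :> L.
Proof. by apply: (addrI (lie 0 z)); rewrite -lieDl !addr0. Qed.
Lemma lieZl a x z : lie (a *: x) z = a *: lie x z.
Proof. by have := lie_linear_l a x 0 z; rewrite lie0l !addr0. Qed.

Lemma lie_anti x y : lie x y = - lie y x.
Proof.
apply/eqP; rewrite -addr_eq0; apply/eqP; have := @lie_alt _ _ (x + y).
by rewrite lieDl !lieDr !lie_alt add0r addr0.
Qed.

Lemma lie_suml n (a : 'I_n -> k) (b : 'I_n -> L) z :
  lie (\sum_i a i *: b i) z = \sum_i a i *: lie (b i) z.
Proof.
rewrite (big_morph (fun x => lie x z) (fun x y => lieDl x y z) (lie0l z)).
by apply: eq_bigr => i _; rewrite lieZl.
Qed.

End LieBasics.

(** The basis comes with its coordinates, and its order is part of the data: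
    the notion of a sorted word depends on it. *)
Record lie_basis (k : fieldType) (L : lieAlgType k) (n : nat) := LieBasis {
  bvec : 'I_n -> L;
  bcoord : L -> 'I_n -> k;
  bcoord_lin : forall a x y i,
    bcoord (a *: x + y) i = a * bcoord x i + bcoord y i;
  bcoordE : forall x, x = \sum_i bcoord x i *: bvec i;
  bcoord_bvec : forall i j, bcoord (bvec i) j = (i == j)%:R
}.

Section Functionals.
Variables (k : fieldType) (L : lieAlgType k) (n : nat) (B : lie_basis L n).
Variable E : lmodType k.
Local Notation word := (seq 'I_n).
Local Notation co := (bcoord B).
Local Notation b := (bvec B).

Lemma coD x y i : co (x + y) i = co x i + co y i.
Proof. by have := bcoord_lin B 1 x y i; rewrite scale1r mul1r. Qed.
Lemma co0 i : co 0 i = 0.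
Proof. by apply: (addrI (co 0 i)); rewrite -coD !addr0. Qed.
Lemma coZ a x i : co (a *: x) i = a * co x i.
Proof. by have := bcoord_lin B a x 0 i; rewrite co0 !addr0. Qed.

Definition structure_const i j l := co (lie (b i) (b j)) l.
Local Notation c := structure_const.

Lemma structure_const_lie x j l :
  \sum_m co x m * c m j l = co (lie x (b j)) l.
Proof.
rewrite [in RHS](bcoordE B x) lie_suml.
rewrite (big_morph (fun x => co x l) (fun x y => coD x y l) (co0 l)).
by apply: eq_bigr => m _; rewrite coZ.
Qed.

Lemma structure_const_alt i l : c i i l = 0.
Proof. by rewrite /c lie_alt co0. Qed.

Lemma structure_const_anti i j l : c i j l = - c j i l.
Proof. by rewrite /c lie_anti -scaleN1r coZ mulN1r. Qed.

Lemma structure_const_jacobi i j h l :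
  \sum_m (c i j m * c m h l + c j h m * c m i l + c h i m * c m j l) = 0.
Proof.
rewrite !big_split /= !structure_const_lie -!coD -(co0 l); congr (co _ l).
rewrite (lie_anti (lie (b i) _)) (lie_anti (lie (b j) _)) (lie_anti (lie (b h)
  _)).
rewrite -!opprD [X in - X](_ : _ = 0) ?oppr0 //.
rewrite -(lie_jacobi (b h) (b i) (b j)); abel.
Qed.

Definition compatible (f : word -> E) : Prop := forall u i j v,
  f (u ++ i :: j :: v) =
  f (u ++ j :: i :: v) + \sum_l c i j l *: f (u ++ l :: v).

Lemma straighten_compatible (g : word -> E) : compatible (straighten c g).
Proof.
move=> u i j v; apply: straighten_rel.
- exact: structure_const_alt.
- exact: structure_const_anti.
- exact: structure_const_jacobi.
Qed.

Lemma compatible_cons f i : compatible f -> compatible (fun w => f (i :: w)).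
Proof. by move=> fc u; apply: (fc (i :: u)). Qed.

(** U(L) acts on its dual by (h f)(g) = f (hg); on functions on words this
    makes sense for expressions, without reference to U(L). *)
Fixpoint expr_act (a : uexpr L) (f : word -> E) (w : word) : E :=
  match a with
  | UScal r => r *: f w
  | UGen x => \sum_i co x i *: f (i :: w)
  | UAdd a b => expr_act a f w + expr_act b f w
  | UMul a b => expr_act b (expr_act a f) w
  end.

Lemma expr_act_eq a f f' : f =1 f' -> expr_act a f =1 expr_act a f'.
Proof.
elim: a f f' => [r|x|a IHa b' IHb|a IHa b' IHb] f f' ff' w /=.
- by rewrite ff'.
- by apply: eq_bigr => i _; rewrite ff'.
- by rewrite (IHa _ _ ff') (IHb _ _ ff').
- by apply: IHb; apply: IHa.
Qed.

Lemma expr_actD a f f' w :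
  expr_act a (fun v => f v + f' v) w = expr_act a f w + expr_act a f' w.
Proof.
elim: a f f' w => [r|x|a IHa b' IHb|a IHa b' IHb] f f' w /=.
- by rewrite scalerDr.
- by rewrite -big_split; apply: eq_bigr => i _; rewrite scalerDr.
- by rewrite IHa IHb addrACA.
- by rewrite -IHb; apply: expr_act_eq => v; apply: IHa.
Qed.

Lemma expr_actZ a r f w : expr_act a (fun v =>
  r *: f v) w = r *: expr_act a f w.
Proof.
elim: a f w => [r'|x|a IHa b' IHb|a IHa b' IHb] f w /=.
- by rewrite !scalerA mulrC.
- by rewrite scaler_sumr; apply: eq_bigr => i _; rewrite !scalerA mulrC.
- by rewrite IHa IHb scalerDr.
- by rewrite -IHb; apply: expr_act_eq => v; apply: IHa.
Qed.

Lemma expr_act_compatible a f : compatible f -> compatible (expr_act a f).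
Proof.
elim: a f => [r|x|a IHa b' IHb|a IHa b' IHb] f fc u i j v /=.
- rewrite fc scalerDr scaler_sumr; congr (_ + _).
  by apply: eq_bigr => l _; rewrite !scalerA mulrC.
- under [X in _ = _ + X]eq_bigr => l _ do rewrite scaler_sumr.
  rewrite exchange_big -big_split; apply: eq_bigr => m _.
  rewrite (compatible_cons m fc) scalerDr scaler_sumr; congr (_ + _).
  by apply: eq_bigr => l _; rewrite !scalerA mulrC.
- rewrite IHa // IHb // addrACA -big_split; congr (_ + _).
  by apply: eq_bigr => l _; rewrite scalerDr.
- by apply: IHb; apply: IHa.
Qed.

Lemma expr_act_ueq a a' : ueq a a' -> forall f, compatible f ->
  expr_act a f =1 expr_act a' f.
Proof.
elim=> {a a'} //=.
- by move=> a b' _ IH f fc w; rewrite IH.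
- by move=> a b' d _ IH1 _ IH2 f fc w; rewrite IH1 ?IH2.
- by move=> a a' d d' _ IHa _ IHd f fc w; rewrite IHa ?IHd.
- move=> a a' d d' _ IHa _ IHd f fc w.
  rewrite (expr_act_eq _ (IHa f fc)); apply: IHd.
  exact: expr_act_compatible.
- by move=> a b' d f fc w; rewrite addrA.
- by move=> a b' f fc w; rewrite addrC.
- by move=> a f fc w; rewrite scale0r add0r.
- by move=> a f fc w; rewrite expr_actZ scaleN1r addNr scale0r.
- by move=> a f fc w; rewrite expr_actZ scale1r.
- by move=> a b' d f fc w; rewrite -expr_actD.
- by move=> r d f fc w; rewrite scalerDl.
- by move=> r d f fc w; rewrite scalerA mulrC.
- by move=> r a f fc w; rewrite expr_actZ.
- move=> x y f fc w; rewrite -big_split.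
  by apply: eq_bigr => i _; rewrite coD scalerDl.
- move=> r x f fc w.
  by apply: eq_bigr => i _; rewrite coZ scalerA mulrC.
move=> x y f fc w.
have mulE x' y' : \sum_i co y' i *: (\sum_j co x' j *: f [:: j, i & w]) =
    \sum_i \sum_j (co x' i * co y' j) *: f [:: i, j & w].
  under eq_bigr => i _ do rewrite scaler_sumr.
  rewrite exchange_big; apply: eq_bigr => i _; apply: eq_bigr => j _.
  by rewrite scalerA mulrC.
rewrite !mulE [X in _ + X = _]exchange_big /=.
have -> : \sum_l co (lie x y) l *: f (l :: w) =
    \sum_i \sum_j (co x i * co y j) *: (\sum_l c i j l *: f (l :: w)).
  transitivity (\sum_l (\sum_i \sum_j co x i * co y j * c i j l) *: f (l :: w)).
    apply: eq_bigr => l _; congr (_ *: _).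
    rewrite [in LHS](bcoordE B x) lie_suml.
    rewrite (big_morph (fun x => co x l) (fun x y => coD x y l) (co0 l)).
    apply: eq_bigr => i _; rewrite coZ lie_anti -scaleN1r coZ.
    rewrite {1}(bcoordE B y) lie_suml.
    rewrite (big_morph (fun x => co x l) (fun x y => coD x y l) (co0 l)).
    rewrite !big_distrr /=; apply: eq_bigr => j _.
    rewrite coZ -/(c j i l) structure_const_anti.
    by rewrite -mulrA; congr (_ * _); rewrite mulN1r mulrN opprK.
  under eq_bigr => l _ do rewrite scaler_suml.
  rewrite exchange_big; apply: eq_bigr => i _ /=.
  under eq_bigr => l _ do rewrite scaler_suml.
  rewrite exchange_big; apply: eq_bigr => j _ /=.
  by rewrite scaler_sumr; apply: eq_bigr => l _; rewrite scalerA.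
rewrite -big_split; apply: eq_bigr => i _ /=.
rewrite -big_split; apply: eq_bigr => j _ /=.
by have /= -> := fc [::] i j w; rewrite (mulrC (co y j)) -scalerDr addrC.
Qed.

Section Eval.
Variables (f : word -> E) (fc : compatible f).

Definition functional (h : Uenv L) : E := expr_act (repr h) f [::].

Lemma functional_pi a : functional (\pi_(Uenv L) a)%qT = expr_act a f [::].
Proof. by apply: expr_act_ueq => //; apply: ueq_repr. Qed.

Lemma functionalD g h : functional (g + h) = functional g + functional h.
Proof.
elim/quotW: g => a; elim/quotW: h => d.
by rewrite [X in functional X]/GRing.add /= Uadd_pi !functional_pi.
Qed.

Lemma functionalZ r h : functional (r *: h) = r *: functional h.
Proof.
elim/quotW: h => a.
rewrite [X in functional X]/GRing.scale /= /Uscale /Uscal.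
by rewrite [X in functional X]/GRing.mul /= Umul_pi !functional_pi /= expr_actZ.
Qed.

Lemma functional1 : functional 1 = f [::].
Proof. by rewrite [X in functional X]/GRing.one /= functional_pi /= scale1r.
  Qed.

End Eval.

Lemma functional_gen f x h : compatible f ->
  functional f (Ugen x * h) =
  \sum_i co x i *: functional (fun w => f (i :: w)) h.
Proof.
move=> fc; elim/quotW: h => a.
rewrite [X in functional _ X]/GRing.mul /= /Ugen Umul_pi functional_pi //=.
under [RHS]eq_bigr => i _ do
  rewrite (functional_pi (compatible_cons i fc)) -expr_actZ.
suff H (r : seq 'I_n) : expr_act a (fun w =>
  \sum_(i <- r) co x i *: f (i :: w)) [::] =
    \sum_(i <- r) expr_act a (fun w => co x i *: f (i :: w)) [::] by exact: H.
elim: r => [|i r IH].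
  rewrite big_nil; apply: etrans (etrans (expr_actZ a 0 f [::]) (scale0r _)).
  by apply: expr_act_eq => w; rewrite big_nil scale0r.
rewrite big_cons -IH -expr_actD; apply: expr_act_eq => w.
by rewrite big_cons.
Qed.

End Functionals.

(** * The degree filtration *)

Definition monomial (k : fieldType) (L : lieAlgType k) (w : seq L) : Uenv L :=
  \prod_(x <- w) Ugen x.

Section UgenLinear.
Variables (k : fieldType) (L : lieAlgType k).

Lemma UgenD (x y : L) : Ugen (x + y) = Ugen x + Ugen y.
Proof. by have [+ _] := Ugen_morph L; move=> /(_ 1 x y); rewrite !scale1r. Qed.
Lemma Ugen0 : Ugen 0 = 0 :> Uenv L.
Proof. by apply: (addrI (Ugen 0)); rewrite -UgenD !addr0. Qed.
Lemma UgenZ a (x : L) : Ugen (a *: x) = a *: Ugen x.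
Proof. by have [+ _] := Ugen_morph L; move=> /(_ a x 0);
  rewrite Ugen0 !addr0. Qed.

End UgenLinear.

Lemma alg_morphN (k : fieldType) (A B : algType k) (f : A -> B) u :
  alg_morph f -> f (- u) = - f u.
Proof. by move=> fM; rewrite -scaleN1r (alg_morphZ fM) scaleN1r. Qed.

Lemma alg_morphB (k : fieldType) (A B : algType k) (f : A -> B) u v :
  alg_morph f -> f (u - v) = f u - f v.
Proof. by move=> fM; rewrite (alg_morphD fM) (alg_morphN _ fM). Qed.

Section TensLinear.
Variables (k : fieldType) (A B : algType k).

Lemma tenp0l (b : B) : 0 \ot b = 0 :> tens A B.
Proof. by rewrite -(scale0r 0) -tenpZl scale0r. Qed.
Lemma tenp0r (a : A) : a \ot 0 = 0 :> tens A B.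
Proof. by rewrite -(scale0r 0) -tenpZr scale0r. Qed.
Lemma tenpNl (a : A) (b : B) : (- a) \ot b = - (a \ot b).
Proof. by rewrite -scaleN1r -tenpZl scaleN1r. Qed.
Lemma tenpNr (a : A) (b : B) : a \ot (- b) = - (a \ot b).
Proof. by rewrite -scaleN1r -tenpZr scaleN1r. Qed.
Lemma tenp_sumr I (r : seq I) (P : pred I) (F : I -> B) (a : A) :
  a \ot (\sum_(i <- r | P i) F i) = \sum_(i <- r | P i) a \ot F i.
Proof.
by rewrite (big_morph (fun b => a \ot b) (fun x y => tenpDr a x y) (tenp0r a)).
Qed.

End TensLinear.

Section Degree.
Variables (k : fieldType) (A : algType k) (L : lieAlgType k).
Local Notation H := (Uenv L).
Local Notation K := (tens A H).
Implicit Types (a : A) (u v : K) (w : seq L) (x y : L).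

(** The second factor of u has degree less than n, as with [size] for
    polynomials; in particular [deg_lt 0 u] means u = 0. *)
Definition deg_lt n u : Prop := exists l : seq (A * seq L),
  all (fun p => size p.2 < n)%N l /\ u = \sum_(p <- l) p.1 \ot monomial p.2.

Lemma monomial_cons x w : monomial (x :: w) = Ugen x * monomial w.
Proof. exact: big_cons. Qed.
Lemma monomial_cat w w' : monomial (w ++ w') = monomial w * monomial w'.
Proof. exact: big_cat. Qed.
Lemma monomial0 : monomial [::] = 1 :> H.
Proof. exact: big_nil. Qed.

Lemma deg_lt0 u : deg_lt 0 u <-> u = 0.
Proof.
split=> [[[|p l] [// _ ->]]|->]; first by rewrite big_nil.
by exists [::]; rewrite big_nil.
Qed.

Lemma deg_lt_zero n : deg_lt n 0.
Proof. by exists [::]; rewrite big_nil. Qed.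

Lemma deg_ltD n u v : deg_lt n u -> deg_lt n v -> deg_lt n (u + v).
Proof.
move=> [l [ln ->]] [l' [ln' ->]]; exists (l ++ l').
by rewrite all_cat ln ln' big_cat.
Qed.

Lemma deg_lt_monomial n a w : (size w < n)%N -> deg_lt n (a \ot monomial w).
Proof. by move=> wn; exists [:: (a, w)]; rewrite /= wn big_seq1. Qed.

Lemma deg_lt_ind n (P : K -> Prop) : P 0 ->
  (forall u v, P u -> P v -> P (u + v)) ->
  (forall a w, (size w < n)%N -> P (a \ot monomial w)) ->
  forall u, deg_lt n u -> P u.
Proof.
move=> P0 PD Pm u [l [ln ->]]; elim: l ln => [|p l IH] /=.
  by rewrite big_nil.
by move=> /andP[pn ln]; rewrite big_cons; apply: PD; [apply: Pm|apply: IH].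
Qed.

Lemma deg_lt_leq n m u : (n <= m)%N -> deg_lt n u -> deg_lt m u.
Proof.
move=> nm un; elim/deg_lt_ind: u / un => [|v v'|a w wn];
  first exact: deg_lt_zero.
- exact: deg_ltD.
- by apply: deg_lt_monomial; apply: leq_trans nm.
Qed.

Lemma deg_ltN n u : deg_lt n u -> deg_lt n (- u).
Proof.
move=> un; elim/deg_lt_ind: u / un => [|v v'|a w wn].
- by rewrite oppr0; apply: deg_lt_zero.
- by rewrite opprD; apply: deg_ltD.
- by rewrite -tenpNl; apply: deg_lt_monomial.
Qed.

Lemma deg_ltB n u v : deg_lt n u -> deg_lt n v -> deg_lt n (u - v).
Proof. by move=> un vn; apply: deg_ltD => //; apply: deg_ltN. Qed.

Lemma deg_ltM n m u v :
  deg_lt n.+1 u -> deg_lt m.+1 v -> deg_lt (n + m).+1 (u * v).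
Proof.
move=> un vm; elim/deg_lt_ind: v / vm => [|v v' IH IH'|b w' w'm].
- by rewrite mulr0; apply: deg_lt_zero.
- by rewrite mulrDr; apply: deg_ltD.
elim/deg_lt_ind: u / un => [|u u' IH IH'|a w wn].
- by rewrite mul0r; apply: deg_lt_zero.
- by rewrite mulrDl; apply: deg_ltD.
rewrite tenpM -monomial_cat; apply: deg_lt_monomial.
by rewrite size_cat ltnS leq_add.
Qed.

Lemma deg_ltMl n u v : deg_lt 1 u -> deg_lt n v -> deg_lt n (u * v).
Proof.
case: n => [_ /deg_lt0->|n u1 vn]; first by rewrite mulr0; apply: deg_lt_zero.
exact: deg_ltM u1 vn.
Qed.

Lemma deg_ltMr n u v : deg_lt n u -> deg_lt 1 v -> deg_lt n (u * v).
Proof.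
case: n => [/deg_lt0-> _|n un v1]; first by rewrite mul0r; apply: deg_lt_zero.
by rewrite -(addn0 n); apply: deg_ltM un v1.
Qed.

Lemma deg_lt_coef a : deg_lt 1 (a \ot 1).
Proof. by rewrite -monomial0; apply: deg_lt_monomial. Qed.

Lemma deg_lt_scale n u r : deg_lt n u -> deg_lt n (r *: u).
Proof.
move=> un; rewrite -mulr_algl -tenp1 tenpZl.
exact: deg_ltMl (deg_lt_coef _) un.
Qed.

Lemma deg_lt_scalar (r : k) : deg_lt 1 (r%:A : K).
Proof. by rewrite -tenp1 tenpZl; apply: deg_lt_coef. Qed.

Lemma deg_lt_gen a x : deg_lt 2 (a \ot Ugen x).
Proof.
have -> : Ugen x = monomial [:: x] by rewrite /monomial big_seq1.
exact: deg_lt_monomial.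
Qed.

Lemma deg_lt1P u : deg_lt 1 u <-> exists a, u = a \ot 1.
Proof.
split=> [un|[a ->]]; last exact: deg_lt_coef.
 elim/deg_lt_ind: u / un => [|u v [a ->] [b ->]|a [|//] _].
- by exists 0; rewrite tenp0l.
- by exists (a + b); rewrite tenpDl.
- by exists a; rewrite monomial0.
Qed.

Lemma deg_lt_exists u : exists n, deg_lt n u.
Proof.
move: u; apply: tensor_ind => [|a h t [m tm]]; first by exists 0%N;
  apply: deg_lt_zero.
suff [n hn] : exists n, deg_lt n (a \ot h).
  exists (maxn n m); apply: deg_ltD.
    by apply: deg_lt_leq hn; apply: leq_maxl.
  by apply: deg_lt_leq tm; apply: leq_maxr.
elim/Uenv_ind: h a => {t m tm} [r|x|g h IHg IHh|g h IHg IHh] a.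
- by exists 1%N; rewrite -tenpZ; apply: deg_lt_coef.
- by exists 2%N; apply: deg_lt_gen.
- have [[n gn] [m hm]] := (IHg a, IHh a).
  exists (maxn n m); rewrite tenpDr; apply: deg_ltD.
    by apply: deg_lt_leq gn; apply: leq_maxl.
  by apply: deg_lt_leq hm; apply: leq_maxr.
have [[n gn] [m hm]] := (IHg a, IHh 1).
exists (n + m).+1; rewrite -[a]mulr1 -tenpM.
by apply: deg_ltM; [apply: deg_lt_leq gn|apply: deg_lt_leq hm].
Qed.

Lemma deg_lt_min u : u != 0 -> exists n, deg_lt n.+1 u /\ ~ deg_lt n u.
Proof.
move=> u0; have [n] := deg_lt_exists u.
elim: n => [/deg_lt0/eqP|n IH un]; first by rewrite (negPf u0).
by have [/IH//|nun] := boolp.pselect (deg_lt n u); exists n.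
Qed.

End Degree.

Section DegreeMorphism.
Variables (k : fieldType) (A A' : algType k) (L L' : lieAlgType k).
Local Notation K := (tens A (Uenv L)).
Local Notation K' := (tens A' (Uenv L')).
Variables (f g : K -> K').
Hypothesis fM : alg_morph f.
Hypothesis f_coef : forall a, deg_lt 1 (f (a \ot 1)).
Hypothesis f_gen : forall x, deg_lt 2 (f (1 \ot Ugen x)).

Lemma tenp_monomial_cons (a : A) (x : L) w :
  a \ot monomial (x :: w) = (a \ot 1) * ((1 \ot Ugen x) * (1 \ot monomial w)).
Proof. by rewrite !tenpM !mul1r mulr1 monomial_cons. Qed.

Lemma deg_lt_morph_monomial w : deg_lt (size w).+1 (f (1 \ot monomial w)).
Proof.
have f1 : f 1 = 1 by case: fM.
have fE u v : f (u * v) = f u * f v by case: fM.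
elim: w => [|x w IH]; first by rewrite monomial0 tenp1 f1; apply: deg_lt_coef.
by rewrite tenp_monomial_cons !fE tenp1 f1 mul1r; apply: deg_ltM (f_gen x) IH.
Qed.

Lemma tenp_monomialE (a : A) (w : seq L) :
  a \ot monomial w = (a \ot 1) * (1 \ot monomial w).
Proof. by rewrite tenpM mulr1 mul1r. Qed.

Lemma deg_lt_morph n u : deg_lt n u -> deg_lt n (f u).
Proof.
have fE u' v : f (u' * v) = f u' * f v by case: fM.
move=> un; elim/deg_lt_ind: u / un => [|u v|a w wn].
- by rewrite (alg_morph0 fM); apply: deg_lt_zero.
- by rewrite (alg_morphD fM); apply: deg_ltD.
rewrite tenp_monomialE fE; apply: deg_ltMl => //.
exact: deg_lt_leq wn (deg_lt_morph_monomial w).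
Qed.

Hypothesis gM : alg_morph g.
Hypothesis g_coef : forall a, g (a \ot 1) = f (a \ot 1).
Hypothesis g_gen : forall x, deg_lt 1 (g (1 \ot Ugen x) - f (1 \ot Ugen x)).

(** Altering a morphism by elements of degree 0 on the generators alters its
    values in lower degree only. *)
Lemma deg_lt_morph_diff n u : deg_lt n.+1 u -> deg_lt n (g u - f u).
Proof.
have fE u' v : f (u' * v) = f u' * f v by case: fM.
have gE u' v : g (u' * v) = g u' * g v by case: gM.
have f1 : f 1 = 1 by case: fM.
have g1 : g 1 = 1 by case: gM.
move=> un; elim/deg_lt_ind: u / un => [|u v un vn|a w wn].
- by rewrite (alg_morph0 fM) (alg_morph0 gM) subr0; apply: deg_lt_zero.
- rewrite (alg_morphD fM) (alg_morphD gM) opprD addrACA; exact: deg_ltD.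
rewrite tenp_monomialE fE gE g_coef -mulrBr; apply: deg_ltMl => //.
apply: (deg_lt_leq (n := size w)); first by [].
elim: w {wn} => [|x w IH].
  by rewrite monomial0 tenp1 f1 g1 subrr; apply: deg_lt_zero.
rewrite tenp_monomial_cons !fE !gE tenp1 f1 g1 !mul1r.
set gx := g _; set fx := f _; set gw := g _; set fw := f _.
have -> : gx * gw - fx * fw = (gx - fx) * (gw - fw) + (gx - fx) * fw + fx *
  (gw - fw).
  by rewrite !mulrBl !mulrBr; abel.
apply: deg_ltD; first apply: deg_ltD.
- exact: deg_ltMl (g_gen x) (deg_lt_leq (leqnSn _) IH).
- exact: (deg_ltMl (g_gen x) (deg_lt_morph_monomial w)).
rewrite [size (x :: w)]/=; case: (size w) IH => [|m] IH.
  by move/deg_lt0: IH => ->; rewrite mulr0; apply: deg_lt_zero.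
exact: deg_ltM (f_gen x) IH.
Qed.

End DegreeMorphism.

Section DegreeCommutator.
Variables (k : fieldType) (A : algType k) (L : lieAlgType k) (s : L).
Local Notation K := (tens A (Uenv L)).
Local Notation S := (1 \ot Ugen s : K).

(** Bracketing with s is a derivation that maps generators to generators. *)
Lemma deg_lt_commutator n (u : K) : deg_lt n u -> deg_lt n (S * u - u * S).
Proof.
move=> un; elim/deg_lt_ind: u / un => [|u v un vn|a w wn].
- by rewrite mulr0 mul0r subrr; apply: deg_lt_zero.
- by rewrite mulrDr mulrDl opprD addrACA; apply: deg_ltD.
suff IH : deg_lt (size w).+1 (1 \ot (Ugen s * monomial w - monomial w * Ugen
  s) : K).
  rewrite (_ : _ - _ =
      (a \ot 1) * (1 \ot (Ugen s * monomial w - monomial w * Ugen s))).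
    exact: (deg_ltMl (deg_lt_coef _ _) (deg_lt_leq wn IH)).
  by rewrite tenpDr tenpNr mulrBr !tenpM !mul1r mulr1.
elim: w {wn} => [|x w IH].
  by rewrite monomial0 mulr1 mul1r subrr tenp0r; apply: deg_lt_zero.
rewrite monomial_cons.
have -> : Ugen s * (Ugen x * monomial w) - Ugen x * monomial w * Ugen s =
    Ugen (lie s x) * monomial w + Ugen x * (Ugen s * monomial w - monomial w *
      Ugen s).
  have [_ ->] := Ugen_morph L.
  by rewrite mulrBl mulrBr !mulrA; abel.
rewrite tenpDr; apply: deg_ltD.
  by rewrite -monomial_cons; apply: deg_lt_monomial.
rewrite -[X in X \ot _]mul1r -tenpM.
exact: deg_ltM (deg_lt_gen _ _) IH.
Qed.

End DegreeCommutator.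

(** * Symbols *)

(** Base-M expansions, used to encode exponent vectors by numbers. *)
Lemma digits_inj M d (f g : nat -> nat) :
  (forall j, f j < M)%N -> (forall j, g j < M)%N ->
  (\sum_(j < d) f j * M ^ j = \sum_(j < d) g j * M ^ j)%N ->
  forall j, (j < d)%N -> f j = g j.
Proof.
elim: d f g => [//|d IH] f g fM gM.
have shift (h : nat -> nat) : (\sum_(i < d.+1) h i * M ^ i =
    (\sum_(i < d) h i.+1 * M ^ i) * M + h 0)%N.
  rewrite big_ord_recl /= expn0 muln1 addnC; congr (_ + _)%N.
  rewrite big_distrl /=; apply: eq_bigr => i _.
  by rewrite /bump /= add1n expnS; lia.
rewrite !shift => e; have f0 : f 0%N = g 0%N.
  have := congr1 (modn^~ M) e.
  by rewrite /= !modnMDl !modn_small.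
move: e; rewrite f0 => /addIn /eqP; rewrite eqn_pmul2r;
  last exact: leq_ltn_trans (fM 0%N).
by move=> /eqP e [//|j] jd; apply: (IH (fun i => f i.+1) (fun i => g i.+1)).
Qed.

Section SortedWords.
Variables (M d : nat).
Implicit Types t : seq 'I_d.

Definition word_weight t := (\sum_(i <- t) M ^ i)%N.

Lemma word_weight_count t :
  word_weight t = (\sum_(j < d) count_mem (j : nat) (map val t) * M ^ j)%N.
Proof.
elim: t => [|i t IH]; first by rewrite /word_weight big_nil big1.
rewrite /word_weight big_cons -/(word_weight t) IH /=.
under [RHS]eq_bigr => j _ do rewrite mulnDl.
rewrite big_split /= [X in _ = (X + _)%N](bigD1 i) //= eqxx mul1n.
rewrite [X in (_ + X + _)%N]big1 ?addn0 // => j ji.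
by rewrite eq_sym (negPf ji : (val j == val i) = false).
Qed.

Lemma word_weight_inj t t' :
  (size t < M)%N -> (size t' < M)%N ->
  sorted leq (map val t) -> sorted leq (map val t') ->
  word_weight t = word_weight t' -> t = t'.
Proof.
move=> tM t'M ts t's; rewrite !word_weight_count => e.
apply: (inj_map val_inj).
apply: (sorted_eq leq_trans anti_leq) => //; rewrite /perm_eq; apply/allP => j.
rewrite mem_cat => jtt'; apply/eqP.
apply: (digits_inj (M := M) (d := d) (f := fun j => count_mem j (map val t))
  (g := fun j => count_mem j (map val t'))) => [i|i|//|].
- by apply: leq_ltn_trans (count_size _ _) _; rewrite size_map.
- by apply: leq_ltn_trans (count_size _ _) _; rewrite size_map.
- by case/orP: jtt' => /mapP[i _ ->]; apply: ltn_ord.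
Qed.

End SortedWords.

Section StraightenDegree.
Variables (k : fieldType) (L : lieAlgType k) (d : nat) (B : lie_basis L d).
Variable E : lmodType k.
Local Notation c := (structure_const B).

(** Straightening preserves length up to shorter words, so a functional that
    ignores short sorted words ignores all short words. *)
Lemma straighten_short (g : seq 'I_d -> E) N :
  (forall w, (size w < N)%N -> g w = 0) ->
  forall w, (size w < N)%N -> straighten c g w = 0.
Proof.
move=> g0 w; move: {-1}(size _) (erefl (size w)) => m.
elim/ltn_ind: m w => m IH w;
  move: {-1}(inversions _) (erefl (inversions w)) => p.
elim/ltn_ind: p w => p IHp w invE sz mN.
case fw: (find_descent w) (find_descentP w) => [[[[u i] j] v]|]; last first.
  by move=> sw; rewrite straighten_sorted // g0 ?sz.
move=> [wE ji]; rewrite (straighten_step _ _ fw) /rewritten.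
have inv1 := inversions_descent u v ji; rewrite -wE in inv1.
rewrite (IHp (inversions (u ++ j :: i :: v))) // -?invE ?inv1 //; last first.
  by rewrite -sz wE !size_cat.
rewrite big1 ?addr0 // => l _.
have sz1 : (size (u ++ l :: v) < m)%N by rewrite -sz wE !size_cat /=; lia.
by rewrite (IH _ sz1) ?scaler0 //; apply: ltn_trans mN.
Qed.

(** In top degree the bracket terms are too short to count, and straightening
    merely permutes the letters. *)
Lemma straighten_top (g : seq 'I_d -> E) N :
  (forall w, (size w < N)%N -> g w = 0) ->
  (forall u i j v, size (u ++ i :: j :: v) = N ->
     g (u ++ i :: j :: v) = g (u ++ j :: i :: v)) ->
  forall w, size w = N -> straighten c g w = g w.
Proof.
move=> g0 gC w; move: {-1}(inversions _) (erefl (inversions w)) => p.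
elim/ltn_ind: p w => p IHp w invE sz.
case fw: (find_descent w) (find_descentP w) => [[[[u i] j] v]|]; last first.
  by move=> sw; rewrite straighten_sorted.
move=> [wE ji]; rewrite (straighten_step _ _ fw) /rewritten.
have inv1 := inversions_descent u v ji; rewrite -wE in inv1.
rewrite (IHp (inversions (u ++ j :: i :: v))) // -?invE ?inv1 //; last first.
  by rewrite -sz wE !size_cat.
rewrite big1 ?addr0 => [|l _]; first by rewrite -gC -wE.
rewrite (straighten_short g0) ?scaler0 // -sz wE !size_cat /=; lia.
Qed.

End StraightenDegree.

Section Symbol.
Variables (k : fieldType) (L : lieAlgType k) (d : nat) (B : lie_basis L d).
Local Notation H := (Uenv L).
Local Notation co := (bcoord B).

Section Functional.
Variables (M N : nat).

Definition symbol_word (w : seq 'I_d) : {poly k} :=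
  if size w == N then 'X^(word_weight M w) else 0.

Definition symbol_fun := functional B (straighten (structure_const B)
  symbol_word).

Definition linear_form (x : L) : {poly k} := \sum_i co x i *: 'X^(M ^ i).

(** Arguments are peeled off one at a time; the hypothesis on f is stable under
    this, with m decreasing. *)
Lemma functional_monomial f m (p : {poly k}) w : compatible B f ->
  (forall u, (size u <= m)%N ->
     f u = if size u == m then p * 'X^(word_weight M u) else 0) ->
  (size w <= m)%N ->
  functional B f (monomial w) =
    if size w == m then p * \prod_(x <- w) linear_form x else 0.
Proof.
elim: w m p f => [|x w IH] m p f fc fE wm.
  rewrite monomial0 functional1 // fE // big_nil /word_weight big_nil expr0.
  by [].
case: m fE wm => // m fE wm; rewrite monomial_cons functional_gen //.
transitivity (\sum_i co x i *: (if size w == m then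
    (p * 'X^(M ^ i)) * \prod_(y <- w) linear_form y else 0)).
  apply: eq_bigr => i _; congr (_ *: _).
  apply: IH => // [|u um]; first exact: compatible_cons.
  by rewrite fE //= eqSS /word_weight big_cons exprD mulrA.
rewrite /= eqSS; case: eqP => _; last by rewrite big1 // => i _;
  rewrite scaler0.
rewrite big_cons [in RHS]/linear_form mulrA mulr_sumr mulr_suml.
by apply: eq_bigr => i _; rewrite -scalerAr -scalerAl.
Qed.

Lemma symbol_compatible :
  compatible B (straighten (structure_const B) symbol_word).
Proof. exact: straighten_compatible. Qed.

Lemma symbol_fun_monomial w : (size w <= N)%N ->
  symbol_fun (monomial w) =
    if size w == N then \prod_(x <- w) linear_form x else 0.
Proof.
move=> wN; rewrite /symbol_fun.
rewrite (functional_monomial (m := N) (p := 1) symbol_compatible) // ?mul1r //.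
have g0 u : (size u < N)%N -> symbol_word u = 0.
  by rewrite /symbol_word ltn_neqAle => /andP[/negPf->].
move=> u uN; rewrite mul1r; case: eqP => [uE|/eqP une].
  rewrite (straighten_top B g0) // => [|v i j v' _].
    by rewrite /symbol_word uE eqxx.
  rewrite /symbol_word !size_cat /word_weight !big_cat !big_cons /=.
  by rewrite (addnCA (M ^ i)%N).
by apply: (straighten_short B g0); rewrite ltn_neqAle une.
Qed.

End Functional.

Section Coefficients.
Variable A : algType k.
Local Notation K := (tens A H).
Variables (M N : nat).

Local Notation const_poly := (map_poly (GRing.in_alg A)).

(** The part of degree N of an element of A (x) U(L) of degree at most N, as a
    polynomial in the basis vectors; the i-th variable is replaced by the power
    [M ^ i] of a single one, which loses nothing when N < M. *)
Definition symbol : K -> {poly A} :=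
  tens_lift (fun a h => a%:P * const_poly (symbol_fun M N h)).

Lemma symbol_bal :
  tens_balanced (fun (a : A) h => a%:P * const_poly (symbol_fun M N h)).
Proof.
have fc := symbol_compatible M N.
split=> [a a' h|a h h'|a r h].
- by rewrite polyCD mulrDl.
- by rewrite /symbol_fun functionalD // rmorphD mulrDr.
rewrite /kra /kla /symbol_fun functionalZ // -mul_polyC rmorphM /=.
by rewrite map_polyC /= mulrA -polyCM mulr_algr.
Qed.

Lemma symbolE a h : symbol (a \ot h) = a%:P * const_poly (symbol_fun M N h).
Proof. exact: tens_liftE symbol_bal. Qed.
Lemma symbolD u v : symbol (u + v) = symbol u + symbol v.
Proof. exact: tens_liftD symbol_bal. Qed.
Lemma symbol0 : symbol 0 = 0.
Proof. exact: tens_lift0 symbol_bal. Qed.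

Lemma symbol_monomial a w : (size w <= N)%N ->
  symbol (a \ot monomial w) =
    if size w == N then a%:P * const_poly (\prod_(x <- w) linear_form M x)
      else 0.
Proof.
move=> wN; rewrite symbolE symbol_fun_monomial //.
by case: eqP => // _; rewrite rmorph0 mulr0.
Qed.

Lemma symbol_low u : deg_lt N u -> symbol u = 0.
Proof.
move=> un; elim/deg_lt_ind: u / un => [|u v IH IH'|a w wN].
- exact: symbol0.
- by rewrite symbolD IH IH' addr0.
rewrite symbol_monomial 1?ltnW //.
by move: wN; rewrite ltn_neqAle => /andP[/negPf->].
Qed.

End Coefficients.

Section Product.
Variable A : algType k.
Local Notation K := (tens A H).
Local Notation const_poly := (map_poly (GRing.in_alg A)).

Lemma const_poly_comm (p : {poly k}) (q : {poly A}) :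
  q * const_poly p = const_poly p * q.
Proof.
elim/poly_ind: p => [|p c IH]; first by rewrite rmorph0 mulr0 mul0r.
rewrite rmorphD rmorphM /= map_polyX map_polyC /= mulrDr mulrDl mulrA IH.
rewrite -!mulrA -commr_polyX; congr (_ + _).
apply/polyP => i; rewrite coefMC coefCM.
by rewrite mulr_algl mulr_algr.
Qed.

(** In top degree, generators behave like commuting variables. *)
Lemma symbolM M n m (u v : K) : deg_lt n.+1 u -> deg_lt m.+1 v ->
  symbol M (n + m) (u * v) = symbol M n u * symbol M m v.
Proof.
move=> un vm; elim/deg_lt_ind: v / vm => [|v v' IH IH'|b w' w'm].
- by rewrite mulr0 !symbol0 mulr0.
- by rewrite mulrDr !symbolD IH IH' mulrDr.
elim/deg_lt_ind: u / un => [|u u' IH IH'|a w wn].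
- by rewrite mul0r !symbol0 mul0r.
- by rewrite mulrDl !symbolD IH IH' mulrDl.
rewrite tenpM -monomial_cat !symbol_monomial // ?size_cat ?leq_add //.
rewrite ltnS in wn; rewrite ltnS in w'm.
case: (eqVneq (size w) n) => [->|wn']; last first.
  by rewrite mul0r ifF //; apply/eqP => e; move/eqP: wn'; lia.
case: (eqVneq (size w') m) => [->|wm']; last first.
  by rewrite mulr0 ifF //; apply/eqP => e; move/eqP: wm'; lia.
rewrite eqxx big_cat !rmorphM /= -!mulrA; congr (_ * _).
by rewrite [RHS]mulrA -[in RHS]const_poly_comm mulrA.
Qed.

Local Notation sorted_word t := (sorted leq (map val t)).
Local Notation bmonomial t := (monomial (map (bvec B) t)).

Definition expandable n (u : K) : Prop :=
  exists (a : n.-tuple 'I_d -> A) (r : K),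
    u = \sum_(t : n.-tuple 'I_d | sorted_word t) a t \ot bmonomial t + r /\
      deg_lt n r.

Lemma expandableD n u v : expandable n u -> expandable n v ->
  expandable n (u + v).
Proof.
move=> [a [r [-> rn]]] [a' [r' [-> r'n]]].
exists (fun t => a t + a' t), (r + r'); split; last exact: deg_ltD.
under [in RHS]eq_bigr => t _ do rewrite tenpDl.
by rewrite big_split /= addrACA.
Qed.

Lemma expandable_low n u : deg_lt n u -> expandable n u.
Proof.
move=> un; exists (fun=> 0), u; split=> //.
by rewrite big1 ?add0r // => t _; rewrite tenp0l.
Qed.

Lemma monomial_swap (w w' : seq L) (x y : L) :
  monomial (w ++ x :: y :: w') =
  monomial (w ++ y :: x :: w') + monomial (w ++ lie x y :: w').
Proof.
rewrite !monomial_cat -mulrDr; congr (_ * _).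
rewrite !monomial_cons; have [_ ->] := Ugen_morph L.
by rewrite mulrBl !mulrA; abel.
Qed.

Lemma expandable_word n a (t : seq 'I_d) : size t = n ->
  expandable n (a \ot bmonomial t).
Proof.
move: {-1}(inversions _) (erefl (inversions t)) => p.
elim/ltn_ind: p t => p IHp t invE sz.
case ft: (find_descent t) (find_descentP t) => [[[[u i] j] v]|].
  move=> [tE ji]; have inv1 := inversions_descent u v ji; rewrite -tE in inv1.
  rewrite tE map_cat /= monomial_swap tenpDr; apply: expandableD.
    have := IHp (inversions (u ++ j :: i :: v)); rewrite -invE inv1.
    move=> /(_ (leqnn _) _ erefl); rewrite map_cat /=; apply.
    by rewrite -sz tE !size_cat.
  apply: expandable_low; apply: deg_lt_monomial.
  by rewrite -sz tE !size_cat /= !size_map; lia.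
move=> ts; exists (fun t' => if t' == in_tuple t :> seq _ then a else 0), 0.
split; last exact: deg_lt_zero.
have tn : size t == n by rewrite sz.
rewrite (bigD1 (Tuple tn)) //= eqxx big1 ?addr0 // => t' /andP[_ tt'].
by rewrite ifF ?tenp0l //; apply: contraNF tt' => /eqP e; apply/eqP/val_inj.
Qed.

Lemma expandable_monomial n a (t : seq 'I_d) (w : seq L) :
  (size t + size w)%N = n ->
  expandable n (a \ot (bmonomial t * monomial w)).
Proof.
elim: w t a => [|x w IH] t a /=.
  by rewrite addn0 monomial0 mulr1; apply: expandable_word.
move=> sz; rewrite monomial_cons (bcoordE B x).
rewrite (big_morph (@Ugen k L) (@UgenD k L) (@Ugen0 k L)) mulr_suml mulr_sumr
  tenp_sumr.
elim/big_ind: _ => [|u v|i _]; first exact/expandable_low/deg_lt_zero.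
  exact: expandableD.
rewrite UgenZ -scalerAl -scalerAr -tenpZ mulrA.
have -> : bmonomial t * Ugen (bvec B i) = bmonomial (rcons t i).
  by rewrite map_rcons -cats1 monomial_cat monomial_cons monomial0 mulr1.
by apply: IH; rewrite size_rcons addSnnS.
Qed.

(** Sorted monomials span: this is the elementary half of the theorem of
    Poincare, Birkhoff and Witt. *)
Lemma sorted_expansion n (u : K) : deg_lt n.+1 u -> expandable n u.
Proof.
move=> un; elim/deg_lt_ind: u / un => [|u v|a w wn].
- exact/expandable_low/deg_lt_zero.
- exact: expandableD.
move: wn; rewrite ltnS leq_eqVlt => /orP[/eqP wn|wn]; last first.
  exact/expandable_low/deg_lt_monomial.
by have := @expandable_monomial n a [::] w wn; rewrite monomial0 mul1r.
Qed.

Lemma symbol_sorted M n (t : n.-tuple 'I_d) (a : A) :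
  symbol M n (a \ot bmonomial t) = a *: 'X^(word_weight M t).
Proof.
rewrite symbol_monomial ?size_map ?size_tuple // eqxx -mul_polyC big_map.
congr (_ * _); rewrite /word_weight (big_morph _ (exprD _) (expr0 _)).
rewrite rmorph_prod; apply: eq_bigr => i _.
rewrite /linear_form (bigD1 i) //= bcoord_bvec eqxx scale1r.
rewrite big1 ?addr0 => [|j ji]; first by rewrite map_polyXn.
by rewrite bcoord_bvec eq_sym (negPf ji) scale0r.
Qed.

(** The symbol detects the degree: this is where the linear independence of
    sorted monomials enters. *)
Lemma symbol_eq0 M n (u : K) : (n < M)%N -> deg_lt n.+1 u -> symbol M n u = 0 ->
  deg_lt n u.
Proof.
move=> nM /sorted_expansion[a [r [-> rn]]].
rewrite symbolD (symbol_low M rn) addr0.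
rewrite (big_morph _ (symbolD _ _) (symbol0 _ _ _)).
under eq_bigr => t _ do rewrite symbol_sorted.
move=> e; rewrite big1 ?add0r // => t ts.
suff -> : a t = 0 by rewrite tenp0l.
have := congr1 (fun p : {poly A} => p`_(word_weight M t)) e.
rewrite coef0 coef_sum (bigD1 t) //= coefZ coefXn eqxx mulr1 big1 ?addr0 //.
move=> t' /andP[t's tt']; rewrite coefZ coefXn.
case: eqP => [wE|]; last by rewrite mulr0.
case/eqP: tt'; apply: val_inj; apply: (@word_weight_inj M) => //.
- by rewrite size_tuple.
- by rewrite size_tuple.
Qed.

Definition domain (R : nzRingType) := forall a b : R, a * b = 0 ->
  a = 0 \/ b = 0.

Lemma poly_domain (R : nzRingType) : domain R -> domain {poly R}.
Proof.
move=> Rd p q pq0; case: (eqVneq p 0) => [->|p0]; first by left.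
case: (eqVneq q 0) => [->|q0]; first by right.
have lpq : lead_coef p * lead_coef q != 0.
  by apply/eqP => /Rd[] /eqP; rewrite lead_coef_eq0 ?(negPf p0) ?(negPf q0).
by have := lead_coef_proper_mul lpq; move: lpq => /[swap] <-;
  rewrite pq0 lead_coef0 eqxx.
Qed.

(** Degrees add up, because symbols are multiplicative and polynomials over a
    domain form a domain. *)
Theorem deg_lt_mul n m (u v : K) : domain A ->
  deg_lt n.+1 u -> deg_lt m.+1 v -> deg_lt (n + m) (u * v) ->
  deg_lt n u \/ deg_lt m v.
Proof.
move=> Ad un vm uv; pose M := (n + m).+1.
have := symbolM M un vm; rewrite (symbol_low M uv) => /esym.
case/(poly_domain Ad) => [su|sv]; [left|right].
  by apply: symbol_eq0 su => //; rewrite /M ltnS leq_addr.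
by apply: symbol_eq0 sv => //; rewrite /M ltnS leq_addl.
Qed.

Corollary tens_domain : domain A -> domain K.
Proof.
move=> Ad u v uv0; case: (eqVneq u 0) => [->|u0]; first by left.
case: (eqVneq v 0) => [->|v0]; first by right.
have [n [un nun]] := deg_lt_min u0; have [m [vm nvm]] := deg_lt_min v0.
by case: (deg_lt_mul Ad un vm) => //; rewrite uv0; apply: deg_lt_zero.
Qed.

(** Additive maps on A (x) U(L) can be compared on sorted monomials. *)
Lemma sorted_ind (P : K -> Prop) : P 0 ->
  (forall u v, P u -> P v -> P (u + v)) ->
  (forall a (t : seq 'I_d), sorted_word t -> P (a \ot bmonomial t)) ->
  forall u, P u.
Proof.
move=> P0 PD Ps u; have [n] := deg_lt_exists u.
elim: n u => [u /deg_lt0->//|n IH u /sorted_expansion[a [r [-> rn]]]].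
apply: (PD); last exact: IH.
by elim/big_ind: _ => [//|v v'|t ts]; [apply: PD|apply: Ps].
Qed.

End Product.
End Symbol.

(** * Coefficients along a basis vector *)

Lemma lie_basis_exists (k : fieldType) (L : finLieAlgType k) (s : L) : s != 0 ->
  exists d (B : lie_basis L d.+1), bvec B ord0 = s.
Proof.
move=> s0; pose Y := vbasis (<[s]>^C)%VS; pose X := in_tuple (s :: Y).
have Xb : basis_of fullv X.
  rewrite -(addv_complf <[s]>%VS) /= -cat1s; apply: cat_basis.
  - exact/directv_addP/capv_compl.
  - exact: seq1_basis.
  - exact: vbasisP.
have Xfree := basis_free Xb.
have coordE x : x = \sum_i coord X i x *: X`_i.
  by apply: coord_span; rewrite (span_basis Xb) memvf.
have coord_lin a x y i : coord X i (a *: x + y) = a * coord X i x + coord X i y.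
  by rewrite linearP.
have coord_basis (i j : 'I_(size Y).+1) : coord X j X`_i = (i == j)%:R.
  by rewrite coord_free // eq_sym.
by exists (size Y), (LieBasis coord_lin coordE coord_basis).
Qed.

Section Counit.
Variables (k : fieldType) (L : lieAlgType k).
Local Notation H := (Uenv L).

Definition counit : H -> (k^o)%type := U_lift (fun=> 0).

Lemma counit_lie : lie_morph (fun _ : L => 0 : (k^o)%type).
Proof. by split=> [r x y|x y]; rewrite ?scaler0 ?addr0 ?mulr0 ?subr0. Qed.

Lemma counit_morph : alg_morph counit.
Proof. exact: U_lift_morph counit_lie. Qed.

Lemma counit_gen x : counit (Ugen x) = 0.
Proof. exact: U_lift_gen counit_lie. Qed.

Lemma counitM g h : counit (g * h) = counit g * counit h.
Proof. by case: counit_morph. Qed.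
Lemma counit1 : counit 1 = 1.
Proof. by case: counit_morph. Qed.
Lemma counitZ r h : counit (r *: h) = r * counit h.
Proof. exact: alg_morphZ counit_morph _ _. Qed.

Variable A : algType k.
Local Notation K := (tens A H).

Definition id_counit : K -> A := tens_lift (fun a h => (counit h : k) *: a).

Lemma id_counit_bal : tens_balanced (fun (a : A) h => (counit h : k) *: a).
Proof.
split=> [a a' h|a h h'|a r h]; first by rewrite scalerDr.
  by rewrite (alg_morphD counit_morph) scalerDl.
by rewrite /kra /kla scalerA counitZ mulrC.
Qed.

Lemma id_counitE a h : id_counit (a \ot h) = (counit h : k) *: a.
Proof. exact: tens_liftE id_counit_bal. Qed.

Lemma id_counit_morph : alg_morph id_counit.
Proof.
apply: tens_alg_morph => [u v|r a h|a h a' h'|].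
- exact: tens_liftD id_counit_bal.
- by rewrite tenpZl !id_counitE !scalerA mulrC.
- by rewrite tenpM !id_counitE counitM -scalerAl -scalerAr scalerA.
- by rewrite -tenp1 id_counitE counit1 scale1r.
Qed.

Definition counit_id : tens H A -> A := tens_lift (fun h a =>
  (counit h : k) *: a).

Lemma counit_id_bal : tens_balanced (fun h (a : A) => (counit h : k) *: a).
Proof.
split=> [h h' a|h a a'|h r a]; last 2 [by rewrite scalerDr].
  by rewrite (alg_morphD counit_morph) scalerDl.
by rewrite /kra /kla scalerA counitZ mulrC.
Qed.

Lemma counit_idE h a : counit_id (h \ot a) = (counit h : k) *: a.
Proof. exact: tens_liftE counit_id_bal. Qed.

Lemma counit_id_morph : alg_morph counit_id.
Proof.
apply: tens_alg_morph => [u v|r h a|h a h' a'|].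
- exact: tens_liftD counit_id_bal.
- by rewrite tenpZl !counit_idE counitZ scalerA.
- by rewrite tenpM !counit_idE counitM -scalerAl -scalerAr scalerA.
- by rewrite -tenp1 counit_idE counit1 scale1r.
Qed.

End Counit.

Lemma id_counit_cop (k : fieldType) (L : lieAlgType k) (h : Uenv L) :
  id_counit (cop h) = h.
Proof.
apply: (alg_morph_ext
  (alg_morph_comp (id_counit_morph L (Uenv L)) (cop_morph L)) (alg_morph_id _)).
move=> x /=; rewrite cop_gen (alg_morphD (id_counit_morph _ _)) !id_counitE.
by rewrite counit1 counit_gen scale1r scale0r addr0.
Qed.

(** U(L) is k (x) U(L), and k is a domain. *)
Lemma Uenv_domain (k : fieldType) (L : lieAlgType k) d (B : lie_basis L d) :
  domain (Uenv L).
Proof.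
have kd : domain (k^o)%type.
  by move=> a b /eqP; rewrite mulf_eq0 => /orP[]/eqP; [left|right].
have inj (h : Uenv L) : (1 : (k^o)%type) \ot h = 0 -> h = 0.
  have bal : tens_balanced (fun (c : (k^o)%type) (h : Uenv L) => (c : k) *: h).
    split=> [c c' u|c u u'|c r u]; [exact: scalerDl|exact: scalerDr|].
    by rewrite /kra /kla scalerA mulrC.
  move=> /(congr1 (tens_lift (fun (c : (k^o)%type) (h : Uenv L) =>
    (c : k) *: h))).
  by rewrite (tens_liftE _ _ bal) (tens_lift0 bal) scale1r.
move=> g h gh0; have := tens_domain B kd (a := 1 \ot g) (b := 1 \ot h).
by rewrite tenpM gh0 tenp0r => /(_ erefl)[] /inj; [left|right].
Qed.

Section PowerCoefficients.
Variables (k : fieldType) (L : lieAlgType k) (d : nat) (B : lie_basis L d.+1).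
Local Notation H := (Uenv L).
Local Notation s := (bvec B ord0).
Local Notation sorted_word t := (sorted leq (map val t)).
Local Notation bmonomial t := (monomial (map (bvec B) t)).

(** The coefficient of the m-th power of the first basis vector, with respect
    to the basis of sorted monomials. *)
Definition power_word m (w : seq 'I_d.+1) : (k^o)%type := (w == nseq m ord0)%:R.
Definition power_coef m : H -> (k^o)%type :=
  functional B (straighten (structure_const B) (power_word m)).

Lemma functional_bmonomial (E : lmodType k) (f : seq 'I_d.+1 -> E) t :
  compatible B f -> functional B f (bmonomial t) = f t.
Proof.
elim: t f => [|i t IH] f fc; first by rewrite monomial0 functional1.
rewrite /= monomial_cons functional_gen // (bigD1 i) //= bcoord_bvec eqxx.
rewrite scale1r big1 ?addr0 => [|j ji].
  by rewrite IH //; apply: compatible_cons.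
by rewrite bcoord_bvec eq_sym (negPf ji) scale0r.
Qed.

Lemma functional_short (E : lmodType k) (f : seq 'I_d.+1 -> E) m w :
  compatible B f -> (forall u, (size u < m)%N -> f u = 0) ->
  (size w < m)%N -> functional B f (monomial w) = 0.
Proof.
elim: w m f => [|x w IH] m f fc f0 wm.
  by rewrite monomial0 functional1 // f0.
case: m f0 wm => // m f0 wm;
  rewrite monomial_cons functional_gen // big1 // => i _.
rewrite (IH m) ?scaler0 // => [|u um]; first exact: compatible_cons.
exact: f0.
Qed.

Let power_compatible m := straighten_compatible B (power_word m).

Lemma power_coef_sorted m t : sorted_word t ->
  power_coef m (bmonomial t) = (t == nseq m ord0)%:R.
Proof. by move=> ts; rewrite /power_coef functional_bmonomial //
  straighten_sorted. Qed.

Variable A : algType k.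
Local Notation K := (tens A H).

Definition coef_along m : K -> A :=
  tens_lift (fun a h => (power_coef m h : k) *: a).

Lemma coef_along_bal m :
  tens_balanced (fun (a : A) h => (power_coef m h : k) *: a).
Proof.
have fc := power_compatible m.
split=> [a a' h|a h h'|a r h]; first by rewrite scalerDr.
  by rewrite /power_coef functionalD // scalerDl.
by rewrite /kra /kla scalerA /power_coef functionalZ // mulrC.
Qed.

Lemma coef_alongE m a h : coef_along m (a \ot h) = (power_coef m h : k) *: a.
Proof. exact: tens_liftE (coef_along_bal m). Qed.
Lemma coef_alongD m u v : coef_along m (u + v) = coef_along m u + coef_along m
  v.
Proof. exact: tens_liftD (coef_along_bal m). Qed.
Lemma coef_along0 m : coef_along m 0 = 0.
Proof. exact: tens_lift0 (coef_along_bal m). Qed.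
Lemma coef_alongN m u : coef_along m (- u) = - coef_along m u.
Proof.
by apply/eqP; rewrite -addr_eq0 -coef_alongD addNr coef_along0.
Qed.

Lemma coef_along_coefM m a u :
  coef_along m ((a \ot 1) * u) = a * coef_along m u.
Proof.
move: u; apply: tens_ext => [u v|u v|b h].
- by rewrite mulrDr coef_alongD.
- by rewrite coef_alongD mulrDr.
by rewrite tenpM mul1r !coef_alongE scalerAr.
Qed.

(* As s is the smallest letter, prepending it to a sorted word gives a sorted
   word. *)
Lemma coef_along_shift m u :
  coef_along m.+1 ((1 \ot Ugen s) * u) = coef_along m u.
Proof.
elim/(@sorted_ind _ _ _ B): u => [|u v IH IH'|a t ts].
- by rewrite mulr0 !coef_along0.
- by rewrite mulrDr !coef_alongD IH IH'.
rewrite tenpM mul1r -monomial_cons -(map_cons (bvec B) ord0) !coef_alongE.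
rewrite !power_coef_sorted //=.
by case: t ts.
Qed.

Lemma coef_along0_shift u : coef_along 0 ((1 \ot Ugen s) * u) = 0.
Proof.
elim/(@sorted_ind _ _ _ B): u => [|u v IH IH'|a t ts].
- by rewrite mulr0 !coef_along0.
- by rewrite mulrDr !coef_alongD IH IH' addr0.
rewrite tenpM mul1r -monomial_cons -(map_cons (bvec B) ord0) !coef_alongE.
rewrite power_coef_sorted ?scale0r //.
by case: t ts.
Qed.

Lemma coef_along_low m u : deg_lt m u -> coef_along m u = 0.
Proof.
move=> um; elim/deg_lt_ind: u / um => [|u v IH IH'|a w wm].
- exact: coef_along0.
- by rewrite coef_alongD IH IH' addr0.
rewrite coef_alongE /power_coef (functional_short (m := m)) ?scale0r // => t tm.
apply: (straighten_short B (N := m)) => // t' t'm; rewrite /power_word.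
by case: eqP => // e; rewrite e size_nseq ltnn in t'm.
Qed.

Lemma coef_along_id_counit u : coef_along 0 u = id_counit u.
Proof.
elim/(@sorted_ind _ _ _ B): u => [|u v IH IH'|a t ts].
- by rewrite coef_along0 (alg_morph0 (id_counit_morph _ _)).
- by rewrite coef_alongD (alg_morphD (id_counit_morph _ _)) IH IH'.
rewrite coef_alongE id_counitE power_coef_sorted //.
case: t ts => [|i t] _ /=; first by rewrite monomial0 counit1.
by rewrite monomial_cons counitM counit_gen mul0r.
Qed.

Lemma coef_along_coef m a : coef_along m (a \ot 1) = (m == 0%N)%:R *: a.
Proof.
case: m => [|m]; last first.
  by rewrite coef_along_low ?scale0r //; apply: deg_lt_leq (deg_lt_coef _ _).
by rewrite coef_along_id_counit id_counitE counit1.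
Qed.

(** Both coefficients are read off by [coef_along]. *)
Lemma linear_in_s (a b : A) : a \ot 1 + b \ot Ugen s = 0 -> a = 0 /\ b = 0.
Proof.
have bs : b \ot Ugen s = (1 \ot Ugen s) * (b \ot 1) by rewrite tenpM mul1r
  mulr1.
move=> e; have := congr1 (coef_along 0) e; have := congr1 (coef_along 1) e.
rewrite !coef_alongD bs coef_along_shift coef_along0_shift !coef_along_coef.
by rewrite !coef_along0 /= scale0r !scale1r add0r addr0.
Qed.

End PowerCoefficients.

Section LinearInS.
Variables (k : fieldType) (L : lieAlgType k) (d : nat) (B : lie_basis L d.+1).
Hypothesis k0 : [pchar k] =i pred0.
Local Notation H := (Uenv L).
Local Notation S := (Ugen (bvec B ord0) : H).

Lemma power_coef_pow i j : power_coef B i (S ^+ j) = (i == j)%:R.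
Proof.
have E h : (power_coef B i h : k) *: (1 : H) = coef_along B i (1 \ot h).
  by rewrite coef_alongE.
have inj (x y : k) : x *: (1 : H) = y *: 1 -> x = y.
  by move=> /(congr1 (@counit k L)); rewrite !counitZ counit1 !mulr1.
apply: (inj); rewrite E; elim: j i {E} => [|j IH] i.
  by rewrite expr0 coef_along_coef.
rewrite exprS -[X in X \ot _]mul1r -tenpM; case: i => [|i].
  by rewrite coef_along0_shift scale0r.
by rewrite coef_along_shift IH.
Qed.

(** Reading off the coefficients of powers of s in the second factor shows that
    c is a polynomial p(s) with s p'(s) = p(s) - p(0); in characteristic zero,
    p has degree at most 1. *)
Lemma linear_of_cocycle (c : H) :
  (1 \ot S - S \ot 1) * cop c = 1 \ot (c * S) - (c * S) \ot 1 ->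
  exists l c0 : k, c = l *: S + c0%:A.
Proof.
move=> e; pose D m h := coef_along B m (cop h).
pose mu m : k := power_coef B m.+1 (c * S).
have DE m : D m c = (mu m)%:A + S * D m.+1 c.
  have := congr1 (coef_along B m.+1) e.
  rewrite mulrBl !coef_alongD !coef_alongN coef_along_shift coef_along_coefM.
  by rewrite coef_alongE coef_along_coef scale0r subr0 => /eqP;
    rewrite subr_eq => /eqP.
have D0 h : D 0 h = h by rewrite /D coef_along_id_counit id_counit_cop.
have D1S h : D 1 (S * h) = h + S * D 1 h.
  have copM : cop (S * h) = cop S * cop h by case: (cop_morph L) => _ ->.
  rewrite /D copM cop_gen mulrDl coef_alongD coef_along_coefM coef_along_shift.
  by rewrite addrC; congr (_ + _); apply: D0.
have DD m g h : D m (g + h) = D m g + D m h.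
  by rewrite /D (alg_morphD (cop_morph L)) coef_alongD.
have DZ r h : D 1 (r *: h) = r *: D 1 h.
  rewrite -mulr_algl /D.
  have -> : cop (r%:A * h) = (r%:A \ot 1) * cop h.
    case: (cop_morph L) => cl -> _; congr (_ * _).
    by rewrite (alg_morphZ (cop_morph L)) cop1 -tenp1 tenpZl.
  by rewrite coef_along_coefM mulr_algl.
have D1pow j : D 1 (S ^+ j) = j%:R *: S ^+ j.-1.
  elim: j => [|j IH].
    by rewrite expr0 /D cop1 -tenp1 coef_along_coef !scale0r.
  rewrite exprS D1S IH /= -scalerAr.
  case: j {IH} => [|j]; first by rewrite scale0r addr0 scale1r.
  by rewrite -exprS /= -[X in X + _]scale1r -scalerDl nat1r.
have [N cN] := deg_lt_exists (cop c).
have DN : D N c = 0 by apply: coef_along_low.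
have cE : c = \sum_(j < N) mu j *: S ^+ j.
  have H m p : (m + p)%N = N -> D m c = \sum_(j < p) mu (m + j)%N *: S ^+ j.
    elim: p m => [|p IH] m; first by rewrite addn0 big_ord0 => ->.
    rewrite addnS -addSn => mp; rewrite DE IH // big_ord_recl addn0 expr0.
    congr (_ + _); rewrite mulr_sumr; apply: eq_bigr => j _.
    by rewrite -scalerAr -exprS addSnnS.
  by rewrite -[LHS]D0 (H 0%N N).
have cE' : c = (mu 0%N)%:A + \sum_(j < N) (j%:R * mu j) *: S ^+ j.
  rewrite -[LHS]D0 DE; congr (_ + _); rewrite {1}cE.
  have D10 : D 1 0 = 0 by rewrite -(scale0r 0) DZ !scale0r.
  rewrite (big_morph (D 1) (DD 1) D10) mulr_sumr; apply: eq_bigr => j _.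
  rewrite DZ D1pow -!scalerAr scalerA mulrC.
  by case: (nat_of_ord j) => [|i]; [rewrite !mul0r !scale0r|rewrite exprS].
pose P i : H -> k := power_coef B i.
have fc i := straighten_compatible B (power_word k (d := d) i).
have PD i g h : P i (g + h) = P i g + P i h by apply: functionalD (fc i) _ _.
have PZ i r h : P i (r *: h) = r * P i h by apply: functionalZ (fc i) _ _.
have P0 i : P i 0 = 0 by rewrite -(scale0r (0 : H)) PZ mul0r.
have Psum i (f : nat -> k) :
    P i (\sum_(j < N) f j *: S ^+ j) = if (i < N)%N then f i else 0.
  rewrite (big_morph (P i) (PD i) (P0 i)).
  under eq_bigr => j _ do rewrite PZ /P power_coef_pow.
  case: ltnP => iN; last first.
    rewrite big1 // => j _; case: eqP => [ij|_]; last by rewrite mulr0.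
    by move: (ltn_ord j); rewrite -ij ltnNge iN.
  rewrite (bigD1 (Ordinal iN)) //= eqxx mulr1 big1 ?addr0 // => j ji.
  case: eqP => [ij|_]; last by rewrite mulr0.
  by case/eqP: ji; apply: val_inj.
have mu0 i : (i.+2 < N)%N -> mu i.+2 = 0.
  move=> iN; have := congr1 (P i.+2) cE';
    rewrite {1}cE PD (Psum _ mu) (Psum _ (fun j => j%:R * mu j)) iN PZ.
  rewrite -(expr0 S) /P power_coef_pow mulr0 add0r => {}e.
  have : (1 - i.+2%:R) * mu i.+2 == 0 by rewrite mulrBl mul1r subr_eq0;
    apply/eqP.
  rewrite mulf_eq0 subr_eq0 => /orP[|/eqP//].
  rewrite eq_sym -subr_eq0 -natr1 addrK.
  by rewrite (pcharf0P k).1.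
exists (if (1 < N)%N then mu 1%N else 0), (mu 0%N).
rewrite [LHS]cE' addrC; congr (_ + _); case: ltnP => N1.
  rewrite (bigD1 (Ordinal N1)) //= mul1r expr1 big1 ?addr0 // => j j1.
  case: j j1 => [[|[|j]] jN] //=; first by rewrite mul0r scale0r.
  by rewrite mu0 // mulr0 scale0r.
rewrite scale0r big1 // => j _; have := leq_trans (ltn_ord j) N1.
by case: (nat_of_ord j) => // _; rewrite mul0r scale0r.
Qed.

End LinearInS.

(** * The pre-Lie identity in coordinates *)

Section Placement.
Variables (k : fieldType) (A B K : algType k).
Variables (al : A -> K) (be : B -> K).
Hypotheses (alM : alg_morph al) (beM : alg_morph be).

(** Written [u(al, be)] in formulas such as u(x, y + z): the two tensor factors
    of u are sent into a common algebra along al and be. *)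
Definition place (u : tens A B) : K := tens_lift (fun a b => al a * be b) u.

Lemma place_bal : tens_balanced (fun a b => al a * be b).
Proof.
split=> [a a' b|a b b'|a c b].
- by rewrite (alg_morphD alM) mulrDl.
- by rewrite (alg_morphD beM) mulrDr.
by rewrite /kra /kla (alg_morphZ alM) (alg_morphZ beM) -scalerAl -scalerAr.
Qed.

Lemma placeE a b : place (a \ot b) = al a * be b.
Proof. exact: tens_liftE place_bal. Qed.

Lemma placeD u v : place (u + v) = place u + place v.
Proof. exact: tens_liftD place_bal. Qed.

Hypothesis comm : forall a b, be b * al a = al a * be b.

Lemma place_morph : alg_morph place.
Proof.
apply: tens_alg_morph => [u v|c a b|a b a' b'|].
- exact: placeD.
- by rewrite tenpZl !placeE (alg_morphZ alM) scalerAl.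
- rewrite tenpM !placeE; case: alM => _ -> _; case: beM => _ -> _.
  by rewrite -!mulrA; congr (_ * _); rewrite !mulrA comm.
- by rewrite -tenp1 placeE; case: alM => _ _ ->; case: beM => _ _ ->;
  rewrite mulr1.
Qed.

End Placement.

Lemma alg_morph_place (k : fieldType) (A B K K' : algType k)
    (al : A -> K) (be : B -> K) (g : K -> K') u :
  alg_morph al -> alg_morph be -> alg_morph g ->
  g (place al be u) = place (g \o al) (g \o be) u.
Proof.
move=> alM beM gM.
have gal := alg_morph_comp gM alM; have gbe := alg_morph_comp gM beM.
move: u; apply: tens_ext => [u v|u v|a b].
- by rewrite (placeD alM beM) (alg_morphD gM).
- exact: placeD gal gbe _ _.
by rewrite (placeE alM beM) (placeE gal gbe); case: gM => _ ->.
Qed.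

Lemma eq_place (k : fieldType) (A B K : algType k) (al al' : A -> K)
    (be be' : B -> K) u :
  al =1 al' -> be =1 be' -> place al be u = place al' be' u.
Proof. by move=> /boolp.funext-> /boolp.funext->. Qed.

Section Slots.
Variables (k : fieldType) (L : lieAlgType k).
Local Notation H := (Uenv L).
Local Notation H2 := (tens H H).
Local Notation H3 := (tens H2 H).

(** The embeddings of H into its third tensor power: x, y, z are the factors,
    and x + y, y + z, x + z precede them by the coproduct. *)
Definition slot_x (h : H) : H3 := (h \ot 1) \ot 1.
Definition slot_y (h : H) : H3 := (1 \ot h) \ot 1.
Definition slot_z (h : H) : H3 := 1 \ot h.
Definition slot_xy (h : H) : H3 := cop h \ot 1.
Definition slot_yz (h : H) : H3 := one_ot (cop h).
Definition slot_xz (h : H) : H3 := swap12 (slot_yz h).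

Lemma cop_id_cop (s : H2) r : cop_id (s * cop r) = cop_id s * cop3 r.
Proof. by have [_ -> _] := cop_id_morph L. Qed.
Lemma id_cop_cop (s : H2) r : id_cop (s * cop r) = id_cop s * cop3 r.
Proof. by have [_ -> _] := id_cop_morph L; rewrite cop_coassoc. Qed.
Lemma swap12_cop (s : H3) r : swap12 (s * cop3 r) = swap12 s * cop3 r.
Proof. by have [_ -> _] := swap12_morph L; rewrite swap12_cop3. Qed.

Lemma tenp_l_morph (A B : algType k) : alg_morph (fun a : A => a \ot (1 : B)).
Proof.
by split=> [c a a'|a a'|//]; rewrite ?tenpDl ?tenpZl // tenpM mulr1.
Qed.
Lemma tenp_r_morph (A B : algType k) : alg_morph (fun b : B => (1 : A) \ot b).
Proof.
by split=> [c b b'|b b'|//]; rewrite ?tenpDr ?tenpZr // tenpM mulr1.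
Qed.

Lemma one_ot_morph : alg_morph (@one_ot k L).
Proof. exact: alg_morph_comp (@tens_assoc_morph _ _ _ _) (tenp_r_morph _ _).
  Qed.

Lemma slot_x_morph : alg_morph slot_x.
Proof. exact: alg_morph_comp (tenp_l_morph H2 H) (tenp_l_morph H H). Qed.
Lemma slot_y_morph : alg_morph slot_y.
Proof. exact: alg_morph_comp (tenp_l_morph H2 H) (tenp_r_morph H H). Qed.
Lemma slot_z_morph : alg_morph slot_z.
Proof. exact: tenp_r_morph. Qed.
Lemma slot_xy_morph : alg_morph slot_xy.
Proof. exact: alg_morph_comp (tenp_l_morph H2 H) (cop_morph L). Qed.
Lemma slot_yz_morph : alg_morph slot_yz.
Proof. exact: alg_morph_comp one_ot_morph (cop_morph L). Qed.
Lemma slot_xz_morph : alg_morph slot_xz.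
Proof. exact: alg_morph_comp (swap12_morph L) slot_yz_morph. Qed.

Lemma swap_x h : swap12 (slot_x h) = slot_y h.
Proof. exact: swap12E. Qed.
Lemma swap_y h : swap12 (slot_y h) = slot_x h.
Proof. exact: swap12E. Qed.
Lemma swap_z h : swap12 (slot_z h) = slot_z h.
Proof. exact: swap12E. Qed.
Lemma swap_xy h : swap12 (slot_xy h) = slot_xy h.
Proof.
rewrite /swap12 /slot_xy (tens_mapE _ _ (tens_swap_morph H H) (alg_morph_id _)).
by rewrite cop_cocomm.
Qed.
Lemma swap_yz h : swap12 (slot_yz h) = slot_xz h.
Proof. by []. Qed.

Lemma place_xy u : place slot_x slot_y u = u \ot 1.
Proof.
move: u; apply: tens_ext => [u v|u v|a b].
- exact: placeD slot_x_morph slot_y_morph _ _.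
- exact: tenpDl.
rewrite (placeE slot_x_morph slot_y_morph).
by rewrite !tenpM !mul1r mulr1.
Qed.

Lemma place_yz u : place slot_y slot_z u = one_ot u.
Proof.
move: u; apply: tens_ext => [u v|u v|a b].
- exact: placeD slot_y_morph slot_z_morph _ _.
- exact: one_otD.
by rewrite (placeE slot_y_morph slot_z_morph) tenpM mulr1 mul1r one_otE.
Qed.

Lemma place_xy_z u : place slot_xy slot_z u = cop_id u.
Proof.
move: u; apply: tens_ext => [u v|u v|a b].
- exact: placeD slot_xy_morph slot_z_morph _ _.
- exact: alg_morphD (cop_id_morph L) _ _.
by rewrite (placeE slot_xy_morph slot_z_morph) tenpM mulr1 mul1r cop_idE.
Qed.

Lemma slot_x_one_ot h u : slot_x h * one_ot u = tens_assoc (h \ot u).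
Proof.
rewrite -[X in X * _](tens_assocE h 1 1) tenp1 /one_ot.
by case: (@tens_assoc_morph k H H H) => _ <- _; rewrite tenpM mulr1 mul1r.
Qed.

Lemma one_ot_slot_x h u : one_ot u * slot_x h = tens_assoc (h \ot u).
Proof.
rewrite -[X in _ * X](tens_assocE h 1 1) tenp1 /one_ot.
by case: (@tens_assoc_morph k H H H) => _ <- _; rewrite tenpM mulr1 mul1r.
Qed.

Lemma place_x_yz u : place slot_x slot_yz u = id_cop u.
Proof.
move: u; apply: tens_ext => [u v|u v|a b].
- exact: placeD slot_x_morph slot_yz_morph _ _.
- exact: alg_morphD (id_cop_morph L) _ _.
by rewrite (placeE slot_x_morph slot_yz_morph) id_copE slot_x_one_ot.
Qed.

Lemma swap_place_xy u : swap12 (place slot_x slot_y u) = place slot_y slot_x u.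
Proof.
rewrite (alg_morph_place _ slot_x_morph slot_y_morph (swap12_morph L)).
exact: eq_place swap_x swap_y.
Qed.
Lemma swap_place_xy_z u : swap12 (place slot_xy slot_z u) = place slot_xy
  slot_z u.
Proof.
rewrite (alg_morph_place _ slot_xy_morph slot_z_morph (swap12_morph L)).
exact: eq_place swap_xy swap_z.
Qed.
Lemma swap_place_yz u : swap12 (place slot_y slot_z u) = place slot_x slot_z u.
Proof.
rewrite (alg_morph_place _ slot_y_morph slot_z_morph (swap12_morph L)).
exact: eq_place swap_y swap_z.
Qed.
Lemma swap_place_x_yz u : swap12 (place slot_x slot_yz u) = place slot_y
  slot_xz u.
Proof.
rewrite (alg_morph_place _ slot_x_morph slot_yz_morph (swap12_morph L)).
exact: eq_place swap_x swap_yz.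
Qed.

End Slots.

Section Coordinates.
Variables (k : fieldType) (L : lieAlgType k) (P : pseudoAlgType L) (e1 e2 : P).
Hypothesis eB : is_basis2 e1 e2.
Local Notation H := (Uenv L).
Local Notation H2 := (tens H H).
Local Notation H3 := (tens H2 H).

Definition basis2 (i : bool) : P := if i then e1 else e2.
Local Notation e := basis2.

Lemma coord2_exists : exists co : P -> H * H,
  forall x, x = (co x).1 *: e1 + (co x).2 *: e2.
Proof.
have ex x : exists h : H * H, x = h.1 *: e1 + h.2 *: e2.
  by have [h [hE _]] := eB x; exists h.
by have [co coE] := boolp.choice ex; exists co.
Qed.

Definition coord2 (i : bool) (x : P) : H :=
  let h := projT1 (boolp.cid coord2_exists) x in if i then h.1 else h.2.

Lemma coord2E x : x = coord2 true x *: e1 + coord2 false x *: e2.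
Proof. exact: projT2 (boolp.cid coord2_exists) x. Qed.

Lemma coord2_uniq x (h : bool -> H) :
  x = h true *: e1 + h false *: e2 -> forall i, coord2 i x = h i.
Proof.
have [p [_ pU]] := eB x; move=> xE.
have p1 := pU (coord2 true x, coord2 false x) (coord2E x).
have p2 := pU (h true, h false) xE.
by case; [have := congr1 fst (etrans (esym p1) p2)
         |have := congr1 snd (etrans (esym p1) p2)].
Qed.

Lemma coord2D i x y : coord2 i (x + y) = coord2 i x + coord2 i y.
Proof.
apply: (@coord2_uniq _ (fun i => coord2 i x + coord2 i y)).
by rewrite {1}(coord2E x) {1}(coord2E y) !scalerDl; abel.
Qed.

Lemma coord2Z i h x : coord2 i (h *: x) = h * coord2 i x.
Proof.
apply: (@coord2_uniq _ (fun i => h * coord2 i x)).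
by rewrite {1}(coord2E x) scalerDr !scalerA.
Qed.

Lemma coord2_basis i j : coord2 i (e j) = (i == j)%:R.
Proof.
apply: (@coord2_uniq _ (fun i => (i == j)%:R)).
by case: j; rewrite /= scale1r scale0r ?addr0 ?add0r.
Qed.

Section ExtCoord.
Variables (S : algType k) (phi : H -> S).
Hypothesis phiM : alg_morph phi.

Definition ext_coord (i : bool) : ext phi P -> S :=
  ext_lift (fun s v => s * phi (coord2 i v)).

Lemma ext_coord_bal i : ext_balanced phi (fun s v => s * phi (coord2 i v)).
Proof.
split=> [s s' v|s v v'|s r v].
- by rewrite mulrDl.
- by rewrite coord2D (alg_morphD phiM) mulrDr.
by rewrite /era /ela coord2Z; case: phiM => _ -> _; rewrite mulrA.
Qed.

Lemma ext_coordE i s v : ext_coord i (extp phi s v) = s * phi (coord2 i v).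
Proof. exact: ext_liftE (ext_coord_bal i). Qed.
Lemma ext_coordD i s t : ext_coord i (s + t) = ext_coord i s + ext_coord i t.
Proof. exact: ext_liftD (ext_coord_bal i). Qed.
Lemma ext_coord0 i : ext_coord i 0 = 0.
Proof. by apply: (addrI (ext_coord i 0)); rewrite -ext_coordD !addr0. Qed.
Lemma ext_coordN i t : ext_coord i (- t) = - ext_coord i t.
Proof. by apply/eqP; rewrite -addr_eq0 -ext_coordD addNr ext_coord0. Qed.
Lemma ext_coord_basis i s j : ext_coord i (extp phi s (e j)) = (i == j)%:R * s.
Proof.
rewrite ext_coordE coord2_basis; case: (i == j).
  by case: phiM => _ _ ->; rewrite mulr1 mul1r.
by rewrite (alg_morph0 phiM) mulr0 mul0r.
Qed.
Lemma ext_coordZ i a t : ext_coord i (a *: t) = a * ext_coord i t.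
Proof.
move: t; apply: ext_ext => [s t|s t|s v].
- by rewrite scalerDr ext_coordD.
- by rewrite ext_coordD mulrDr.
by rewrite extpZ !ext_coordE mulrA.
Qed.

Lemma ext_coord_sum t :
  t = extp phi (ext_coord true t) e1 + extp phi (ext_coord false t) e2.
Proof.
move: t; apply: ext_ext => [//|s t|s v].
  by rewrite !ext_coordD !extpDl addrACA.
rewrite !ext_coordE !extp_bal -extpDr -coord2E.
by [].
Qed.

Lemma ext_coord_eq t t' : (forall i, ext_coord i t = ext_coord i t') -> t = t'.
Proof. by move=> tt'; rewrite (ext_coord_sum t) !tt' -ext_coord_sum. Qed.

End ExtCoord.

Local Notation coord_cop := (ext_coord (phi := @cop k L)).
Local Notation coord_cop3 := (ext_coord (phi := @cop3 k L)).
Let copM := cop_morph L.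
Let cop3M := cop3_morph L.

Definition coef i j l : H2 := coord_cop l (e i ** e j).

Lemma psmul_coef i j : e i ** e j = coef i j true \otH e1 + coef i j false
  \otH e2.
Proof. exact: ext_coord_sum. Qed.

Definition assoc_coef i j h m : H3 :=
  (place (@slot_x k L) (@slot_y k L) (coef i j true) *
     place (@slot_xy k L) (@slot_z k L) (coef true h m)
   + place (@slot_x k L) (@slot_y k L) (coef i j false) *
     place (@slot_xy k L) (@slot_z k L) (coef false h m))
  - (place (@slot_y k L) (@slot_z k L) (coef j h true) *
       place (@slot_x k L) (@slot_yz k L) (coef i true m)
     + place (@slot_y k L) (@slot_z k L) (coef j h false) *
       place (@slot_x k L) (@slot_yz k L) (coef i false m)).

Definition associator (x y z : P) := psmul3l (x ** y) z - psmul3r x (y ** z).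

Lemma ext_map_coord (f : H2 -> H3) m t :
  (forall s s', f (s + s') = f s + f s') ->
  (forall s r, f (s * cop r) = f s * cop3 r) ->
  coord_cop3 m (ext_map (@cop3 k L) f t) = f (coord_cop m t).
Proof.
move=> fD fphi; move: t; apply: ext_ext => [s t|s t|s v].
- by rewrite (ext_mapD fD fphi) ext_coordD.
- by rewrite (ext_coordD copM) fD.
by rewrite (ext_mapE fD fphi) (ext_coordE cop3M) (ext_coordE copM) fphi.
Qed.

Lemma associator_coord i j h m :
  coord_cop3 m (associator (e i) (e j) (e h)) = assoc_coef i j h m.
Proof.
have cidD := alg_morphD (cop_id_morph L).
have idcD := alg_morphD (id_cop_morph L).
rewrite /associator (psmul_coef i j) (psmul_coef j h) psmul3lD psmul3rD
  !psmul3lE !psmul3rE.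
rewrite (ext_coordD cop3M) (ext_coordN cop3M) !(ext_coordD cop3M) !(ext_coordZ
  cop3M).
rewrite !(ext_map_coord _ _ cidD (@cop_id_cop k L)) !(ext_map_coord _ _ idcD
  (@id_cop_cop k L)).
by rewrite /assoc_coef !place_xy !place_yz !place_xy_z !place_x_yz.
Qed.

Lemma swap12H_coord m t : coord_cop3 m (swap12H t) = swap12 (coord_cop3 m t).
Proof.
have sD := alg_morphD (swap12_morph L).
move: t; apply: ext_ext => [s t|s t|s v].
- by rewrite /swap12H (ext_mapD sD (@swap12_cop k L)) (ext_coordD cop3M).
- by rewrite (ext_coordD cop3M) sD.
by rewrite swap12HE !(ext_coordE cop3M) (@swap12_cop k L).
Qed.

Lemma swap12HD (s t : ext (@cop3 k L) P) :
  swap12H (s + t) = swap12H s + swap12H t.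
Proof.
have sD := alg_morphD (swap12_morph L).
by apply: ext_coord_eq cop3M _ _ _ => i;
  rewrite swap12H_coord !(ext_coordD cop3M) sD !swap12H_coord.
Qed.

Lemma psmul3lDr (t : ext (@cop k L) P) (y y' : P) :
  psmul3l t (y + y') = psmul3l t y + psmul3l t y'.
Proof.
move: t; apply: ext_ext => [s t|s t|b x].
- by rewrite psmul3lD.
- by rewrite !psmul3lD addrACA.
have cidD := alg_morphD (cop_id_morph L).
by rewrite !psmul3lE psmulDr (ext_mapD cidD (@cop_id_cop k L)) scalerDr.
Qed.

Lemma psmul3rDl (t : ext (@cop k L) P) (x x' : P) :
  psmul3r (x + x') t = psmul3r x t + psmul3r x' t.
Proof.
move: t; apply: ext_ext => [s t|s t|b y].
- by rewrite psmul3rD.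
- by rewrite !psmul3rD addrACA.
have idcD := alg_morphD (id_cop_morph L).
by rewrite !psmul3rE psmulDl (ext_mapD idcD (@id_cop_cop k L)) scalerDr.
Qed.

Lemma associatorDl x x' y z :
  associator (x + x') y z = associator x y z + associator x' y z.
Proof. by rewrite /associator psmulDl psmul3lD psmul3rDl opprD addrACA. Qed.
Lemma associatorDm x y y' z :
  associator x (y + y') z = associator x y z + associator x y' z.
Proof. by rewrite /associator psmulDl psmulDr psmul3lD psmul3rD opprD addrACA.
  Qed.
Lemma associatorDr x y z z' :
  associator x y (z + z') = associator x y z + associator x y z'.
Proof. by rewrite /associator psmulDr psmul3lDr psmul3rD opprD addrACA. Qed.

Lemma associatorZ h g f x y z :
  associator (h *: x) (g *: y) (f *: z) = ((h \ot g) \ot f) *: associator x y z.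
Proof.
have cidD := alg_morphD (cop_id_morph L).
have [_ cidM _] := cop_id_morph L.
have idcD := alg_morphD (id_cop_morph L).
have [_ idcM _] := id_cop_morph L.
rewrite /associator scalerBr !psmul_bilin; congr (_ - _).
  move: (x ** y); apply: ext_ext => [s t|s t|b v].
  - by rewrite scalerDr psmul3lD.
  - by rewrite psmul3lD scalerDr.
  have := psmul_bilin 1 f v z; rewrite scale1r => vfz.
  rewrite extpZ !psmul3lE vfz (ext_mapZ cidD (@cop_id_cop k L) cidM) cop_idE
    cop1 !scalerA.
  by congr (_ *: _); rewrite !tenpM !mulr1 mul1r.
move: (y ** z); apply: ext_ext => [s t|s t|b v].
- by rewrite scalerDr psmul3rD.
- by rewrite psmul3rD scalerDr.
have := psmul_bilin h 1 x v; rewrite scale1r => hxv.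
rewrite extpZ !psmul3rE hxv (ext_mapZ idcD (@id_cop_cop k L) idcM) id_copE
  cop1 !scalerA.
have one_ot1 : one_ot 1 = 1 :> H3 by case: (one_ot_morph L).
congr (_ *: _); rewrite one_otM -slot_x_one_ot one_ot1 mulr1 -mulrA.
rewrite one_ot_slot_x -slot_x_one_ot mulrA; congr (_ * _).
by rewrite one_otE tenpM mulr1 tenpM mulr1 !mul1r.
Qed.

Lemma swap12HZ (a : H3) (t : ext (@cop3 k L) P) :
  swap12H (a *: t) = swap12 a *: swap12H t.
Proof.
have [_ sM _] := swap12_morph L.
by apply: ext_coord_eq cop3M _ _ _ => i;
  rewrite swap12H_coord !(ext_coordZ cop3M) sM swap12H_coord.
Qed.

(** By trilinearity, the pre-Lie identity need only be checked on the basis,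
    where it is an identity between the structure constants. *)
Theorem left_prelie_coef : left_prelie P <->
  forall i j h m, assoc_coef i j h m = swap12 (assoc_coef j i h m).
Proof.
split=> [pl i j h m|pl].
  by rewrite -!associator_coord -swap12H_coord; congr (coord_cop3 m _);
    apply: pl.
have base i j h : associator (e i) (e j) (e h) = swap12H (associator (e j) (e
  i) (e h)).
  by apply: ext_coord_eq cop3M _ _ _ => m;
    rewrite swap12H_coord !associator_coord; apply: pl.
have lin (Q : P -> Prop) : (forall x y, Q x -> Q y -> Q (x + y)) ->
    (forall i h, Q (h *: e i)) -> forall x, Q x.
  by move=> QD Qe x; rewrite (coord2E x); apply: QD;
    [apply: (Qe true)|apply: (Qe false)].
move=> x y z; rewrite -!/(associator _ _ _).
move: x; apply: (lin) => [x x' IH IH'|i h].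
  by rewrite associatorDl associatorDm IH IH' swap12HD.
move: y; apply: (lin) => [y y' IH IH'|j g].
  by rewrite associatorDl associatorDm IH IH' swap12HD.
move: z; apply: (lin) => [z z' IH IH'|l f].
  by rewrite !associatorDr IH IH' swap12HD.
by rewrite !associatorZ swap12HZ swap12E base.
Qed.

End Coordinates.

(** * Degrees of placements *)

Section PlacementDegree.
Variables (k : fieldType) (L : lieAlgType k).
Local Notation H := (Uenv L).
Local Notation H2 := (tens H H).
Local Notation H3 := (tens H2 H).
Local Notation X := (@slot_x k L).
Local Notation Y := (@slot_y k L).
Local Notation Z := (@slot_z k L).
Local Notation XY := (@slot_xy k L).
Local Notation YZ := (@slot_yz k L).
Local Notation XZ := (@slot_xz k L).

Lemma slot_xy_gen v : XY (Ugen v) = X (Ugen v) + Y (Ugen v).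
Proof. by rewrite /slot_xy cop_gen tenpDl. Qed.
Lemma slot_yz_gen v : YZ (Ugen v) = Y (Ugen v) + Z (Ugen v).
Proof. by rewrite /slot_yz cop_gen one_otD !one_otE. Qed.
Lemma slot_xz_gen v : XZ (Ugen v) = X (Ugen v) + Z (Ugen v).
Proof.
by rewrite /slot_xz slot_yz_gen (alg_morphD (swap12_morph L)) swap_y swap_z.
Qed.

Lemma slot_xC_y a b : Y b * X a = X a * Y b.
Proof. by rewrite !tenpM !mul1r !mulr1. Qed.
Lemma slot_xC_z a b : Z b * X a = X a * Z b.
Proof. by rewrite !tenpM !mul1r !mulr1. Qed.
Lemma slot_yC_z a b : Z b * Y a = Y a * Z b.
Proof. by rewrite !tenpM !mul1r !mulr1. Qed.
Lemma slot_xyC_z a b : Z b * XY a = XY a * Z b.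
Proof. by rewrite !tenpM !mul1r !mulr1. Qed.
Lemma slot_xC_yz a b : YZ b * X a = X a * YZ b.
Proof. by rewrite one_ot_slot_x slot_x_one_ot. Qed.

Lemma place_swap (A B K : algType k) (al : A -> K) (be : B -> K) u :
  alg_morph al -> alg_morph be -> (forall a b, be b * al a = al a * be b) ->
  place al be u = place be al (tens_swap u).
Proof.
move=> alM beM C; move: u; apply: tens_ext => [u v|u v|a b].
- exact: placeD alM beM _ _.
- by rewrite (alg_morphD (tens_swap_morph _ _)) (placeD beM alM).
by rewrite tens_swapE (placeE alM beM) (placeE beM alM) C.
Qed.

Lemma tens_swapK (A B : algType k) (u : tens A B) : tens_swap (tens_swap u) = u.
Proof.
have sD (A' B' : algType k) := alg_morphD (tens_swap_morph A' B').
move: u; apply: tens_ext => [u v|//|a b]; first by rewrite !sD.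
by rewrite !tens_swapE.
Qed.

Section Degree.
Variables (al be : H -> H3).
Hypotheses (alM : alg_morph al) (beM : alg_morph be).
Hypothesis C : forall a b, be b * al a = al a * be b.
Hypothesis al_coef : forall a, deg_lt 1 (al a).
Hypothesis be_gen : forall v, deg_lt 2 (be (Ugen v)).

Let place_coef a : place al be (a \ot 1) = al a.
Proof. by rewrite (placeE alM beM); case: beM => _ _ ->; rewrite mulr1. Qed.
Let place_gen b : place al be (1 \ot b) = be b.
Proof. by rewrite (placeE alM beM); case: alM => _ _ ->; rewrite mul1r. Qed.

Lemma deg_lt_place n u : deg_lt n u -> deg_lt n (place al be u).
Proof.
have f_coef a : deg_lt 1 (place al be (a \ot 1)) by rewrite place_coef.
have f_gen v : deg_lt 2 (place al be (1 \ot Ugen v)) by rewrite place_gen.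
exact: (deg_lt_morph (place_morph alM beM C) f_coef f_gen).
Qed.

(** Shifting the variable along which the degree is taken by another one
    changes only lower order terms. *)
Lemma deg_lt_place_diff (be' : H -> H3) n u : alg_morph be' ->
  (forall a b, be' b * al a = al a * be' b) ->
  (forall v, deg_lt 1 (be' (Ugen v) - be (Ugen v))) ->
  deg_lt n.+1 u -> deg_lt n (place al be' u - place al be u).
Proof.
move=> beM' C' be'_gen.
have f_coef a : deg_lt 1 (place al be (a \ot 1)) by rewrite place_coef.
have f_gen v : deg_lt 2 (place al be (1 \ot Ugen v)) by rewrite place_gen.
have g_coef a : place al be' (a \ot 1) = place al be (a \ot 1).
  rewrite (placeE alM beM') (placeE alM beM).
  by case: beM' => _ _ ->; case: beM => _ _ ->.
have g_gen v :
    deg_lt 1 (place al be' (1 \ot Ugen v) - place al be (1 \ot Ugen v)).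
  rewrite place_gen (placeE alM beM').
  by case: alM => _ _ ->; rewrite mul1r.
exact: (deg_lt_morph_diff (place_morph alM beM C) f_coef f_gen
  (place_morph alM beM' C') g_coef g_gen).
Qed.

End Degree.

Lemma deg_lt_x a : deg_lt 1 (X a). Proof. exact: deg_lt_coef. Qed.
Lemma deg_lt_y a : deg_lt 1 (Y a). Proof. exact: deg_lt_coef. Qed.
Lemma deg_lt_xy a : deg_lt 1 (XY a). Proof. exact: deg_lt_coef. Qed.
Lemma deg_lt_z v : deg_lt 2 (Z (Ugen v)). Proof. exact: deg_lt_gen. Qed.
Lemma deg_lt_yz v : deg_lt 2 (YZ (Ugen v)).
Proof.
rewrite slot_yz_gen; apply: deg_ltD (deg_lt_z v).
exact: deg_lt_leq (deg_lt_y _).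
Qed.
Lemma deg_lt_xz v : deg_lt 2 (XZ (Ugen v)).
Proof.
rewrite slot_xz_gen; apply: deg_ltD (deg_lt_z v).
exact: deg_lt_leq (deg_lt_x _).
Qed.

Let Xm := slot_x_morph L.
Let Ym := slot_y_morph L.
Let Zm := slot_z_morph L.
Let XYm := slot_xy_morph L.
Let YZm := slot_yz_morph L.
Let XZm := slot_xz_morph L.

Lemma slot_yC_xz a b : XZ b * Y a = Y a * XZ b.
Proof.
have [_ sM _] := swap12_morph L.
by rewrite -!swap_x -!swap_yz -!sM slot_xC_yz.
Qed.

Lemma deg_lt_place_xy u : deg_lt 1 (place X Y u).
Proof. by rewrite place_xy; apply: deg_lt_coef. Qed.
Lemma deg_lt_place_yx u : deg_lt 1 (place Y X u).
Proof.
by rewrite -swap_place_xy place_xy /swap12 tens_mapE ?tenp1 //;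
  [apply: deg_lt_coef|apply: tens_swap_morph].
Qed.
Lemma deg_lt_place_xz n u : deg_lt n u -> deg_lt n (place X Z u).
Proof. exact: (deg_lt_place Xm Zm slot_xC_z deg_lt_x deg_lt_z). Qed.
Lemma deg_lt_place_yz n u : deg_lt n u -> deg_lt n (place Y Z u).
Proof. exact: (deg_lt_place Ym Zm slot_yC_z deg_lt_y deg_lt_z). Qed.
Lemma deg_lt_place_xy_z n u : deg_lt n u -> deg_lt n (place XY Z u).
Proof. exact: (deg_lt_place XYm Zm slot_xyC_z deg_lt_xy deg_lt_z). Qed.
Lemma deg_lt_place_x_yz n u : deg_lt n u -> deg_lt n (place X YZ u).
Proof. exact: (deg_lt_place Xm YZm slot_xC_yz deg_lt_x deg_lt_yz). Qed.
Lemma deg_lt_place_y_xz n u : deg_lt n u -> deg_lt n (place Y XZ u).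
Proof. exact: (deg_lt_place Ym XZm slot_yC_xz deg_lt_y deg_lt_xz). Qed.

Lemma deg_lt_x_yz_diff n u : deg_lt n.+1 u ->
  deg_lt n (place X YZ u - place X Z u).
Proof.
apply: (deg_lt_place_diff Xm Zm slot_xC_z deg_lt_x deg_lt_z YZm slot_xC_yz).
by move=> v; rewrite slot_yz_gen addrK; apply: deg_lt_y.
Qed.
Lemma deg_lt_y_xz_diff n u : deg_lt n.+1 u ->
  deg_lt n (place Y XZ u - place Y Z u).
Proof.
apply: (deg_lt_place_diff Ym Zm slot_yC_z deg_lt_y deg_lt_z XZm slot_yC_xz).
by move=> v; rewrite slot_xz_gen addrK; apply: deg_lt_x.
Qed.

(** The counit is evaluation at zero: these maps set x, y or z to 0. *)
Definition drop_x : H3 -> H2 := tens_map (counit_id (A := H)) id.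
Definition drop_y : H3 -> H2 := tens_map (id_counit (A := H)) id.
Definition drop_z : H3 -> H2 := id_counit (A := H2).

Lemma drop_x_morph : alg_morph drop_x.
Proof. exact: tens_map_morph (counit_id_morph _ _) (alg_morph_id _). Qed.
Lemma drop_y_morph : alg_morph drop_y.
Proof. exact: tens_map_morph (id_counit_morph _ _) (alg_morph_id _). Qed.
Lemma drop_z_morph : alg_morph drop_z.
Proof. exact: id_counit_morph. Qed.

Lemma deg_lt_tens_map (A A' : algType k) (g : A -> A') n (u : tens A H) :
  alg_morph g -> deg_lt n u -> deg_lt n (tens_map g id u).
Proof.
move=> gM; have E a (b : H) : tens_map g id (a \ot b) = g a \ot b.
  exact: tens_mapE gM (alg_morph_id H).
have f_coef a : deg_lt 1 (tens_map g id (a \ot (1 : H))).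
  by rewrite E; apply: deg_lt_coef.
have f_gen (v : L) : deg_lt 2 (tens_map g id (1 \ot Ugen v)).
  by rewrite E; apply: deg_lt_gen.
exact: (deg_lt_morph (tens_map_morph gM (alg_morph_id _)) f_coef f_gen).
Qed.

Lemma deg_lt_drop_x n u : deg_lt n u -> deg_lt n (drop_x u).
Proof. exact: deg_lt_tens_map (counit_id_morph _ _). Qed.
Lemma deg_lt_drop_y n u : deg_lt n u -> deg_lt n (drop_y u).
Proof. exact: deg_lt_tens_map (id_counit_morph _ _). Qed.

Let drop_xE a b : drop_x (a \ot b) = counit_id a \ot b.
Proof. exact: tens_mapE (counit_id_morph _ _) (alg_morph_id _). Qed.
Let drop_yE a b : drop_y (a \ot b) = id_counit a \ot b.
Proof. exact: tens_mapE (id_counit_morph _ _) (alg_morph_id _). Qed.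

Lemma drop_x_x h : drop_x (X h) = (counit h : k)%:A.
Proof. by rewrite drop_xE counit_idE -tenp1 tenpZl. Qed.
Lemma drop_x_y h : drop_x (Y h) = h \ot 1.
Proof. by rewrite drop_xE counit_idE counit1 scale1r. Qed.
Lemma drop_x_z h : drop_x (Z h) = 1 \ot h.
Proof. by rewrite drop_xE -tenp1 counit_idE counit1 scale1r. Qed.
Lemma drop_y_x h : drop_y (X h) = h \ot 1.
Proof. by rewrite drop_yE id_counitE counit1 scale1r. Qed.
Lemma drop_y_y h : drop_y (Y h) = (counit h : k)%:A.
Proof. by rewrite drop_yE id_counitE -tenp1 tenpZl. Qed.
Lemma drop_y_z h : drop_y (Z h) = 1 \ot h.
Proof. by rewrite drop_yE -tenp1 id_counitE counit1 scale1r. Qed.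

Lemma drop_y_yz h : drop_y (YZ h) = 1 \ot h.
Proof.
apply: (alg_morph_ext (alg_morph_comp drop_y_morph YZm) (tenp_r_morph _ _)).
move=> v /=; rewrite slot_yz_gen (alg_morphD drop_y_morph) drop_y_y drop_y_z.
by rewrite counit_gen scale0r add0r.
Qed.
Lemma drop_x_xz h : drop_x (XZ h) = 1 \ot h.
Proof.
apply: (alg_morph_ext (alg_morph_comp drop_x_morph XZm) (tenp_r_morph _ _)).
move=> v /=; rewrite slot_xz_gen (alg_morphD drop_x_morph) drop_x_x drop_x_z.
by rewrite counit_gen scale0r add0r.
Qed.
Lemma drop_x_yz h : drop_x (YZ h) = cop h.
Proof.
apply: (alg_morph_ext (alg_morph_comp drop_x_morph YZm) (cop_morph _)).
move=> v /=; rewrite slot_yz_gen (alg_morphD drop_x_morph) drop_x_y drop_x_z.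
by rewrite cop_gen.
Qed.

Lemma drop_y_xy h : drop_y (XY h) = h \ot 1.
Proof.
apply: (alg_morph_ext (alg_morph_comp drop_y_morph XYm) (tenp_l_morph _ _)).
move=> v /=; rewrite slot_xy_gen (alg_morphD drop_y_morph) drop_y_y drop_y_x.
by rewrite counit_gen scale0r addr0.
Qed.
Lemma drop_x_xy h : drop_x (XY h) = h \ot 1.
Proof.
apply: (alg_morph_ext (alg_morph_comp drop_x_morph XYm) (tenp_l_morph _ _)).
move=> v /=; rewrite slot_xy_gen (alg_morphD drop_x_morph) drop_x_x drop_x_y.
by rewrite counit_gen scale0r add0r.
Qed.

Let place_tenp (al be : H -> H2) u :
  (forall h, al h = h \ot 1) -> (forall h, be h = 1 \ot h) -> place al be u = u.
Proof.
move=> alE beE; rewrite (eq_place u alE beE).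
have lM := tenp_l_morph H H; have rM := tenp_r_morph H H.
move: u; apply: tens_ext => [u v|//|a b]; first exact: placeD.
by rewrite placeE // tenpM mulr1 mul1r.
Qed.

Lemma drop_y_place_xz u : drop_y (place X Z u) = u.
Proof.
by rewrite (alg_morph_place u Xm Zm drop_y_morph) place_tenp //= => h;
  [apply: drop_y_x|apply: drop_y_z].
Qed.
Lemma drop_y_place_x_yz u : drop_y (place X YZ u) = u.
Proof.
by rewrite (alg_morph_place u Xm YZm drop_y_morph) place_tenp //= => h;
  [apply: drop_y_x|apply: drop_y_yz].
Qed.
Lemma drop_x_place_yz u : drop_x (place Y Z u) = u.
Proof.
by rewrite (alg_morph_place u Ym Zm drop_x_morph) place_tenp //= => h;
  [apply: drop_x_y|apply: drop_x_z].
Qed.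
Lemma drop_z_place_xy u : drop_z (place X Y u) = u.
Proof. by rewrite place_xy /drop_z id_counitE counit1 scale1r. Qed.

(** Renaming x, y, z into z, x, y turns degrees in x into degrees in the last
    factor, which is the one that [deg_lt] refers to. *)
Definition rotate : H3 -> H3 :=
  @tens_assoc k H H H \o @tens_swap k H2 H \o @tens_assoc k H H H \o
    @tens_swap k H2 H.

Lemma rotate_morph : alg_morph rotate.
Proof.
by do 3?[apply: alg_morph_comp];
  (apply: tens_assoc_morph || apply: tens_swap_morph).
Qed.

Lemma rotateE a b c : rotate ((a \ot b) \ot c) = (b \ot c) \ot a.
Proof. by rewrite /rotate /= tens_swapE tens_assocE tens_swapE tens_assocE. Qed.

Lemma rotate_x h : rotate (X h) = Z h. Proof. exact: rotateE. Qed.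
Lemma rotate_y h : rotate (Y h) = X h. Proof. exact: rotateE. Qed.
Lemma rotate_z h : rotate (Z h) = Y h. Proof. exact: rotateE. Qed.
Lemma rotate_xy h : rotate (XY h) = XZ h.
Proof.
apply: (alg_morph_ext (alg_morph_comp rotate_morph XYm) XZm) => v /=.
by rewrite slot_xy_gen (alg_morphD rotate_morph) rotate_x rotate_y slot_xz_gen
  addrC.
Qed.
Lemma rotate_yz h : rotate (YZ h) = XY h.
Proof.
apply: (alg_morph_ext (alg_morph_comp rotate_morph YZm) XYm) => v /=.
by rewrite slot_yz_gen (alg_morphD rotate_morph) rotate_y rotate_z slot_xy_gen.
Qed.
Lemma rotate_xz h : rotate (XZ h) = YZ h.
Proof.
apply: (alg_morph_ext (alg_morph_comp rotate_morph XZm) YZm) => v /=.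
by rewrite slot_xz_gen (alg_morphD rotate_morph) rotate_x rotate_z slot_yz_gen
  addrC.
Qed.

Lemma rotate_place (al be al' be' : H -> H3) u :
  alg_morph al -> alg_morph be ->
  (forall h, rotate (al h) = al' h) -> (forall h, rotate (be h) = be' h) ->
  rotate (place al be u) = place al' be' u.
Proof.
by move=> alM beM alE beE; rewrite (alg_morph_place u alM beM rotate_morph);
  apply: eq_place.
Qed.

End PlacementDegree.

(** * Solving for the coefficients of e1 * e2 on e2 and e2 * e1 on e1 *)

Section Identities.
Variable R : pzRingType.
Implicit Types x y z : R.

Lemma cancel_right x y g gyz gxz : g * y = y * g -> g * x = x * g ->
  (y - x) * g = g * gyz - g * gxz -> g * ((y - gyz) - (x - gxz)) = 0.
Proof.
move=> gy gx /eqP; rewrite -subr_eq0 => /eqP <-.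
by rewrite !mulrBr mulrBl gy gx; abel.
Qed.

Lemma cancel_left x y z cx cy cxy :
  z * x = x * z -> z * y = y * z -> z * cx = cx * z -> z * cy = cy * z ->
  cy * cx = cx * cy ->
  (y - x) * (z + cxy) = (z + cy) * (y + z + cx) - (z + cx) * (x + z + cy) ->
  (y - x) * cxy = cy * y - cx * x.
Proof.
move=> zx zy zcx zcy cyx /eqP; rewrite -subr_eq0 => /eqP e.
apply/subr0_eq; rewrite -{}e !(mulrDl, mulrDr, mulNr) zx zy zcx zcy cyx; abel.
Qed.

Lemma isolate_top x y z E0 E1 E2 E3 E4 : y * x = x * y -> z * y = y * z ->
  (x - z) * (y + E0) = (y + E1) * (x + y + E2) - (y + E3) * (y + z + E4) ->
  E3 * E4 = y * E2 + E1 * (x + y + E2) - y * E4 - E3 * y - x * E0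
    + z * (E0 - E3) + (z * E3 - E3 * z).
Proof.
move=> yx zy /eqP; rewrite -subr_eq0 => /eqP e; apply/subr0_eq; rewrite -{}e.
by rewrite !(mulrDl, mulrDr, mulNr, mulrN) yx zy; abel.
Qed.

End Identities.

Section Solve.
Variables (k : fieldType) (L : lieAlgType k) (d : nat) (B : lie_basis L d.+1).
Hypothesis k0 : [pchar k] =i pred0.
Local Notation H := (Uenv L).
Local Notation H2 := (tens H H).
Local Notation H3 := (tens H2 H).
Local Notation X := (@slot_x k L).
Local Notation Y := (@slot_y k L).
Local Notation Z := (@slot_z k L).
Local Notation XY := (@slot_xy k L).
Local Notation YZ := (@slot_yz k L).
Local Notation XZ := (@slot_xz k L).
Local Notation S := (Ugen (bvec B ord0) : H).

Let Xm := slot_x_morph L.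
Let Ym := slot_y_morph L.
Let Zm := slot_z_morph L.
Let XYm := slot_xy_morph L.
Let YZm := slot_yz_morph L.
Let XZm := slot_xz_morph L.

Lemma domain1 : domain H. Proof. exact: Uenv_domain B. Qed.
Lemma domain2 : domain H2. Proof. exact (tens_domain B domain1). Qed.
Lemma domain3 : domain H3. Proof. exact (tens_domain B domain2). Qed.

Lemma place_zy (u : H2) : place Z Y u = place Y Z (tens_swap u).
Proof. by rewrite (place_swap _ Zm Ym) // => a b; rewrite slot_yC_z. Qed.
Lemma place_z_xy (u : H2) : place Z XY u = place XY Z (tens_swap u).
Proof. by rewrite (place_swap _ Zm XYm) // => a b; rewrite slot_xyC_z. Qed.

Lemma deg_lt_place_yzN n (u : H2) : ~ deg_lt n u -> ~ deg_lt n (place Y Z u).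
Proof. by move=> un /deg_lt_drop_x; rewrite drop_x_place_yz. Qed.
Lemma deg_lt_place_x_yzN n (u : H2) : ~ deg_lt n u -> ~ deg_lt n (place X YZ u).
Proof. by move=> un /deg_lt_drop_y; rewrite drop_y_place_x_yz. Qed.
Lemma deg_lt_place_xzN n (u : H2) : ~ deg_lt n u -> ~ deg_lt n (place X Z u).
Proof. by move=> un /deg_lt_drop_y; rewrite drop_y_place_xz. Qed.

(** Degrees in x: if u has degree p in its first and q in its second argument,
    the left hand side has degree p in x and the right hand side p + q. *)
Lemma left_only_of_symmetric (u : H2) :
  place Y Z u * place X YZ u = place X Z u * place Y XZ u ->
  exists b, u = b \ot 1.
Proof.
move=> e; apply/deg_lt1P; apply: boolp.contrapT => u1.
have u0 : u != 0.
  by apply/eqP => u0; apply: u1; rewrite u0; apply: deg_lt_zero.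
have u0' : tens_swap u != 0.
  apply: contra_neq u0 => u0; rewrite -(tens_swapK u) u0.
  exact: alg_morph0 (tens_swap_morph _ _).
have [p [up nup]] := deg_lt_min u0'; have [q [uq nuq]] := deg_lt_min u0.
have q0 : (0 < q)%N by case: q uq {nuq} => // uq.
have := congr1 (@rotate k L) e; have [_ rM _] := rotate_morph L; rewrite !rM.
rewrite (rotate_place _ Ym Zm (@rotate_y k L) (@rotate_z k L)).
rewrite (rotate_place _ Xm YZm (@rotate_x k L) (@rotate_yz k L)).
rewrite (rotate_place _ Xm Zm (@rotate_x k L) (@rotate_z k L)).
rewrite (rotate_place _ Ym XZm (@rotate_y k L) (@rotate_xz k L)).
rewrite place_zy place_z_xy => {}e.
have low : deg_lt (p + q) (place Y Z (tens_swap u) * place X YZ u).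
  rewrite -e; apply: deg_ltMl (deg_lt_place_xy _) _.
  apply: deg_lt_leq (deg_lt_place_xy_z up).
  by rewrite -addn1 leq_add2l.
case: (deg_lt_mul B domain2 (deg_lt_place_yz up) (deg_lt_place_x_yz uq) low).
  exact: deg_lt_place_yzN nup.
exact: deg_lt_place_x_yzN nuq.
Qed.

Lemma place1r (al be : H -> H3) h : alg_morph al -> alg_morph be ->
  place al be (h \ot 1) = al h.
Proof. by move=> alM beM; rewrite placeE //; case: beM => _ _ ->;
  rewrite mulr1. Qed.
Lemma place1l (al be : H -> H3) h : alg_morph al -> alg_morph be ->
  place al be (1 \ot h) = be h.
Proof. by move=> alM beM; rewrite placeE //; case: alM => _ _ ->;
  rewrite mul1r. Qed.

Local Notation sx := (X S).
Local Notation sy := (Y S).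
Local Notation sz := (Z S).

Section SolveC.
Variable C : H2.
Hypothesis eC : (sy - sx) * place XY Z C =
  place Y Z C * place X YZ C - place X Z C * place Y XZ C.

(** When C depends only on its second argument, C can be cancelled. *)
Lemma solve_C_right g : C = 1 \ot g ->
  C = 0 \/ exists c, C = 1 \ot S + c \ot 1.
Proof.
move=> Cg; move: eC; rewrite Cg !place1l //= => e.
have : Z g * ((sy - YZ g) - (sx - XZ g)) = 0.
  by apply: cancel_right e; [rewrite slot_yC_z|rewrite slot_xC_z].
case/domain3 => [g0|].
  left; have := congr1 (@drop_x k L) g0.
  by rewrite drop_x_z (alg_morph0 (drop_x_morph _)).
move=> /eqP; rewrite subr_eq0 => /eqP /(congr1 (@drop_x k L)).
rewrite !(alg_morphB _ _ (drop_x_morph L)) drop_x_y drop_x_x drop_x_yz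
  drop_x_xz.
rewrite counit_gen scale0r sub0r => /(congr1 (@id_counit k L H)).
have iM := id_counit_morph L H.
rewrite (alg_morphB _ _ iM) (alg_morphN _ iM) id_counit_cop !id_counitE.
rewrite counit1 scale1r => /eqP;
  rewrite subr_eq addrC -subr_eq opprK => /eqP gE.
right; exists ((counit g : k)%:A); rewrite -{1}gE tenpDr; congr (_ + _).
by rewrite tenpZ.
Qed.

(** When C - s(y) depends only on its first argument, it is a solution of the
    cocycle equation of [linear_of_cocycle]. *)
Lemma solve_C_left c : C = 1 \ot S + c \ot 1 ->
  exists l c0 : k, c = l *: S + c0%:A.
Proof.
move=> Cc; apply: (linear_of_cocycle (B := B) k0).
move: eC; rewrite Cc !placeD // !place1l // !place1r //
  slot_yz_gen slot_xz_gen => e.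
have {}e : (sy - sx) * XY c = Y c * sy - X c * sx.
  by apply: cancel_left e; rewrite ?slot_xC_z ?slot_yC_z ?slot_xC_y.
have := congr1 (@drop_z k L) e.
have zM := drop_z_morph L; have [_ zMul _] := zM.
rewrite zMul !(alg_morphB _ _ zM) !zMul /drop_z !id_counitE !counit1 !scale1r
  => ->.
by rewrite !tenpM !mulr1.
Qed.

(** Degrees in x again, now for E = C - s(y): if E depends on both arguments,
    then E(x, z) E(y, x + z) has larger degree in x than all other terms. *)
Theorem solve_C :
  C = 0 \/ exists l c0 : k, C = 1 \ot S + l *: (S \ot 1) + c0%:A.
Proof.
suff [C0|[c Cc]] : C = 0 \/ exists c, C = 1 \ot S + c \ot 1; first by left.
  have [l [c0 cE]] := solve_C_left Cc; right; exists l, c0.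
  by rewrite Cc cE tenpDl -!tenpZl addrA.
have [E CE] : exists E, C = 1 \ot S + E.
  by exists (C - 1 \ot S); rewrite addrC subrK.
case: (boolp.pselect (deg_lt 1 E)) => [/deg_lt1P[c Ec]|E1].
  by right; exists c; rewrite CE Ec.
case: (boolp.pselect (deg_lt 1 (tens_swap E))) => [/deg_lt1P[g Eg]|E1'].
  apply: (solve_C_right (g := S + g)); rewrite tenpDr {1}CE; congr (_ + _).
  by rewrite -(tens_swapK E) Eg tens_swapE.
exfalso.
have [q [Eq nEq]] : exists q, deg_lt q.+1 E /\ ~ deg_lt q E.
  apply: deg_lt_min; apply/eqP => E0.
  by apply: E1; rewrite E0; apply: deg_lt_zero.
have [p [Ep nEp]] : exists p, deg_lt p.+1 (tens_swap E) /\
  ~ deg_lt p (tens_swap E).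
  apply: deg_lt_min; apply/eqP => E0.
  by apply: E1'; rewrite E0; apply: deg_lt_zero.
have q0 : (0 < q)%N by case: q Eq {nEq} => // Eq; case: E1.
have p0 : (0 < p)%N by case: p Ep {nEp} => // Ep; case: E1'.
have := congr1 (@rotate k L) eC; have rM := rotate_morph L.
have [_ rMul _] := rM; rewrite (alg_morphB _ _ rM) !rMul (alg_morphB _ _ rM).
rewrite rotate_x rotate_y.
rewrite (rotate_place _ XYm Zm (@rotate_xy k L) (@rotate_z k L)).
rewrite (rotate_place _ Ym Zm (@rotate_y k L) (@rotate_z k L)).
rewrite (rotate_place _ Xm YZm (@rotate_x k L) (@rotate_yz k L)).
rewrite (rotate_place _ Xm Zm (@rotate_x k L) (@rotate_z k L)).
rewrite (rotate_place _ Ym XZm (@rotate_y k L) (@rotate_xz k L)).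
rewrite CE !placeD // !place1l // slot_xy_gen slot_yz_gen => e.
set E0 := place XZ Y E in e; set E1'' := place X Y E in e.
set E2 := place Z XY E in e; set E3 := place Z Y E in e.
set E4 := place X YZ E in e.
have {}e := isolate_top (slot_xC_y S S) (slot_yC_z S S) e.
have E3p : deg_lt p.+1 E3 by rewrite /E3 place_zy; apply: deg_lt_place_yz.
have E2p : deg_lt p.+1 E2 by rewrite /E2 place_z_xy; apply: deg_lt_place_xy_z.
have E4q : deg_lt q.+1 E4 by apply: deg_lt_place_x_yz.
have E1z : deg_lt 1 E1'' by apply: deg_lt_place_xy.
have zyC a b : Y b * Z a = Z a * Y b by rewrite slot_yC_z.
have zyC' a b : Y b * XZ a = XZ a * Y b by rewrite slot_yC_xz.
have E0E : E0 = place Y XZ (tens_swap E) by rewrite /E0 (place_swap _ XZm Ym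
  zyC').
have E0p : deg_lt p.+1 E0 by rewrite E0E; apply: deg_lt_place_y_xz.
have E03 : deg_lt p (E0 - E3) by rewrite E0E /E3 place_zy;
  apply: deg_lt_y_xz_diff.
have low : deg_lt (p + q) (E3 * E4).
  have pq : (p < p + q)%N by rewrite -addn1 leq_add2l.
  have qp : (q < p + q)%N by rewrite -add1n leq_add2r.
  have sxy : deg_lt 1 (sx + sy) by apply: deg_ltD;
    [apply: deg_lt_x|apply: deg_lt_y].
  rewrite e; apply: deg_ltD; last first.
    exact: deg_lt_leq pq (deg_lt_commutator _ E3p).
  apply: deg_ltD; last first.
    case: p p0 E03 pq {Ep nEp E3p E2p E0p qp} => // p _ E03 pq.
    by apply: deg_lt_leq pq _; rewrite -(add1n p);
      apply: deg_ltM (deg_lt_z _) E03.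
  apply: deg_ltB; last exact: deg_lt_leq pq (deg_ltMl (deg_lt_x _) E0p).
  apply: deg_ltB; last exact: deg_lt_leq pq (deg_ltMr E3p (deg_lt_y _)).
  apply: deg_ltB; last exact: deg_lt_leq qp (deg_ltMl (deg_lt_y _) E4q).
  apply: deg_ltD; first exact: deg_lt_leq pq (deg_ltMl (deg_lt_y _) E2p).
  apply: (deg_ltMl E1z); apply: deg_ltD; last exact: deg_lt_leq pq E2p.
  by apply: deg_lt_leq sxy; apply: leq_ltn_trans pq.
rewrite /E3 place_zy in low.
case: (deg_lt_mul B domain2 (deg_lt_place_yz Ep) (deg_lt_place_x_yz Eq) low).
  exact: deg_lt_place_yzN nEp.
exact: deg_lt_place_x_yzN nEq.
Qed.

End SolveC.
End Solve.

(** * Solving the remaining equations *)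

Section MoreIdentities.
Variables (k : fieldType) (R : algType k).
Implicit Types (x y z : R) (l c t : k).

(** The component along e1 of the pre-Lie identity for (e1, e2, e1), solved for
    D(y, z) A(x, y + z): the other terms are affine in z. *)
Lemma isolate_DA x y z Axy Bx Dyx DA l c t :
  Axy * t%:A + Bx * (z + l *: (x + y) + c%:A)
    - ((z + l *: y + c%:A) * t%:A + DA) =
  (x + l *: y + c%:A) * t%:A + Dyx * (z + l *: (x + y) + c%:A)
    - t%:A * (x + z + l *: y + c%:A) ->
  DA = (t *: Axy + (Bx - Dyx) * (l *: (x + y) + c%:A) - t *: (l *: y + c%:A))
       + (Bx - Dyx) * z.
Proof.
move/eqP; rewrite -subr_eq0 => /eqP e; apply/esym/subr0_eq; rewrite -{}e.
rewrite !(mulrDl, mulrDr, mulNr, mulrN, mulr_algl, mulr_algr, scalerDr).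
have ct : c *: t%:A = t *: c%:A :> R by rewrite !scalerA mulrC.
by rewrite -!scalerAr ct; abel.
Qed.

(** The component along e2 of the identity for (e1, e2, e2), solved for
    A(x, z) D(y, x + z): the coefficient of z is the opposite of the previous
    one. *)
Lemma isolate_AD x z Axy Bxy Bx Cyx Dyx AD t : z * Bx = Bx * z ->
  Axy * Bxy + Bx * (z + t%:A) - (z + t%:A) * Bx =
  Cyx * Bxy + Dyx * (z + t%:A) - (AD + Bx * (x + z + t%:A)) ->
  AD = ((Cyx - Axy) * Bxy + t *: Dyx - Bx * x - t *: Bx) - (Bx - Dyx) * z.
Proof.
move=> zB /eqP; rewrite -subr_eq0 => /eqP e; apply/subr0_eq; rewrite -{}e.
rewrite !(mulrDl, mulrDr, mulNr, mulrN, mulr_algl, mulr_algr) zB.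
by abel.
Qed.

(** The component along e1 of the identity for (e1, e2, e2) when
    A = l s(y) + c and C = s(y) + l s(x) + c. *)
Lemma collect_coefs x y z l c t : z * y = y * z -> z * x = x * z ->
  (l *: y + c%:A) * (l *: z + c%:A) - (z + t%:A) * (l *: (y + z) + c%:A) =
  (x + l *: y + c%:A) * (l *: z + c%:A) - (l *: z + c%:A) * (x + z + l *: y +
    c%:A) ->
  ((l * (c - t)) *: y + (c * (c - t))%:A)
    + ((l * (l - 1)) *: y + (l * (c - t))%:A) * z = 0.
Proof.
move=> zy zx /eqP; rewrite -subr_eq0 => /eqP <-.
rewrite !(mulrDl, mulrDr, mulNr, mulrN, mulr_algl, mulr_algr, scalerDr).
rewrite -!(scalerAl, scalerAr) !scalerA !mulr1 !scalerDl !scaleNr zy zx.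
by rewrite (mulrC c l) (mulrC t l) (mulrC t c); abel.
Qed.

End MoreIdentities.

Section Forward.
Variables (k : fieldType) (L : lieAlgType k) (d : nat) (B : lie_basis L d.+1).
Hypothesis k0 : [pchar k] =i pred0.
Local Notation H := (Uenv L).
Local Notation H2 := (tens H H).
Local Notation H3 := (tens H2 H).
Local Notation X := (@slot_x k L).
Local Notation Y := (@slot_y k L).
Local Notation Z := (@slot_z k L).
Local Notation XY := (@slot_xy k L).
Local Notation YZ := (@slot_yz k L).
Local Notation XZ := (@slot_xz k L).
Local Notation S := (Ugen (bvec B ord0) : H).
Local Notation sx := (X S).
Local Notation sy := (Y S).
Local Notation sz := (Z S).

Let Xm := slot_x_morph L.
Let Ym := slot_y_morph L.
Let Zm := slot_z_morph L.
Let XYm := slot_xy_morph L.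
Let YZm := slot_yz_morph L.
Let XZm := slot_xz_morph L.

(** The form in which [linear_in_s] is used: 1 and s(z) are independent over
    the functions of x and y. *)
Lemma separate_z (U V : H3) : deg_lt 1 U -> deg_lt 1 V -> V + U * sz = 0 ->
  U = 0 /\ V = 0.
Proof.
move=> /deg_lt1P[u ->] /deg_lt1P[v ->]; rewrite tenpM mulr1 mul1r.
by case/linear_in_s => -> ->; rewrite !tenp0l.
Qed.

Lemma gen_neq0 : S != 0.
Proof.
apply/eqP => S0; have [|_ /eqP] := @linear_in_s _ _ _ B H 0 1.
  by rewrite S0 !tenp0l tenp0r addr0.
by rewrite oner_eq0.
Qed.

Lemma linear_eq0 (l c : k) : l *: S + c%:A = 0 -> l = 0 /\ c = 0.
Proof.
have cM := counit_morph L; move=> e.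
have c0 : c = 0.
  have := congr1 (@counit k L) e; rewrite (alg_morphD cM) !(alg_morphZ cM).
  by rewrite counit_gen counit1 scaler0 add0r (alg_morph0 cM) [_ *: _]mulr1.
split=> //; move: e; rewrite c0 scale0r addr0 => /eqP.
by rewrite scaler_eq0 (negPf gen_neq0) orbF => /eqP.
Qed.

Lemma slot_y_inj h h' : Y h = Y h' -> h = h'.
Proof.
move=> /(congr1 (@drop_x k L)); rewrite !drop_x_y.
by move=> /(congr1 (@id_counit k L H)); rewrite !id_counitE counit1 !scale1r.
Qed.

Lemma linear_y_eq0 (l c : k) : l *: sy + c%:A = 0 -> l = 0 /\ c = 0.
Proof.
move=> e; apply: linear_eq0; apply: slot_y_inj.
rewrite (alg_morphD Ym) !(alg_morphZ Ym) (alg_morph0 Ym).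
by case: Ym => _ _ ->.
Qed.

Lemma place_xy_inj (u v : H2) : place X Y u = place X Y v -> u = v.
Proof. by move=> /(congr1 (@drop_z k L)); rewrite !drop_z_place_xy. Qed.
Lemma place_yx_inj (u v : H2) : place Y X u = place Y X v -> u = v.
Proof.
have sw w : swap12 (place Y X w) = place X Y w.
  rewrite (alg_morph_place _ Ym Xm (swap12_morph L)).
  by apply: eq_place; [apply: swap_y|apply: swap_x].
by move=> e; apply: place_xy_inj; rewrite -!sw e.
Qed.

Lemma place0 (al be : H -> H3) : alg_morph al -> alg_morph be ->
  place al be 0 = 0.
Proof.
by move=> alM beM; apply: (addrI (place al be 0)); rewrite -placeD // !addr0.
Qed.

Lemma place_const (al be : H -> H3) (c : k) : alg_morph al -> alg_morph be ->
  place al be c%:A = c%:A.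
Proof.
move=> alM beM; rewrite -tenp1 tenpZl place1r // (alg_morphZ alM).
by case: alM => _ _ ->.
Qed.

Lemma place_affine (al be : H -> H3) (l c : k) : alg_morph al -> alg_morph be ->
  place al be (1 \ot S + l *: (S \ot 1) + c%:A) = be S + l *: al S + c%:A.
Proof.
move=> alM beM; rewrite !placeD // place1l // place_const //.
by rewrite tenpZl place1r // (alg_morphZ alM).
Qed.

Variables (t1 t2 : k) (A B' C D : H2).
Hypothesis t1_neq0 : t1 != 0.
(** [eqijh_m] is the component along e_m of the pre-Lie identity for
    (e_i, e_j, e_h). *)
Hypothesis eq112_2 :
  place Y Z B' * place X YZ B' = place X Z B' * place Y XZ B'.
Hypothesis eq221_1 : (sy - sx) * place XY Z C =
  place Y Z C * place X YZ C - place X Z C * place Y XZ C.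
Hypothesis eq121_1 :
  place X Y A * t1%:A + place X Y B' * place XY Z C
    - (place Y Z C * t1%:A + place Y Z D * place X YZ A) =
  place Y X C * t1%:A + place Y X D * place XY Z C - t1%:A * place Y XZ C.
Hypothesis eq121_2 :
  place X Y B' * place XY Z D - place Y Z D * place X YZ B' =
  place Y X D * place XY Z D - t1%:A * place Y XZ D.
Hypothesis eq122_1 :
  place X Y A * place XY Z A - (sz + t2%:A) * place X YZ A =
  place Y X C * place XY Z A - place X Z A * place Y XZ C.
Hypothesis eq122_2 :
  place X Y A * place XY Z B' + place X Y B' * (sz + t2%:A)
    - (sz + t2%:A) * place X YZ B' =
  place Y X C * place XY Z B' + place Y X D * (sz + t2%:A)
    - (place X Z A * place Y XZ D + place X Z B' * (sx + sz + t2%:A)).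

Definition classified : Prop :=
  [/\ A = 0, B' = 0, C = 0 & D = 0]
  \/ [/\ A = 0, B' = 0, C = 1 \ot S & D = 0]
  \/ [/\ A = 0, B' = t1%:A, C = 1 \ot S & D = t1%:A]
  \/ [/\ A = t2%:A, B' = 0, C = 1 \ot S + t2%:A & D = 0]
  \/ [/\ A = 1 \ot S + t2%:A, B' = 0, C = 1 \ot S + S \ot 1 + t2%:A & D = 0].

Lemma deg_sz_t2 : ~ deg_lt 1 (sz + t2%:A : H3).
Proof.
move=> h; have : deg_lt 1 (sz + t2%:A - t2%:A : H3).
  by apply: deg_ltB h (deg_lt_scalar _ _ _).
rewrite addrK => /deg_lt1P[u e].
have [|_ /eqP] := @linear_in_s _ _ _ B H2 (- u) 1.
  by rewrite tenpNl -e addNr.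
by rewrite oner_eq0.
Qed.

(** If A had degree q in its second argument, then for C = 0 the two sides of
    [eq122_1] would have degree at most q and exactly q + 1 in z. *)
Lemma A_eq0 : C = 0 -> A = 0.
Proof.
move=> C0; apply/eqP/negPn/negP => /deg_lt_min[q [Aq nAq]].
move: eq122_1; rewrite C0 !place0 // mul0r mulr0 subrr => /eqP.
rewrite subr_eq0 => /eqP e.
have low : deg_lt (1 + q) ((sz + t2%:A) * place X YZ A).
  by rewrite -e; apply: deg_ltMl (deg_lt_place_xy _) (deg_lt_place_xy_z Aq).
have sz2 : deg_lt 2 (sz + t2%:A : H3).
  by apply: deg_ltD (deg_lt_z _) (deg_lt_leq _ (deg_lt_scalar _ _ _)).
case: (deg_lt_mul B (domain2 B) sz2 (deg_lt_place_x_yz Aq) low).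
  exact: deg_sz_t2.
exact: deg_lt_place_x_yzN nAq.
Qed.

Section FixB.
Variable b : H.
Hypothesis Bb : B' = b \ot 1.

Lemma place_B (al be : H -> H3) : alg_morph al -> alg_morph be ->
  place al be B' = al b.
Proof. by move=> alM beM; rewrite Bb place1r. Qed.

Local Notation W := (X b - place Y X D).

Lemma deg_W : deg_lt 1 W.
Proof. by apply: deg_ltB (deg_lt_x _) (deg_lt_place_yx _). Qed.

Lemma eqAD : place X Z A * place Y XZ D =
  ((place Y X C - place X Y A) * XY b + t2 *: place Y X D - X b * sx - t2 *: X
    b)
  - W * sz.
Proof.
apply: isolate_AD; first by rewrite slot_xC_z.
by move: eq122_2; rewrite !place_B.
Qed.

Lemma D_of_W : W = 0 -> D = 1 \ot b.
Proof.
move=> /eqP; rewrite subr_eq0 => /eqP e; apply: place_yx_inj.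
by rewrite -e place1l.
Qed.

(** The coefficient of z in [eqAD] identifies D(y, x) with b(x), and what
    remains is b s = 0. *)
Lemma classified_C0 : C = 0 -> classified.
Proof.
move=> C0; have A0 := A_eq0 C0; have := eqAD.
rewrite A0 C0 !place0 // mul0r subrr mul0r add0r => /esym e.
have [] := @separate_z (- W) (t2 *: place Y X D - X b * sx - t2 *: X b).
- exact/deg_ltN/deg_W.
- apply: deg_ltB; last exact/deg_lt_scale/deg_lt_x.
  apply: deg_ltB; first exact/deg_lt_scale/deg_lt_place_yx.
  by apply: deg_ltMl; apply: deg_lt_x.
- by rewrite mulNr.
move=> /eqP; rewrite oppr_eq0 => /eqP W0.
have DE := D_of_W W0; rewrite DE place1l // addrAC subrr sub0r => /eqP.
rewrite oppr_eq0 => /eqP /(domain3 B)[] /(congr1 (@drop_y k L));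
  rewrite drop_y_x (alg_morph0 (drop_y_morph _)) =>
    /(congr1 (@id_counit k L H));
  rewrite id_counitE counit1 scale1r (alg_morph0 (id_counit_morph _ _)) => z0.
  by left; rewrite A0 Bb C0 DE z0 tenp0l tenp0r.
by have := gen_neq0; rewrite z0 eqxx.
Qed.

Section FixC.
Variables l c : k.
Hypothesis CE : C = 1 \ot S + l *: (S \ot 1) + c%:A.

Lemma eqDA : place Y Z D * place X YZ A =
  (t1 *: place X Y A + W * (l *: (sx + sy) + c%:A) - t1 *: (l *: sy + c%:A))
  + W * sz.
Proof.
apply: isolate_DA; move: eq121_1; rewrite CE !place_affine // !place_B //.
by rewrite slot_xy_gen slot_xz_gen.
Qed.

Let deg_affine : deg_lt 1 (l *: (sx + sy) + c%:A : H3).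
Proof.
apply: deg_ltD (deg_lt_scalar _ _ _); apply: deg_lt_scale.
by apply: deg_ltD; [apply: deg_lt_x|apply: deg_lt_y].
Qed.

Let deg_rest : deg_lt 1
  (t1 *: place X Y A + W * (l *: (sx + sy) + c%:A) - t1 *: (l *: sy + c%:A)).
Proof.
apply: deg_ltB; first apply: deg_ltD.
- exact/deg_lt_scale/deg_lt_place_xy.
- exact: deg_ltMl deg_W deg_affine.
apply: deg_lt_scale; apply: deg_ltD (deg_lt_scalar _ _ _).
exact/deg_lt_scale/deg_lt_y.
Qed.

Lemma DA_low : deg_lt 1 (place Y Z D * place X YZ A) ->
  W = 0 /\ place Y Z D * place X YZ A = t1 *: place X Y A - t1 *: (l *: sy +
    c%:A).
Proof.
move=> low; have [] := @separate_z W
  (t1 *: place X Y A + W * (l *: (sx + sy) + c%:A) - t1 *: (l *: sy + c%:A)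
   - place Y Z D * place X YZ A).
- exact: deg_W.
- exact: deg_ltB deg_rest low.
- by rewrite addrAC -eqDA subrr.
move=> W0 _; split=> //.
by rewrite eqDA W0 !mul0r !addr0.
Qed.

Lemma scale_inj (t : k) (u v : H3) : t != 0 -> t *: u - t *: v = 0 -> u = v.
Proof.
by move=> t0 /eqP; rewrite -scalerBr scaler_eq0 (negPf t0) subr_eq0 => /eqP.
Qed.

(** As A = 0, both sides of [eqDA] have degree 0 in z. This kills l and c and
    gives D(y, x) = b(x); then s(x) b(x + y) = b(x) s(x) makes b constant. *)
Lemma classified_A0 : A = 0 -> classified.
Proof.
move=> A0; have [|W0 e] := DA_low.
  by rewrite A0 place0 // mulr0; apply: deg_lt_zero.
have DE := D_of_W W0.
move: e; rewrite A0 !place0 // mulr0 => /esym /(scale_inj t1_neq0)/esym.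
case/linear_y_eq0 => l0 c0.
have CS : C = 1 \ot S by rewrite CE l0 c0 !scale0r !addr0.
have sXY : sx * XY b = X b * sx.
  have := eqAD; rewrite A0 W0 !place0 // CS DE !place1l // !mul0r !subr0.
  by rewrite addrAC addrK => /esym/eqP; rewrite subr_eq0 => /eqP.
have bS : S * b = b * S.
  have [_ dM _] := drop_y_morph L; have := congr1 (@drop_y k L) sXY.
  rewrite !dM !drop_y_x drop_y_xy !tenpM mulr1.
  by move=> /(congr1 (@id_counit k L H)); rewrite !id_counitE counit1 !scale1r.
have [_ xM _] := Xm.
have /(domain3 B)[] : sx * (XY b - X b) = 0 by rewrite mulrBr sXY -!xM bS subrr.
  move=> /(congr1 (@drop_y k L));
    rewrite drop_y_x (alg_morph0 (drop_y_morph _)).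
  move=> /(congr1 (@id_counit k L H)); rewrite id_counitE counit1 scale1r.
  by rewrite (alg_morph0 (id_counit_morph _ _)) => /eqP;
    rewrite (negPf gen_neq0).
move=> /eqP; rewrite subr_eq0 => /eqP /(congr1 (@drop_x k L)).
rewrite drop_x_xy drop_x_x; set be := (counit b : k) => bbe.
have Bbe : B' = be%:A by rewrite Bb.
have Dbe : D = be%:A.
  move: bbe => /(congr1 (@id_counit k L H)); rewrite id_counitE counit1 scale1r.
  rewrite (alg_morphZ (id_counit_morph _ _)) => bE.
  rewrite DE bE; case: (id_counit_morph L H) => _ _ ->.
  by rewrite -tenpZr.
move: eq121_2; rewrite Bbe Dbe !place_const // subrr => /esym/eqP.
rewrite -mulrBl -scalerBl mulr_algl scalerA scaler_eq0 oner_eq0 orbF.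
rewrite mulf_eq0 subr_eq0 => /orP[] /eqP bE.
  by do 2!right; left; rewrite Bbe Dbe bE.
by right; left; rewrite Bbe Dbe bE !scale0r.
Qed.

(** If D = 0, then B = 0 and A is determined by C; the identity for (e1, e2, e2)
    then leaves two possibilities for the coefficients of C. *)
Lemma classified_D0 : A != 0 -> D = 0 -> classified.
Proof.
move=> A0 D0; have [|W0 e] := DA_low.
  by rewrite D0 place0 // mul0r; apply: deg_lt_zero.
have b0 : b = 0.
  have := W0; rewrite D0 place0 // subr0 => /(congr1 (@drop_y k L)).
  rewrite drop_y_x (alg_morph0 (drop_y_morph _)) =>
    /(congr1 (@id_counit k L H)).
  by rewrite id_counitE counit1 scale1r (alg_morph0 (id_counit_morph _ _)).
have B0 : B' = 0 by rewrite Bb b0 tenp0l.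
move: e; rewrite D0 place0 // mul0r => /esym /(scale_inj t1_neq0) Axy.
have AE : A = 1 \ot (l *: S) + c%:A.
  by apply: place_xy_inj; rewrite Axy placeD // place1l // place_const //
    (alg_morphZ Ym).
have pA (al be : H -> H3) : alg_morph al -> alg_morph be ->
    place al be A = l *: be S + c%:A.
  by move=> alM beM; rewrite AE placeD // place1l // place_const //
    (alg_morphZ beM).
move: eq122_1; rewrite CE !place_affine // !pA // slot_yz_gen slot_xz_gen.
move=> /(collect_coefs (slot_yC_z S S) (slot_xC_z S S)) /separate_z[].
- exact: deg_ltD (deg_lt_scale _ (deg_lt_y _)) (deg_lt_scalar _ _ _).
- exact: deg_ltD (deg_lt_scale _ (deg_lt_y _)) (deg_lt_scalar _ _ _).
move=> /linear_y_eq0[ll lc] /linear_y_eq0[_ cc].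
move/eqP: ll; rewrite mulf_eq0 subr_eq0 => /orP[] /eqP lE.
  have cE : c = t2.
    move/eqP: cc; rewrite mulf_eq0 subr_eq0 => /orP[/eqP c0|/eqP//].
    by case/eqP: A0; rewrite AE lE c0 !scale0r tenp0r addr0.
  by do 3!right; left; rewrite AE CE lE cE !scale0r tenp0r add0r addr0.
have cE : c = t2 by move/eqP: lc; rewrite lE mul1r subr_eq0 => /eqP.
by do 4!right; rewrite AE CE lE cE !scale1r.
Qed.

Let two_neq0 : (2%:R : k) != 0.
Proof. by rewrite (pcharf0P k).1. Qed.

Lemma deg_lt_double n (u : H3) : deg_lt n (u + u) -> deg_lt n u.
Proof.
move=> /(deg_lt_scale 2%:R^-1).
by rewrite -mulr2n -scaler_nat scalerA mulVf // scale1r.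
Qed.

Lemma place_xzC_y (u : H2) a : Y a * place X Z u = place X Z u * Y a.
Proof.
have XZD := placeD Xm Zm; move: u; apply: tens_ext => [u v|u v|p q].
- by rewrite XZD mulrDr.
- by rewrite XZD mulrDl.
by rewrite (placeE Xm Zm) mulrA slot_xC_y -!mulrA -slot_yC_z.
Qed.

Lemma place_yzC_x (u : H2) a : X a * place Y Z u = place Y Z u * X a.
Proof.
have YZD := placeD Ym Zm; move: u; apply: tens_ext => [u v|u v|p q].
- by rewrite YZD mulrDr.
- by rewrite YZD mulrDl.
by rewrite (placeE Ym Zm) mulrA -slot_xC_y -!mulrA -slot_xC_z.
Qed.

(** Let n and m be the degrees of D and A in their second arguments;
  [eqDA] gives
    n + m < 2. If n + m = 1, the products on the left of [eqDA] and [eqAD] have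
    opposite coefficients of z, but the same leading term. If n = m = 0, then D
    and B are the constant t1 and the two equations give 2 t1 A = 0. *)
Lemma AD_contra : A != 0 -> D != 0 -> False.
Proof.
move=> A0 D0; have [m [Am nAm]] := deg_lt_min A0.
have [n [Dn nDn]] := deg_lt_min D0.
have DA2 : deg_lt 2 (place Y Z D * place X YZ A).
  rewrite eqDA; apply: deg_ltD; first exact: deg_lt_leq deg_rest.
  exact: deg_ltMl deg_W (deg_lt_z _).
have nm : (n + m < 2)%N.
  rewrite ltnNge; apply/negP => nm.
  case: (deg_lt_mul B (domain2 B) (deg_lt_place_yz Dn) (deg_lt_place_x_yz Am)
    (deg_lt_leq nm DA2)).
    exact: deg_lt_place_yzN nDn.
  exact: deg_lt_place_x_yzN nAm.
have sum_low : deg_lt 1 (place Y Z D * place X YZ A + place X Z A * place Y XZ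
  D).
  rewrite eqDA eqAD; set V := (V in V + W * sz); set V' := (V in V - W * sz).
  have -> : V + W * sz + (V' - W * sz) = V + V' by abel.
  apply: deg_ltD; first exact: deg_rest.
  rewrite /V'; apply: deg_ltB; last exact/deg_lt_scale/deg_lt_x.
  apply: deg_ltB; last exact: deg_ltMl (deg_lt_x _) (deg_lt_x _).
  apply: deg_ltD; last exact/deg_lt_scale/deg_lt_place_yx.
  apply: deg_ltMl; last exact: deg_lt_xy.
  exact: deg_ltB (deg_lt_place_yx _) (deg_lt_place_xy _).
case: n Dn nDn nm => [|[|n]] Dn nDn; case: m Am nAm => [|[|m]] Am nAm // _.
- have /deg_lt1P[dd Dd] := Dn; have /deg_lt1P[a Aa] := Am.
  have [|W0 e] := DA_low.
    by apply: deg_ltMl; [apply: deg_lt_place_yz|apply: deg_lt_place_x_yz].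
  have DE := D_of_W W0; set be := (counit b : k).
  have Dbe : D = be%:A.
    move: (Dd); rewrite DE => /(congr1 (@id_counit k L H)).
    rewrite !id_counitE counit1 scale1r => dE.
    by rewrite -DE Dd -dE -tenpZl.
  have bE : b = be%:A.
    have := congr1 (@counit_id k L H) (etrans (esym DE) Dbe).
    rewrite counit_idE counit1 scale1r (alg_morphZ (counit_id_morph _ _)) => ->.
    by case: (counit_id_morph L H) => _ _ ->.
  have Bbe : B' = be%:A by rewrite Bb bE -tenpZl.
  have be0 : be != 0 by apply: contraNneq D0 => be0; rewrite Dbe be0 scale0r.
  have bet1 : be = t1.
    move: eq121_2; rewrite Bbe Dbe !place_const // subrr => /esym/eqP.
    rewrite -mulrBl -scalerBl mulr_algl scalerA scaler_eq0 oner_eq0 orbF.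
    by rewrite mulf_eq0 subr_eq0 (negPf be0) orbF => /eqP.
  have lsc : l *: sy + c%:A = 0.
    move: e; rewrite Dbe place_const // Aa !place1r // mulr_algl bet1 => /eqP.
    rewrite -subr_eq0 opprB addrC subrK => /eqP e.
    by apply: (scale_inj t1_neq0); rewrite scaler0 subr0.
  have const (f : H -> H3) : alg_morph f -> f b = be%:A.
    by move=> fM; rewrite bE (alg_morphZ fM); case: fM => _ _ ->.
  have := eqAD; rewrite W0 mul0r subr0 CE place_affine // -(addrA sx) lsc addr0.
  rewrite Aa Dbe !place1r // !place_const // !const // !mulr_algr mulr_algl.
  rewrite addrAC addrK scalerBr addrAC subrr sub0r => /eqP.
  rewrite -addr_eq0 -scalerDr -mulr2n -scaler_nat !scaler_eq0 (negPf be0).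
  rewrite (negPf two_neq0) => /eqP /(congr1 (@drop_y k L)).
  rewrite drop_y_x (alg_morph0 (drop_y_morph _)) => a0.
  by move: A0; rewrite Aa a0 eqxx.
- have /deg_lt1P[dd Dd] := Dn.
  have low : deg_lt (0 + 1) (place Y Z D * place X Z A).
    apply: deg_lt_double; move: sum_low; rewrite Dd !place1r // -place_xzC_y.
    move=> sum_low; rewrite (_ :
      _ + _ = (Y dd * place X YZ A + Y dd * place X Z A)
      - Y dd * (place X YZ A - place X Z A)); last by rewrite mulrBr; abel.
    exact: deg_ltB sum_low (deg_ltMl (deg_lt_y _) (deg_lt_x_yz_diff Am)).
  case: (deg_lt_mul B (domain2 B) (deg_lt_place_yz Dn) (deg_lt_place_xz Am)
    low).
    exact: deg_lt_place_yzN nDn.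
  exact: deg_lt_place_xzN nAm.
- have /deg_lt1P[a Aa] := Am.
  have low : deg_lt (1 + 0) (place Y Z D * place X Z A).
    apply: deg_lt_double; move: sum_low; rewrite Aa !place1r // -place_yzC_x.
    move=> sum_low; rewrite (_ :
      _ + _ = (X a * place Y Z D + X a * place Y XZ D)
      - X a * (place Y XZ D - place Y Z D)); last by rewrite mulrBr; abel.
    exact: deg_ltB sum_low (deg_ltMl (deg_lt_x _) (deg_lt_y_xz_diff Dn)).
  case: (deg_lt_mul B (domain2 B) (deg_lt_place_yz Dn) (deg_lt_place_xz Am)
    low).
    exact: deg_lt_place_yzN nDn.
  exact: deg_lt_place_xzN nAm.
Qed.

End FixC.
End FixB.

Theorem classification : classified.
Proof.
have [b Bb] := left_only_of_symmetric B eq112_2.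
have [C0|[l [c CE]]] := solve_C k0 eq221_1; first exact (classified_C0 Bb C0).
case: (eqVneq A 0) => [A0|A0]; first exact (classified_A0 Bb CE A0).
case: (eqVneq D 0) => [D0|D0]; first exact (classified_D0 Bb CE A0 D0).
by have := AD_contra Bb CE A0 D0.
Qed.

End Forward.

(** * The five families are pre-Lie *)

Section Affine.
Variables (k : fieldType) (R : algType k).

(** The value of an affine function of two commuting variables, given by its
    coefficients. *)
Definition affine (u : k * k * k) (x y : R) : R :=
  u.1.1 *: x + u.1.2 *: y + u.2%:A.

Definition affine_associator (co : bool -> bool -> bool ->
  k * k * k) (x y z : R)
    i j h m : R :=
  (affine (co i j true) x y * affine (co true h m) (x + y) z
   + affine (co i j false) x y * affine (co false h m) (x + y) z)
  - (affine (co j h true) y z * affine (co i true m) x (y + z)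
     + affine (co j h false) y z * affine (co i false m) x (y + z)).

(** The structure constants of an algebra as in the theorem; a, b describe
    e1 * e2 and c, d describe e2 * e1. *)
Definition coef_table (t1 t2 : k) (a b c d : k * k * k) (i j l : bool) :=
  match i, j, l with
  | true, true, true => (0, 0, t1)
  | false, false, false => (0, 1, t2)
  | true, false, true => a
  | true, false, false => b
  | false, true, true => c
  | false, true, false => d
  | _, _, _ => (0, 0, 0)
  end.

Variables (t1 t2 : k) (x y z : R).
Hypotheses (yx : y * x = x * y) (zx : z * x = x * z) (zy : z * y = y * z).

Ltac verify :=
  do 4!case;
  rewrite /affine_associator /affine /= ?(scale0r, scale1r, add0r, addr0);
  rewrite ?(mul0r, mulr0, addr0, add0r, subr0, sub0r);
  rewrite ?(mulrDl, mulrDr, mulr_algl, mulr_algr, scalerDr) ?yx ?zx ?zy;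
  rewrite ?scalerA ?(mulrC t2 t1); try reflexivity; abel.

Local Notation table := (coef_table t1 t2).

(** The five families, in the order of the theorem. *)
Lemma affine_prelie1 i j h m :
  let co := table (0, 0, 0) (0, 0, 0) (0, 0, 0) (0, 0, 0) in
  affine_associator co x y z i j h m = affine_associator co y x z j i h m.
Proof. by move: i j h m; verify. Qed.

Lemma affine_prelie2 i j h m :
  let co := table (0, 0, 0) (0, 0, 0) (0, 1, 0) (0, 0, 0) in
  affine_associator co x y z i j h m = affine_associator co y x z j i h m.
Proof. by move: i j h m; verify. Qed.

Lemma affine_prelie3 i j h m :
  let co := table (0, 0, 0) (0, 0, t1) (0, 1, 0) (0, 0, t1) in
  affine_associator co x y z i j h m = affine_associator co y x z j i h m.
Proof. by move: i j h m; verify. Qed.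

Lemma affine_prelie4 i j h m :
  let co := table (0, 0, t2) (0, 0, 0) (0, 1, t2) (0, 0, 0) in
  affine_associator co x y z i j h m = affine_associator co y x z j i h m.
Proof. by move: i j h m; verify. Qed.

Lemma affine_prelie5 i j h m :
  let co := table (0, 1, t2) (0, 0, 0) (1, 1, t2) (0, 0, 0) in
  affine_associator co x y z i j h m = affine_associator co y x z j i h m.
Proof. by move: i j h m; verify. Qed.

End Affine.

(** * The classification *)

Section Assembly.
Variables (k : fieldType) (L : lieAlgType k) (P : pseudoAlgType L) (e1 e2 : P).
Hypothesis eB : is_basis2 e1 e2.
Local Notation H := (Uenv L).
Local Notation H2 := (tens H H).
Local Notation H3 := (tens H2 H).
Local Notation X := (@slot_x k L).
Local Notation Y := (@slot_y k L).
Local Notation Z := (@slot_z k L).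
Local Notation XY := (@slot_xy k L).
Local Notation YZ := (@slot_yz k L).
Local Notation XZ := (@slot_xz k L).
Local Notation e := (basis2 e1 e2).
Local Notation coef := (coef eB).

Let Xm := slot_x_morph L.
Let Ym := slot_y_morph L.
Let Zm := slot_z_morph L.
Let XYm := slot_xy_morph L.
Let YZm := slot_yz_morph L.
Let XZm := slot_xz_morph L.

Lemma extp0l (x : P) : 0 \otH x = 0 :> ext (@cop k L) P.
Proof. by apply: (addrI (0 \otH x)); rewrite -extpDl !addr0. Qed.

Lemma psmul_eq i j (u v : H2) :
  e i ** e j = u \otH e1 + v \otH e2 <->
  coef i j true = u /\ coef i j false = v.
Proof.
split=> [eE|[<- <-]]; last exact: psmul_coef.
have copM := cop_morph L.
have E l : coef i j l = (l == true)%:R * u + (l == false)%:R * v.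
  by rewrite /coef eE (ext_coordD eB copM) (ext_coord_basis eB copM _ _ true)
    (ext_coord_basis eB copM _ _ false).
by rewrite !E /= !mul1r !mul0r addr0 add0r.
Qed.

Lemma psmul_eq1 i j (u : H2) :
  e i ** e j = u \otH e1 <-> coef i j true = u /\ coef i j false = 0.
Proof. by rewrite -psmul_eq extp0l addr0. Qed.
Lemma psmul_eq2 i j (u : H2) :
  e i ** e j = u \otH e2 <-> coef i j true = 0 /\ coef i j false = u.
Proof. by rewrite -psmul_eq extp0l add0r. Qed.
Lemma psmul_eq0 i j :
  e i ** e j = 0 <-> coef i j true = 0 /\ coef i j false = 0.
Proof. by rewrite -psmul_eq !extp0l addr0. Qed.

Lemma swap_assoc_coef i j h m : swap12 (assoc_coef eB j i h m) =
  (place Y X (coef j i true) * place XY Z (coef true h m)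
   + place Y X (coef j i false) * place XY Z (coef false h m))
  - (place X Z (coef i h true) * place Y XZ (coef j true m)
     + place X Z (coef i h false) * place Y XZ (coef j false m)).
Proof.
have sM := swap12_morph L; have [_ sMul _] := sM; have sD := alg_morphD sM.
rewrite /assoc_coef (alg_morphB _ _ sM) !sD !sMul.
by rewrite !swap_place_xy !swap_place_xy_z !swap_place_yz !swap_place_x_yz.
Qed.

Variables (s : L).
Local Notation S := (Ugen s : H).

Definition affine2 (u : k * k * k) : H2 :=
  u.1.1 *: (S \ot 1) + u.1.2 *: (1 \ot S) + u.2%:A.

Lemma place_affine2 (al be : H -> H3) u : alg_morph al -> alg_morph be ->
  place al be (affine2 u) = affine u (al S) (be S).
Proof.
move=> alM beM; rewrite !placeD // place_const // tenpZl tenpZr.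
by rewrite place1r // place1l // (alg_morphZ alM) (alg_morphZ beM).
Qed.

(** If all structure constants are affine functions of s, the pre-Lie identity
    takes place in the commutative subalgebra generated by s(x), s(y), s(z). *)
Lemma left_prelie_affine co :
  (forall i j l, coef i j l = affine2 (co i j l)) ->
  (forall i j h m, affine_associator co (X S) (Y S) (Z S) i j h m =
     affine_associator co (Y S) (X S) (Z S) j i h m) ->
  left_prelie P.
Proof.
move=> coE pl; apply/(left_prelie_coef eB) => i j h m.
rewrite swap_assoc_coef /assoc_coef !coE !place_affine2 //.
rewrite slot_xy_gen slot_yz_gen slot_xz_gen.
by have := pl i j h m; rewrite /affine_associator (addrC (Y S) (X S)).
Qed.

End Assembly.

Theorem theorem3p19 (k : closedFieldType) (L : finLieAlgType k)
    (P : pseudoAlgType L) (e1 e2 : P) (t1 t2 : k) (s : L) :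
  [pchar k] =i pred0 ->
  is_basis2 e1 e2 ->
  t1 != 0 -> t2 != 0 -> s != 0 ->
  e1 ** e1 = t1%:A \ot 1 \otH e1 ->
  e2 ** e2 = (1 \ot Ugen s + t2%:A) \otH e2 ->
  left_prelie P <->
    (e1 ** e2 = 0 /\ e2 ** e1 = 0)
    \/ (e1 ** e2 = 0 /\ e2 ** e1 = 1 \ot Ugen s \otH e1)
    \/ (e1 ** e2 = t1%:A \ot 1 \otH e2 /\
        e2 ** e1 = 1 \ot Ugen s \otH e1 + t1%:A \ot 1 \otH e2)
    \/ (e1 ** e2 = t2%:A \ot 1 \otH e1 /\
        e2 ** e1 = (1 \ot Ugen s + t2%:A) \otH e1)
    \/ (e1 ** e2 = (1 \ot Ugen s + t2%:A) \otH e1 /\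
        e2 ** e1 = (1 \ot Ugen s + Ugen s \ot 1 + t2%:A) \otH e1).
Proof.
move=> k0 eB t1_neq0 t2_neq0 s0 e11 e22.
have [d [B Bs]] := lie_basis_exists s0.
have constE (t : k) : t%:A \ot 1 = t%:A :> tens (Uenv L) (Uenv L).
  by rewrite -tenpZl.
pose co := coef eB.
have [c111 c112] : co true true true = t1%:A /\ co true true false = 0.
  by apply/(psmul_eq1 eB); rewrite -constE.
have [c221 c222] : co false false true = 0 /\
    co false false false = 1 \ot Ugen s + t2%:A.
  exact/(psmul_eq2 eB).
pose A := co true false true; pose B' := co true false false.
pose C := co false true true; pose D := co false true false.
split=> [/(left_prelie_coef eB) pl|].
  have Xm := slot_x_morph L; have Ym := slot_y_morph L.
  have Zm := slot_z_morph L; have XYm := slot_xy_morph L.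
  have YZm := slot_yz_morph L; have XZm := slot_xz_morph L.
  have eqs i j h m := etrans (pl i j h m) (swap_assoc_coef eB i j h m).
  rewrite /assoc_coef -/co in eqs.
  have pl22 (al be : Uenv L -> tens (tens (Uenv L) (Uenv L)) (Uenv L)) :
      alg_morph al -> alg_morph be ->
      place al be (1 \ot Ugen s + t2%:A) = be (Ugen s) + t2%:A.
    by move=> alM beM; rewrite placeD // place1l // place_const.
  have e112_2 := eqs true true false false.
  rewrite c111 c112 !place0 // !place_const //
    ?(mul0r, mulr0, addr0, add0r) in e112_2.
  move/addrI/oppr_inj: e112_2 => e112_2.
  have e221_1 := eqs false false true true.
  rewrite c221 c222 !place0 // !pl22 // ?(mul0r, mulr0, addr0, add0r) in e221_1.
  have {}e221_1 : (slot_y (Ugen s) - slot_x (Ugen s)) * place (@slot_xy k L)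
    (@slot_z k L) C
      = place (@slot_y k L) (@slot_z k L) C * place (@slot_x k L) (@slot_yz k
        L) C
        - place (@slot_x k L) (@slot_z k L) C * place (@slot_y k L) (@slot_xz
          k L) C.
    move/eqP: e221_1; rewrite -subr_eq0 => /eqP e221_1; apply/subr0_eq;
      rewrite -e221_1.
    by rewrite /C mulrBl !mulrDl; abel.
  have e121_1 := eqs true false true true.
  rewrite c111 c112 c221 !place0 // !place_const //
    ?(mul0r, mulr0, addr0, add0r) in e121_1.
  have e121_2 := eqs true false true false.
  rewrite c111 c112 !place0 // !place_const //
    ?(mul0r, mulr0, addr0, add0r) in e121_2.
  have e122_1 := eqs true false false true.
  rewrite c221 c222 !place0 // !pl22 // ?(mul0r, mulr0, addr0, add0r) in e122_1.
  have e122_2 := eqs true false false false.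
  rewrite c221 c222 !place0 // !pl22 //
    slot_xz_gen ?(mul0r, mulr0, addr0, add0r) in e122_2.
  subst s.
  have cl := classification k0 t1_neq0 e112_2 e221_1 e121_1 e121_2 e122_1
    e122_2.
  case: cl => [[a0 b0 c0 d0]|[[a0 b0 c0 d0]|[[a0 b0 c0 d0]|
    [[a0 b0 c0 d0]|[a0 b0 c0 d0]]]]].
  - by left; split; [apply/(psmul_eq0 eB true false)
      |apply/(psmul_eq0 eB false true)].
  - by right; left; split; [apply/(psmul_eq0 eB true false)
      |apply/(psmul_eq1 eB false true)].
  - do 2!right; left; rewrite constE.
    by split; [apply/(psmul_eq2 eB true false)|apply/(psmul_eq eB false true)].
  - do 3!right; left; rewrite constE.
    by split; [apply/(psmul_eq1 eB true false)|apply/(psmul_eq1 eB false true)].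
  - do 4!right.
    by split; [apply/(psmul_eq1 eB true false)|apply/(psmul_eq1 eB false true)].
have main a b c d' : A = affine2 s a -> B' = affine2 s b ->
    C = affine2 s c -> D = affine2 s d' ->
    (forall i j h m, let co := coef_table t1 t2 a b c d' in
      affine_associator co (slot_x (Ugen s)) (slot_y (Ugen s)) (slot_z (Ugen
        s)) i j h m =
      affine_associator co (slot_y (Ugen s)) (slot_x (Ugen s)) (slot_z (Ugen
        s)) j i h m) ->
    left_prelie P.
  move=> AE BE CE DE; apply: (left_prelie_affine (eB := eB)) => i j l.
  case: i; case: j; case: l => //=;
    rewrite /affine2 /= ?scale0r ?scale1r ?add0r //.
have yx := slot_xC_y (Ugen s) (Ugen s).
have zx := slot_xC_z (Ugen s) (Ugen s).
have zy := slot_yC_z (Ugen s) (Ugen s).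
have af0 : affine2 s (0, 0, 0) = 0 by rewrite /affine2 !scale0r !addr0.
have aft t : affine2 s (0, 0, t) = t%:A by rewrite /affine2 !scale0r !add0r.
have afs t : affine2 s (0, 1, t) = 1 \ot Ugen s + t%:A.
  by rewrite /affine2 scale0r scale1r add0r.
have afs0 : affine2 s (0, 1, 0) = 1 \ot Ugen s by rewrite afs scale0r addr0.
case=> [[]|[[]|[[]|[[]|[]]]]].
- move=> /(psmul_eq0 eB true false)[a0 b0] /(psmul_eq0 eB false true)[c0 d0].
  by apply: (main (0, 0, 0) (0, 0, 0) (0, 0, 0) (0, 0, 0)); rewrite ?af0 //;
    apply: affine_prelie1.
- move=> /(psmul_eq0 eB true false)[a0 b0] /(psmul_eq1 eB false true)[c0 d0].
  by apply: (main (0, 0, 0) (0, 0, 0) (0, 1, 0) (0, 0, 0));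
    rewrite ?af0 ?afs0 //;
    apply: affine_prelie2.
- rewrite constE.
  move=> /(psmul_eq2 eB true false)[a0 b0] /(psmul_eq eB false true)[c0 d0].
  by apply: (main (0, 0, 0) (0, 0, t1) (0, 1, 0) (0, 0, t1));
    rewrite ?af0 ?afs0 ?aft //; apply: affine_prelie3.
- rewrite constE.
  move=> /(psmul_eq1 eB true false)[a0 b0] /(psmul_eq1 eB false true)[c0 d0].
  by apply: (main (0, 0, t2) (0, 0, 0) (0, 1, t2) (0, 0, 0));
    rewrite ?af0 ?afs ?aft //; apply: affine_prelie4.
move=> /(psmul_eq1 eB true false)[a0 b0] /(psmul_eq1 eB false true)[c0 d0].
apply: (main (0, 1, t2) (0, 0, 0) (1, 1, t2) (0, 0, 0)); rewrite ?af0 ?afs //.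
  by rewrite [LHS]c0 /affine2 !scale1r; congr (_ + _); rewrite addrC.
exact: affine_prelie5.
Qed.
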